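(* Assume that there exists a constant $\delta\in(0,1]$ such that $\mathbb{E}[M_{1,0}^{2+\delta}+M_{2,0}^{2+\delta}]<\infty$, and that there exists a constant $p>1$ such that $$\mathbb{E}\Big[\frac{Z_{1,1}^p}{m_{1,0}^p}+\frac{Z_{2,1}^p}{m_{2,0}^p}\Big]<\infty.$$ Then there is a constant $C>0$, not depending on $m,n$, such that for all integers $m,n\ge1$, $$d_w(R_{m,n})\le\frac{C}{(m\wedge n)^{\delta/2}}.$$
   Context: Setting. Write $\mathbb{N}$ for the natural numbers, $m\wedge n=\min\{m,n\}$, $\ln^+x=\max\{\ln x,0\}$, and $\Phi$ for the standard normal distribution function. Let $((\xi_{1,n},\xi_{2,n})^T)_{n\ge0}$ be a sequence of i.i.d. random vectors in $\mathbb{R}^2$ (the environments; for fixed $n$, $\xi_{1,n}$ and $\xi_{2,n}$ may be dependent). For $l=1,2$, each realization of $\xi_{l,n}$ determines a probability law $p(\xi_{l,n})=\{p_k(\xi_{l,n}):k\in\mathbb{N}\}$ on the nonnegative integers. The two branching processes in random environment are $$Z_{l,0}=1,\qquad Z_{l,n+1}=\sum_{i=1}^{Z_{l,n}}X_{l,n,i},\quad n\ge0,\ l=1,2,$$ where, given the environment, the variables $X_{1,n,i},X_{2,n,i}$ ($n\ge 0$, $i\ge1$) are independent, $X_{l,n,i}$ has law $p(\xi_{l,n})$, and those of generation $n$ are independent of $\{Z_{1,k},Z_{2,k}:0\le k\le n\}$. $\mathbb{P}$ and $\mathbb{E}$ denote the annealed (total) probability and expectation. For $l=1,2$ put $$m_{l,n}=\sum_{k=0}^\infty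 k\,p_k(\xi_{l,n}),\quad M_{l,n}=\ln m_{l,n},\quad \mu_l=\mathbb{E}M_{l,0},\quad \sigma_l^2=\mathrm{Var}(M_{l,0}),\quad \rho=\frac{\mathrm{Cov}(M_{1,0},M_{2,0})}{\sigma_1\sigma_2}.$$ Standing assumptions: $0<\sigma_1,\sigma_2<\infty$; $$\mathbb{E}\Big[\tfrac{Z_{1,1}}{m_{1,0}}\ln^+Z_{1,1}+\tfrac{Z_{2,1}}{m_{2,0}}\ln^+Z_{2,1}\Big]<\infty;$$ $p_0(\xi_{1,0})=p_0(\xi_{2,0})=0$ a.s.; and either $\rho\in[-1,1)$, or $\rho=1$ and $\sigma_1\ne\sigma_2$. Define for integers $m,n\ge1$ $$V_{m,n,\rho}=\sqrt{\tfrac1n\sigma_1^2+\tfrac1m\sigma_2^2-2\rho\sigma_1\sigma_2\tfrac{m\wedge n}{mn}},\qquad R_{m,n}=\frac{\frac1n\ln Z_{1,n}-\frac1m\ln Z_{2,m}-(\mu_1-\mu_2)}{V_{m,n,\rho}}.$$ For a real random variable $M$, $d_w(M)=\int_{-\infty}^{+\infty}|\mathbb{P}(M\le x)-\Phi(x)|\,dx$, which is the Wasserstein-1 distance between the law of $M$ and the standard normal law. *)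

(* Defs.v *)
From HB Require Import structures.
From mathcomp Require Import all_boot all_order all_algebra finmap.
From mathcomp Require Import all_classical all_reals all_analysis.

Set Implicit Arguments.
Unset Strict Implicit.
Unset Printing Implicit Defensive.
Import Order.TTheory GRing.Theory Num.Theory.
Import numFieldNormedType.Exports.
Local Open Scope classical_set_scope.
Local Open Scope ring_scope.

(* Conventions.  The two populations are indexed by 'I_2, with 0 (resp. 1) for
   the first (resp. second) one.  The children of a generation are numbered
   from 0: [X l n i] is the offspring number of individual i of generation n of
   population l.  The probability P is the annealed one. *)

Section independence.
Context d (T : measurableType d) (R : realType) (P : probability T R).

Definition iid_pairs (xi : 'I_2 -> nat -> {RV P >-> R}) :=
  let V n := fun w : T => (xi 0 n w, xi 1 n w) in
  (forall (J : {fset nat}) (B : nat -> set (R * R)),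
     (forall n, measurable (B n)) ->
     P (\bigcap_(n in [set` J]) (V n @^-1` B n)) =
     (\prod_(n <- J) fine (P (V n @^-1` B n)))%:E)
  /\ (forall n (B : set (R * R)), measurable B ->
     P (V n @^-1` B) = P (V 0%N @^-1` B)).

Definition sigma_env (xi : 'I_2 -> nat -> {RV P >-> R}) : set (set T) :=
  <<s [set A | exists l n (B : set R), measurable B /\ A = xi l n @^-1` B] >>.

(* [f] is a version of the conditional probability P(B | G). *)
Definition is_cond_prob (G : set (set T)) (B : set T) (f : T -> R) :=
  (forall Y : set R, measurable Y -> G (f @^-1` Y)) /\
  (forall A, G A -> P (A `&` B) = (\int[P]_(w in A) (f w)%:E)%E).

(* Given the whole environment, the X l n i (over all l, n, i) are independent
   and X l n i has law p (xi l n):  P(X_j = k_j, j \in J | xi) is the product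
   over j \in J of p_{k_j}(xi_j), for each finite set J of indices (l, n, i).
   The case of singletons gives the conditional laws; since the joint statement
   covers all generations, those of generation n are independent of the
   population sizes up to generation n, which are functions of the X's of the
   earlier generations. *)
Definition cond_indep_offspring (p : R.-pker R ~> nat)
    (xi : 'I_2 -> nat -> {RV P >-> R})
    (X : 'I_2 -> nat -> nat -> {RV P >-> nat}) :=
  forall (J : {fset 'I_2 * nat * nat}) (k : 'I_2 * nat * nat -> nat),
    is_cond_prob (sigma_env xi)
      (\bigcap_(j in [set` J]) (X j.1.1 j.1.2 j.2 @^-1` [set k j]))
      (fun w => \prod_(j <- J) fine (p (xi j.1.1 j.1.2 w) [set k j])).

End independence.

Fixpoint branching (T : Type) (X : nat -> nat -> T -> nat) (n : nat) (w : T)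
    : nat :=
  if n is n'.+1 then (\sum_(i < branching X n' w) X n' i w)%N else 1%N.

Section branching_in_random_environment.
Context d (T : measurableType d) (R : realType) (P : probability T R).

Definition offspring_mean (p : R.-pker R ~> nat) (x : R) : \bar R :=
  (\sum_(0 <= k <oo) k%:R%:E * p x [set k])%E.

Context (p : R.-pker R ~> nat) (xi : 'I_2 -> nat -> {RV P >-> R}).

(* Only meaningful where the offspring mean is finite ([fine +oo] is 0); the
   theorem assumes this almost surely. *)
Definition env_mean (l : 'I_2) (n : nat) (w : T) : R :=
  fine (offspring_mean p (xi l n w)).

Definition log_mean (l : 'I_2) (n : nat) (w : T) : R := ln (env_mean l n w).

Definition mu_ (l : 'I_2) : R := fine 'E_P[log_mean l 0].

Definition sigma_ (l : 'I_2) : R := Num.sqrt (fine 'V_P[log_mean l 0]).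

Definition rho_ : R :=
  fine (covariance P (log_mean 0 0) (log_mean 1 0)) / (sigma_ 0 * sigma_ 1).

Definition V_ (m n : nat) : R :=
  Num.sqrt (n%:R^-1 * sigma_ 0 ^+ 2 + m%:R^-1 * sigma_ 1 ^+ 2
    - 2 * rho_ * sigma_ 0 * sigma_ 1 * ((minn m n)%:R / (m%:R * n%:R))).

Definition R_ (X : 'I_2 -> nat -> nat -> {RV P >-> nat}) (m n : nat) (w : T)
    : R :=
  (n%:R^-1 * ln (branching (X 0) n w)%:R
   - m%:R^-1 * ln (branching (X 1) m w)%:R - (mu_ 0 - mu_ 1)) / V_ m n.

End branching_in_random_environment.

Definition lnp (R : realType) (x : R) : R := Num.max (ln x) 0.

Definition normal_cdf (R : realType) (x : R) : \bar R :=
  normal_prob 0 1 `]-oo, x].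

Definition d_w d (T : measurableType d) (R : realType) (P : probability T R)
    (M : T -> R) : \bar R :=
  (\int[lebesgue_measure]_x `|P [set w | (M w <= x)%R] - normal_cdf x|)%E.

(* Main.v *)
Require Import Defs.
From HB Require Import structures.
From mathcomp Require Import all_boot all_order all_algebra finmap.
From mathcomp Require Import ring lra.
From mathcomp Require Import all_classical all_reals all_analysis.
From mathcomp Require Import measurable_realfun.

Set Implicit Arguments.
Unset Strict Implicit.
Unset Printing Implicit Defensive.
Import Order.TTheory GRing.Theory Num.Theory.
Import numFieldNormedType.Exports.
Local Open Scope classical_set_scope.
Local Open Scope ring_scope.

(** The distance is bounded by Stein's method, after the population sizes have
    been replaced by random walks.

    Let S be the statistic in which ln Z_{l,n} is replaced by the sum of the log
    means M_{l,0} + ... + M_{l,n-1}. Grouped by generation, S is a sum of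
    independent centred variables (the two coordinates of a generation may
    depend on each other) of total variance 1.

    Reduction to a Lipschitz function. If s is the sign of F - Phi, where F is the
    distribution function of the statistic R, Fubini's theorem shows that the
    distance is - E (h (R)), where h (w) is the integral over t of
    s t * (Phi t - 1_(w <= t)) (d_w_stein). The function h is 1-Lipschitz, so
    d_w(R) <= |E (h (S))| + E |R - S|.

    Normal approximation of S. Stein's equation f' w - w * f w = h w has an
    explicit solution with bounded and Lipschitz derivative, which is therefore
    Hoelder continuous of exponent delta (stein_dsol_holder). The usual
    leave-one-out expansion bounds |E (h (S))| by the sum of the moments of order
    2 + delta of the terms (stein_clt), which is of order min(m, n)^(- delta / 2)
    (env_clt).

    Replacement of R by S. The normalization V is at least of order
    min(m, n)^(- 1/2) (V_lower_bound), so E |R - S| is of order min(m, n)^(- 1/2)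
    as soon as ln Z_{l,n} stays at bounded mean distance from its random walk
    (branching_log_L1). The difference is the sum over k < n of the logarithms of
    the averages, over the Z_{l,k} individuals of generation k, of their numbers of
    children divided by the conditional mean. Given Z_{l,k} = z such an average has
    mean 1; the moment of order q > 1, the fact that everybody has a child and a
    truncation show that its logarithm has mean absolute value at most
    C1 * z^(- eps) (increment_decay). Finally E (Z_{l,k}^(- eps)) decays
    geometrically in k: it is multiplied at each generation by at most
    E (Z_{l,1}^(- eps)) < 1, by convexity of x^(- eps) (branching_inv_moment). *)

(** * The Gaussian density, its tail and their primitives *)

Section gauss.
Context {R : realType}.
Implicit Types w t x a b : R.
Notation leb := (@lebesgue_measure R).

Definition gpdf : R -> R := normal_pdf 0 1.
Definition gcdf w : R := \int[leb]_(t in `]-oo, w]) gpdf t.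
Definition gtail w : R := 1 - gcdf w.

Lemma gpdfE x : gpdf x = normal_peak 1 * expR (- (x ^+ 2 / 2)).
Proof.
by rewrite /gpdf normal_pdfE ?oner_neq0// /normal_fun subr0 expr1n mulNr.
Qed.

Lemma gpdf_gt0 x : 0 < gpdf x.
Proof. by rewrite gpdfE mulr_gt0 ?expR_gt0// normal_peak_gt0 ?oner_neq0. Qed.

Lemma gpdf_ge0 x : 0 <= gpdf x. Proof. exact/ltW/gpdf_gt0. Qed.

Lemma gpdfN x : gpdf (- x) = gpdf x.
Proof. by rewrite !gpdfE sqrrN. Qed.

Lemma gpdf_le1 x : gpdf x <= 1.
Proof.
rewrite gpdfE.
have p1 : normal_peak 1 <= 1 :> R.
  rewrite /normal_peak invf_le1 ?sqrtr_gt0; last first.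
    by rewrite expr1n mul1r mulrn_wgt0// pi_gt0.
  rewrite -[X in X <= _]sqrtr1 ler_sqrt; last first.
    by rewrite expr1n mul1r mulrn_wge0// pi_ge0.
  rewrite expr1n mul1r; have := pi_ge2 R; lra.
rewrite -[leRHS]mulr1 ler_pM ?normal_peak_ge0 ?expR_ge0//.
by rewrite -expR0 ler_expR oppr_le0 divr_ge0 ?sqr_ge0.
Qed.

Lemma is_derive_gpdf x : is_derive x 1 gpdf (- x * gpdf x).
Proof.
rewrite (_ : gpdf = fun x => normal_peak 1 * expR (- (x ^+ 2 / 2))); last first.
  by apply/funext => y; rewrite gpdfE.
by apply: is_derive_eq; rewrite /GRing.scale/=; field.
Qed.

Lemma continuous_gpdf : continuous gpdf.
Proof.
move=> x; apply: differentiable_continuous; apply/derivable1_diffP.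
by have [] := is_derive_gpdf x.
Qed.

Lemma integrable_gpdf (D : set R) : measurable D ->
  leb.-integrable D (EFin \o gpdf).
Proof.
move=> mD; apply: (@integrableS _ _ _ _ setT) => //.
exact: integrable_normal_pdf.
Qed.

Lemma is_derive_gcdf x : is_derive x 1 gcdf (gpdf x).
Proof.
have [||||d dE] := @continuous_FTC1 R gpdf -oo%O x (x + 1).
- by rewrite ltrDl.
- exact: integrable_gpdf.
- exact: ltNyr.
- exact: continuous_gpdf.
by apply: DeriveDef; [exact: d|rewrite -derive1E].
Qed.

Lemma is_derive_gtail x : is_derive x 1 gtail (- gpdf x).
Proof.
rewrite /gtail -[X in is_derive _ _ _ X]add0r.
have := is_derive_gcdf x => ?.
exact: is_deriveB.
Qed.

Lemma normal_cdfE x : normal_cdf x = (gcdf x)%:E.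
Proof.
rewrite /normal_cdf /normal_prob /gcdf /Rintegral fineK//.
apply: integrable_fin_num => //; exact: integrable_gpdf.
Qed.

Lemma gtailE x : gtail x = \int[leb]_(t in `[x, +oo[) gpdf t.
Proof.
rewrite -Rintegral_itv_obnd_cbnd; last exact: integrable_gpdf.
rewrite -(@Rintegral_itvB R gpdf -oo%O +oo%O x)//; last exact: integrable_gpdf.
congr (_ - _); rewrite set_itvNyy; apply/esym.
by rewrite /Rintegral /gpdf integral_normal_pdf.
Qed.

Lemma gcdf_ge0 x : 0 <= gcdf x.
Proof. by apply: Rintegral_ge0 => t _; exact: gpdf_ge0. Qed.

Lemma gtail_ge0 x : 0 <= gtail x.
Proof. by rewrite gtailE; apply: Rintegral_ge0 => t _; exact: gpdf_ge0. Qed.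

Lemma gcdf_le1 x : gcdf x <= 1.
Proof. by rewrite -subr_ge0; exact: gtail_ge0. Qed.

Lemma gtail_le1 x : gtail x <= 1.
Proof. by rewrite /gtail gerBl gcdf_ge0. Qed.

Lemma gcdfN x : gcdf (- x) = gtail x.
Proof.
rewrite gtailE /gcdf /Rintegral ge0_integration_by_substitutionNy.
- by congr fine; apply: eq_integral => t _ /=; rewrite gpdfN.
- by apply: continuous_subspaceT; exact: continuous_gpdf.
- by move=> t _; exact: gpdf_ge0.
Qed.

Lemma gtailN x : gtail (- x) = gcdf x.
Proof. by rewrite -gcdfN opprK. Qed.

Lemma continuous_gcdf : continuous gcdf.
Proof.
by move=> x; apply: differentiable_continuous; apply/derivable1_diffP; have [] := is_derive_gcdf x.
Qed.

Lemma continuous_gtail : continuous gtail.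
Proof.
by move=> x; apply: differentiable_continuous; apply/derivable1_diffP; have [] := is_derive_gtail x.
Qed.

Lemma gcdf_incr a b : a <= b -> 0 <= gcdf b - gcdf a <= b - a.
Proof.
move=> ab; have [||c _ ->] := @MVT_segment R gcdf gpdf a b ab.
- by move=> x _; exact: is_derive_gcdf.
- by apply: continuous_subspaceT; exact: continuous_gcdf.
rewrite mulr_ge0 ?gpdf_ge0 ?subr_ge0//=.
by rewrite ler_piMl ?subr_ge0// gpdf_le1.
Qed.

Lemma le_gcdf a b : a <= b -> gcdf a <= gcdf b.
Proof. by move=> /gcdf_incr/andP[+ _]; rewrite subr_ge0. Qed.

Lemma le_gtail a b : a <= b -> gtail b <= gtail a.
Proof. by move=> /le_gcdf ab; rewrite /gtail lerB. Qed.

(** Follows from 1 + x <= expR x at x = w ^ 2 / 2. Crude, but any decay at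
    infinity is enough for the limits below. *)
Lemma gpdf_le w : 0 < w -> gpdf w <= 2 / w ^+ 2.
Proof.
move=> w0; rewrite gpdfE.
have w2 : 0 < w ^+ 2 / 2 by rewrite divr_gt0 ?exprn_gt0.
have := @expR_ge1Dx R (w ^+ 2 / 2).
have := gpdf_le1 0; rewrite gpdfE expr0n/= mul0r oppr0 expR0 mulr1 => p1 h.
rewrite (le_trans (_ : _ <= expR (- (w ^+ 2 / 2))))//.
  by rewrite ler_piMl// expR_ge0.
rewrite expRN -[leRHS]invf_div lef_pV2 ?posrE ?expR_gt0//.
by rewrite (le_trans _ h)// lerDr.
Qed.

Lemma cvg_gpdfy : gpdf x @[x --> +oo] --> (0 : R).
Proof.
have iV : (x : R)^-1 @[x --> +oo] --> (0 : R).
  by apply/(@gtr0_cvgV0 _ _ _ _ id) => //; exact: nbhs_pinfty_gt.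
apply: (@squeeze_cvgr _ _ _ _ (cst 0) (fun w => 2 * (w^-1 * w^-1))).
- near=> w; rewrite gpdf_ge0/=.
  have w0 : 0 < w by near: w; exact: nbhs_pinfty_gt.
  by rewrite (le_trans (gpdf_le w0))// expr2 invfM.
- exact: cvg_cst.
- rewrite -[X in _ --> X](mulr0 2); apply: cvgMl_tmp => //.
  rewrite -[X in _ --> X](mulr0 0); apply: cvgM; exact: iV.
Unshelve. all: by end_near. Qed.

(** The function - gpdf is a primitive of t * gpdf t. Hence gpdf w is the
    integral to which the tail estimates below are compared. *)
Lemma integral_x_gpdf w : 0 <= w ->
  (\int[leb]_(t in `[w, +oo[) (t * gpdf t)%:E = (gpdf w)%:E)%E.
Proof.
move=> w0; rewrite (@ge0_continuous_FTC2y R _ (fun x => - gpdf x) w 0).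
- by rewrite -EFinN opprK add0e.
- by move=> x wx; rewrite mulr_ge0 ?gpdf_ge0// (le_trans w0).
- apply: continuous_subspaceT => x; apply: cvgM; first exact: cvg_id.
  exact: continuous_gpdf.
- by rewrite -oppr0; apply: cvgN; exact: cvg_gpdfy.
- by move=> x _; have ? := is_derive_gpdf x; apply: ex_derive.
- by apply: cvg_at_right_filter; apply: cvgN; exact: continuous_gpdf.
- move=> x _; have ? := is_derive_gpdf x.
  by rewrite derive1E derive_val mulNr opprK.
Qed.

(** On [w, +oo[ the integrand of w * gtail w is at most t * gpdf t, whose
    integral is gpdf w. *)
Lemma gtail_mills w : 0 <= w -> w * gtail w <= gpdf w.
Proof.
move=> w0; rewrite -lee_fin -integral_x_gpdf// gtailE EFinM fineK; last first.
  by apply: integrable_fin_num => //; exact: integrable_gpdf.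
rewrite -ge0_integralZl//=; last 2 first.
- by apply/measurable_EFinP; apply: measurable_funTS; exact: measurable_normal_pdf.
- by move=> x _; rewrite lee_fin gpdf_ge0.
apply: ge0_le_integral => //=.
- by move=> x _; rewrite lee_fin mulr_ge0 ?gpdf_ge0.
- apply/measurable_EFinP; apply: measurable_funTS; apply: measurable_funM => //; exact: measurable_normal_pdf.
- apply/measurable_EFinP; apply: measurable_funTS; apply: measurable_funM => //; exact: measurable_normal_pdf.
- move=> x; rewrite in_itv/= andbT => wx; rewrite -EFinM lee_fin.
  by rewrite ler_wpM2r ?gpdf_ge0.
Qed.

Lemma integral_gtail w :
  (\int[leb]_(t in `[w, +oo[) (gtail t)%:E = (gpdf w - w * gtail w)%:E)%E.
Proof.
rewrite (@ge0_continuous_FTC2y R _ (fun x => x * gtail x - gpdf x) w 0).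
- by rewrite add0e -EFinN opprB.
- by move=> x _; exact: gtail_ge0.
- by apply: continuous_subspaceT; exact: continuous_gtail.
- rewrite -[X in _ --> X]subr0; apply: cvgB; last exact: cvg_gpdfy.
  apply: (@squeeze_cvgr _ _ _ _ (cst 0) gpdf).
  + near=> x; have x0 : 0 <= x by near: x; exact: nbhs_pinfty_ge.
    by rewrite mulr_ge0 ?gtail_ge0//= gtail_mills.
  + exact: cvg_cst.
  + exact: cvg_gpdfy.
- move=> x _; have ? := is_derive_gpdf x; have ? := is_derive_gtail x.
  exact: ex_derive.
- apply: cvg_at_right_filter; apply: cvgB; last exact: continuous_gpdf.
  by apply: cvgM; [exact: cvg_id|exact: continuous_gtail].
- move=> x _; have ? := is_derive_gpdf x; have ? := is_derive_gtail x.
  by rewrite derive1E derive_val /GRing.scale/=; ring.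
Unshelve. all: by end_near. Qed.

(** The primitive of [gcdf] vanishing at -oo. *)
Definition gprim w : R := gpdf w + w * gcdf w.

Lemma integral_gcdf w :
  (\int[leb]_(t in `]-oo, w]) (gcdf t)%:E = (gprim w)%:E)%E.
Proof.
rewrite -[w in LHS]opprK ge0_integration_by_substitutionNy.
- under eq_integral do rewrite /= gcdfN.
  by rewrite integral_gtail gpdfN gtailN mulNr opprK.
- by apply: continuous_subspaceT; exact: continuous_gcdf.
- by move=> t _; exact: gcdf_ge0.
Qed.

Lemma gprimN w : gprim (- w) = gpdf w - w * gtail w.
Proof. by rewrite /gprim gpdfN gcdfN mulNr. Qed.

Lemma gprim_ge0 w : 0 <= gprim w.
Proof.
by rewrite -lee_fin -integral_gcdf; apply: integral_ge0 => t _; rewrite lee_fin gcdf_ge0.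
Qed.

Lemma is_derive_gprim w : is_derive w 1 gprim (gcdf w).
Proof.
have ? := is_derive_gpdf w; have ? := is_derive_gcdf w.
by apply: is_derive_eq; rewrite /GRing.scale/=; ring.
Qed.

Lemma le_gprim a b : a <= b -> gprim a <= gprim b.
Proof.
move=> ab; rewrite -subr_ge0; have [||c _ ->] := @MVT_segment R gprim gcdf a b ab.
- by move=> x _; exact: is_derive_gprim.
- apply: continuous_subspaceT => x.
  by apply: differentiable_continuous; apply/derivable1_diffP; have [] := is_derive_gprim x.
by rewrite mulr_ge0 ?gcdf_ge0 ?subr_ge0.
Qed.

(** By Mills' inequality, gtail t <= t * gpdf t / w ^ 2 for t >= w. *)
Lemma gprimN_le w : 0 < w -> gprim (- w) <= gpdf w / w ^+ 2.
Proof.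
move=> w0; rewrite gprimN -lee_fin -integral_gtail mulrC EFinM -(integral_x_gpdf (ltW w0)).
rewrite -ge0_integralZl//=; last 3 first.
- apply/measurable_EFinP; apply: measurable_funTS; apply: measurable_funM => //; exact: measurable_normal_pdf.
- move=> x; rewrite in_itv/= andbT => wx; rewrite lee_fin mulr_ge0 ?gpdf_ge0//.
  by rewrite (le_trans _ wx)// ltW.
- by rewrite lee_fin invr_ge0 exprn_ge0// ltW.
apply: ge0_le_integral => //=.
- by move=> x _; rewrite lee_fin gtail_ge0.
- apply/measurable_EFinP; apply: measurable_funTS; apply: continuous_measurable_fun; exact: continuous_gtail.
- apply: emeasurable_funM => //; apply/measurable_EFinP; apply: measurable_funTS; apply: measurable_funM => //; exact: measurable_normal_pdf.
- move=> x; rewrite in_itv/= andbT => wx; rewrite -EFinM lee_fin.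
  have x0 : 0 < x by exact: lt_le_trans wx.
  have := gtail_mills (ltW x0); rewrite -ler_pdivlMl// => /le_trans; apply.
  rewrite mulrA ler_wpM2r ?gpdf_ge0// ler_pdivlMl ?exprn_gt0//.
  by rewrite ler_pdivrMr// -expr2 ler_sqr ?nnegrE// ltW.
Qed.

End gauss.

(** * Bounds for the coefficients of the Stein solution *)

Section stein.
Context {R : realType}.
Implicit Types w t x a b c : R.
Notation leb := (@lebesgue_measure R).

Lemma le_norm_Rintegral_itv (h : R -> R) (M a b : R) : a <= b -> 0 <= M ->
  leb.-integrable `]a, b] (EFin \o h) ->
  (forall t, a < t <= b -> `|h t| <= M) ->
  `|\int[leb]_(t in `]a, b]) h t| <= (b - a) * M.
Proof.
move=> ab M0 ih hM.
have mE : leb `]a, b] = (b - a)%:E.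
  rewrite (lebesgue_measure_itv `]a, b]) /= lte_fin.
  case: ltgtP ab => // -> _; by rewrite subrr.
rewrite (le_trans (le_normr_Rintegral _ _))//.
have -> : (b - a) * M = \int[leb]_(t in `]a, b]) M.
  by rewrite Rintegral_cst// [X in fine X]mE mulrC.
apply: le_Rintegral => //.
- exact: integrable_abse ih.
- apply: measurable_bounded_integrable => //=.
  + by rewrite [X in (X < _)%E]mE ltry.
  + by exists M; split; [exact: num_real|move=> x Mx y _; rewrite ger0_norm// ltW].
Qed.

(** The derivative of the Stein solution is a combination of bounded functionals
    of the test function with coefficients gratio w and gratio (- w), see
    stein_dsolE. At +oo it decays like w ^- 2, at -oo it explodes. *)
Definition gratio w : R := gprim (- w) / gpdf w.

Lemma gratioE w : gratio w = 1 - w * gtail w / gpdf w.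
Proof. by rewrite /gratio gprimN mulrBl divff ?gt_eqF ?gpdf_gt0. Qed.

Lemma gratio_ge0 w : 0 <= gratio w.
Proof. by rewrite divr_ge0 ?gprim_ge0 ?gpdf_ge0. Qed.

Lemma gratio_le1 w : 0 <= w -> gratio w <= 1.
Proof.
move=> w0; rewrite gratioE lerBlDr lerDl.
by rewrite divr_ge0 ?mulr_ge0 ?gtail_ge0 ?gpdf_ge0.
Qed.

Lemma gratio_le_sqr w : 0 < w -> w ^+ 2 * gratio w <= 1.
Proof.
move=> w0; have := gprimN_le w0.
rewrite ler_pdivlMr ?exprn_gt0// => h.
by rewrite /gratio mulrA ler_pdivrMr ?gpdf_gt0// mul1r mulrC.
Qed.

Lemma gprim_le w : 0 <= w -> gprim w <= 1 + w.
Proof.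
move=> w0; rewrite /gprim lerD ?gpdf_le1//.
by rewrite ler_piMr// gcdf_le1.
Qed.

Lemma gprim_gratio_le2_ge0 w : 0 <= w -> gprim w * gratio w <= 2.
Proof.
move=> w0; have := gprim_le w0; have := gratio_le1 w0; have := gratio_ge0 w.
have [w1|w1] := leP w 1; first by have := gprim_ge0 w; nra.
have w0' : 0 < w by lra.
have := gratio_le_sqr w0'; have := gprim_ge0 w; set u := gratio w; set p := gprim w.
move=> p0 wu u0 u1 p1.
apply: (@le_trans _ _ (2 * w ^+ 2 * u)); last by lra.
by apply: ler_wpM2r => //; nra.
Qed.

(** At +oo, gprim grows linearly and gratio decays like w ^- 2. The product is
    even, which settles -oo. *)
Lemma gprim_gratio_le2 w : gprim w * gratio w <= 2.
Proof.
have [|w0] := leP 0 w; first exact: gprim_gratio_le2_ge0.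
rewrite (_ : _ * _ = gprim (- w) * gratio (- w)); last first.
  by rewrite /gratio opprK gpdfN; ring.
by apply: gprim_gratio_le2_ge0; rewrite oppr_ge0 ltW.
Qed.

Lemma gcdf_gratio_le2 w : gcdf w * gratio w <= 2.
Proof.
have [w0|w0] := leP 0 w.
  have := gratio_le1 w0; have := gratio_ge0 w; have := gcdf_ge0 w.
  have := gcdf_le1 w; nra.
rewrite gratioE mulrBr mulr1.
have w0' : 0 <= - w by lra.
have := gtail_mills w0'; rewrite gpdfN gtailN => h.
have h2 : - w * gcdf w / gpdf w <= 1 by rewrite ler_pdivrMr ?gpdf_gt0// mul1r.
have := gcdf_le1 w; have := gtail_le1 w; have := gtail_ge0 w => t0 t1 c1.
rewrite (_ : gcdf w * _ = (- w * gcdf w / gpdf w) * - gtail w); last by ring.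
have : 0 <= - w * gcdf w / gpdf w by rewrite divr_ge0 ?mulr_ge0 ?gcdf_ge0 ?gpdf_ge0.
by nra.
Qed.

Definition dgratio w : R := w * gratio w - gtail w / gpdf w.

Lemma is_derive_gratio w : is_derive w 1 gratio (dgratio w).
Proof.
rewrite (_ : gratio = fun w => 1 - w * gtail w / gpdf w); last first.
  by apply/funext => x; rewrite gratioE.
have ? := is_derive_gpdf w; have ? := is_derive_gtail w.
have ? : gpdf w != 0 by rewrite gt_eqF ?gpdf_gt0.
have ? := @is_deriveV R gpdf w (- w * gpdf w) 1 ltac:(eassumption) ltac:(eassumption).
apply: is_derive_eq.
rewrite /dgratio gratioE /GRing.scale/=.
by field.
Qed.

(** The sum of the bounds met in the three regions w < 0, 0 <= w < 1 and
    1 <= w in gprim_dgratio_le. *)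
Definition stein_cst : R := 4 + 2 / gpdf 1.

Lemma gprim_dgratio_le w : gprim w * `|dgratio w| <= stein_cst.
Proof.
have i0 : 0 < 2 / gpdf (1:R) by rewrite divr_gt0 ?gpdf_gt0.
have r0 x : 0 <= gtail x / gpdf x by rewrite divr_ge0 ?gtail_ge0 ?gpdf_ge0.
have p0 := gprim_ge0 w; have u0 := gratio_ge0 w.
rewrite /stein_cst /dgratio; have [w1|w1] := leP 1 w.
  have w0 : 0 < w by lra.
  have h1 := gratio_le_sqr w0; have h2 := gtail_mills (ltW w0).
  have h3 : w * (gtail w / gpdf w) <= 1.
    by rewrite mulrA ler_pdivrMr ?gpdf_gt0// mul1r.
  have h4 := gprim_le (ltW w0); have := r0 w.
  set r := gtail w / gpdf w in h3 * => r0'.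
  have h5 : w * `|w * gratio w - r| <= 1.
    rewrite -[X in X * _]gtr0_norm// -normrM ler_norml; apply/andP; split; nra.
  have h6 : 0 <= `|w * gratio w - r| by [].
  apply: (@le_trans _ _ (2 * w * `|w * gratio w - r|)); last by lra.
  by apply: ler_wpM2r => //; lra.
have [w0|w0] := leP 0 w.
  have h1 := gratio_le1 w0; have h4 := gprim_le w0; have := r0 w.
  have h2 : gtail w / gpdf w <= (gpdf 1)^-1.
    rewrite -[leRHS]mul1r ler_pM ?gtail_ge0 ?gtail_le1 ?invr_ge0 ?gpdf_ge0//.
    rewrite lef_pV2 ?posrE ?gpdf_gt0// !gpdfE ler_pM2l ?normal_peak_gt0//.
    by rewrite ler_expR lerN2 ler_pM2r// ler_sqr ?nnegrE// ltW.
  have i0' : 0 < (gpdf (1:R))^-1 by rewrite invr_gt0 gpdf_gt0.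
  move: h2 i0'; set r := gtail w / gpdf w; set i := (gpdf 1)^-1 => h2 i0' r0'.
  have h5 : `|w * gratio w - r| <= 1 + i.
    by rewrite ler_norml; apply/andP; split; nra.
  by have : 0 <= `|w * gratio w - r| by []; nra.
rewrite ler0_norm; last first.
  by have := r0 w; have := gratio_ge0 w; nra.
rewrite opprB mulrBr.
have x0 : 0 < - w by lra.
have h1 := gratio_le1 (ltW x0); have h2 := gratio_le_sqr x0.
have h3 : gprim w * (gtail w / gpdf w) <= 1.
  rewrite mulrCA; have := gtail_le1 w; have := gtail_ge0 w.
  move: h1 (gratio_ge0 (- w)); rewrite /gratio opprK gpdfN; nra.
have h4 : gprim w * (- w * gratio w) <= 2.
  rewrite (_ : gprim w * _ = - w * gprim (- w) * gratio (- w)); last first.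
    by rewrite /gratio opprK gpdfN; ring.
  have := gprim_le (ltW x0); have := gprim_ge0 (- w); have := gratio_ge0 (- w).
  move: x0 h1 h2; set x := - w; set u := gratio _; set p := gprim _.
  move=> x0 u1 xu u0' p0' px.
  have [x1|x1] := leP x 1.
    have : x * p <= 2 by nra.
    have xp0 : 0 <= x * p by apply: mulr_ge0 => //; exact: ltW.
    by nra.
  apply: (@le_trans _ _ (2 * x ^+ 2 * u)); last by lra.
  by apply: ler_wpM2r => //; nra.
by lra.
Qed.

(** Both halves of the derivative of the Stein solution have the form
    A * gratio, the second one after w |-> - w. In the increment of the product,
    gratio varies by gprim * dgratio and A by gcdf * gratio, and both products
    are bounded. *)
Lemma lipschitz_mul_gratio (A : R -> R) :
  (forall w, `|A w| <= gprim w) ->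
  (forall a b, a <= b -> `|A b - A a| <= (b - a) * gcdf b) ->
  forall a b, a <= b ->
    `|A b * gratio b - A a * gratio a| <= (stein_cst + 2) * (b - a).
Proof.
move=> Ap Ai a b ab.
have [||c cab cE] := @MVT_segment R gratio dgratio a b ab.
- by move=> x _; exact: is_derive_gratio.
- apply: continuous_subspaceT => x; apply: differentiable_continuous.
  by apply/derivable1_diffP; have [] := is_derive_gratio x.
rewrite (_ : _ - _ = (A b - A a) * gratio b + A a * (gratio b - gratio a)); last by ring.
rewrite [leRHS]mulrDl [X in `|X|]addrC (le_trans (ler_normD _ _))// lerD//.
  rewrite cE !normrM mulrA [X in _ * X](ger0_norm)// ?subr_ge0//.
  rewrite ler_wpM2r ?subr_ge0// (le_trans _ (gprim_dgratio_le c))//.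
  rewrite ler_wpM2r// (le_trans (Ap a))// le_gprim//.
  by move: cab; rewrite in_itv/= => /andP[].
rewrite normrM (ger0_norm (gratio_ge0 b)).
have := Ai _ _ ab; have := gcdf_gratio_le2 b; have := gratio_ge0 b.
have := gcdf_ge0 b => c0 u0 cu h.
apply: (@le_trans _ _ ((b - a) * gcdf b * gratio b)); first exact: ler_wpM2r.
by rewrite -mulrA mulrC ler_wpM2r// subr_ge0.
Qed.
End stein.

(** * The solution of Stein's equation *)

(** For a test function that is only measurable, the integrals defining the
    Stein solution have no continuous integrand to differentiate; a quadratic
    remainder can be checked directly instead. *)
Lemma is_derive0_quadratic {R : realType} (H : R -> R) (K a : R) :
  (forall b, `|H b - H a| <= K * (b - a) ^+ 2) -> is_derive a 1 H 0.
Proof.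
move=> HK.
suff cH : h^-1 *: (H (h + a) - H a) @[h --> 0^'] --> (0 : R).
  have dH : (fun h => h^-1 *: ((H \o shift a) (h *: 1) - H a)) @ 0^' --> (0 : R).
    rewrite (_ : (fun h => _) = (fun h => h^-1 *: (H (h + a) - H a)))//.
    by apply/funext => h /=; rewrite /GRing.scale/= mulr1.
  apply: DeriveDef; first by apply/cvg_ex; exists 0.
  by apply/cvg_lim.
apply/cvgrPdistC_le => e e0.
have K1 : 0 < `|K| + 1 by rewrite ltr_wpDl.
near=> h; rewrite subr0.
have h0 : h != 0 by near: h; exact: nbhs_dnbhs_neq.
rewrite /GRing.scale/= normrM normfV ler_pdivrMl ?normr_gt0//.
have := HK (h + a); rewrite addrK => /le_trans; apply.
rewrite -real_normK ?num_real// expr2 mulrA mulrC ler_wpM2l//.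
have hb : `|h| <= e / (`|K| + 1).
  by near: h; apply: dnbhs0_le; exact: divr_gt0.
move: hb; rewrite ler_pdivlMr// => /(le_trans _); apply.
rewrite mulrC ler_wpM2l// (le_trans (ler_norm _))// lerDl//.
Unshelve. all: by end_near. Qed.

Section stein_solution.
Context {R : realType}.
Implicit Types w t x a b c : R.
Notation leb := (@lebesgue_measure R).
Variable s : R -> R.
Hypothesis ms : measurable_fun setT s.
Hypothesis s_le1 : forall t, `|s t| <= 1.

Definition stein_lower w : R := \int[leb]_(t in `]-oo, w]) (s t * gcdf t).
Definition stein_upper w : R := \int[leb]_(t in `]w, +oo[) (s t * gtail t).
(** The integral over t of s t * (gcdf t - 1_(w <= t)), split at t = w. It is a
    1-Lipschitz function of w, centred for the Gaussian law. *)
Definition stein_rhs w : R := stein_lower w - stein_upper w.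
(** The solution f of f' w - w * f w = stein_rhs w. The usual formula for f
    integrates stein_rhs against the density; exchanging the integrals leaves
    the functionals stein_lower and stein_upper, defined for merely measurable s. *)
Definition stein_sol w : R :=
  - (gtail w * stein_lower w + gcdf w * stein_upper w) / gpdf w.
Definition stein_dsol w : R := stein_rhs w + w * stein_sol w.

Let measurable_gcdf (D : set R) : measurable_fun D gcdf.
Proof. by apply: measurable_funTS; apply: continuous_measurable_fun; exact: continuous_gcdf. Qed.

Let measurable_gtail (D : set R) : measurable_fun D gtail.
Proof. by apply: measurable_funTS; apply: continuous_measurable_fun; exact: continuous_gtail. Qed.

Let bounded_s (D : set R) : [bounded s x | x in D].
Proof.
exists 1; split; first exact: num_real.
by move=> M M1 y _ /=; rewrite (le_trans (s_le1 y))// ltW.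
Qed.

Lemma integrable_gcdf w : leb.-integrable `]-oo, w] (EFin \o gcdf).
Proof.
apply/integrableP; split; first by apply/measurable_EFinP; exact: measurable_gcdf.
under eq_integral do rewrite /= ger0_norm ?gcdf_ge0//.
by rewrite integral_gcdf ltry.
Qed.

Lemma integrable_gtail w : leb.-integrable `]w, +oo[ (EFin \o gtail).
Proof.
have h : leb.-integrable `[w, +oo[ (EFin \o gtail).
  apply/integrableP; split; first by apply/measurable_EFinP; exact: measurable_gtail.
  under eq_integral do rewrite /= ger0_norm ?gtail_ge0//.
  by rewrite integral_gtail ltry.
by apply: integrableS h => //; apply: subset_itvr; rewrite bnd_simp.
Qed.

Lemma integrable_sM (D : set R) (h : R -> R) : measurable D ->
  leb.-integrable D (EFin \o h) -> leb.-integrable D (EFin \o (fun t => s t * h t)).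
Proof.
move=> mD ih; have := @integrableMr _ _ R leb D mD s (EFin \o h) _ _ ih.
apply; [exact: measurable_funTS|exact: bounded_s].
Qed.

Lemma norm_stein_lower w : `|stein_lower w| <= gprim w.
Proof.
rewrite (le_trans (le_normr_Rintegral _ _))//; first exact/integrable_sM/integrable_gcdf.
have -> : gprim w = \int[leb]_(t in `]-oo, w]) gcdf t.
  by rewrite /Rintegral integral_gcdf.
apply: le_Rintegral => //; last 2 first.
- exact: integrable_gcdf.
- by move=> t _; rewrite normrM (ger0_norm (gcdf_ge0 _)) ler_piMl ?gcdf_ge0.
by apply: integrable_abse (integrable_sM _ (integrable_gcdf w)).
Qed.

Lemma norm_stein_upper w : `|stein_upper w| <= gprim (- w).
Proof.
rewrite (le_trans (le_normr_Rintegral _ _))//; first exact/integrable_sM/integrable_gtail.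
have -> : gprim (- w) = \int[leb]_(t in `]w, +oo[) gtail t.
  rewrite Rintegral_itv_obnd_cbnd; last exact: integrable_gtail.
  by rewrite /Rintegral integral_gtail gprimN.
apply: le_Rintegral => //; last 2 first.
- exact: integrable_gtail.
- by move=> t _; rewrite normrM (ger0_norm (gtail_ge0 _)) ler_piMl ?gtail_ge0.
by apply: integrable_abse (integrable_sM _ (integrable_gtail w)).
Qed.

Lemma stein_lowerB a b : a <= b ->
  stein_lower b - stein_lower a = \int[leb]_(t in `]a, b]) (s t * gcdf t).
Proof.
move=> ab; rewrite -(@Rintegral_itvB R _ -oo%O (BRight b) a)//.
exact/integrable_sM/integrable_gcdf.
Qed.

Lemma stein_upperB a b : a <= b ->
  stein_upper a - stein_upper b = \int[leb]_(t in `]a, b]) (s t * gtail t).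
Proof.
move=> ab; rewrite /stein_upper -(@Rintegral_itvB R _ (BRight a) +oo%O b)//.
  by rewrite subKr.
exact/integrable_sM/integrable_gtail.
Qed.

Let integrable_gcdf_itv a b : leb.-integrable `]a, b] (EFin \o gcdf).
Proof.
by apply: integrableS (integrable_gcdf b) => //; apply: subset_itvr.
Qed.

Let integrable_gtail_itv a b : leb.-integrable `]a, b] (EFin \o gtail).
Proof.
by apply: integrableS (integrable_gtail a) => //; apply: subset_itvl.
Qed.

Lemma norm_stein_lowerB a b : a <= b ->
  `|stein_lower b - stein_lower a| <= (b - a) * gcdf b.
Proof.
move=> ab; rewrite stein_lowerB//; apply: le_norm_Rintegral_itv => //.
- exact: gcdf_ge0.
- exact: integrable_sM.
move=> t /andP[_ tb]; rewrite normrM (ger0_norm (gcdf_ge0 _)).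
by rewrite (le_trans _ (le_gcdf tb))// ler_piMl ?gcdf_ge0.
Qed.

Lemma norm_stein_upperB a b : a <= b ->
  `|stein_upper a - stein_upper b| <= (b - a) * gtail a.
Proof.
move=> ab; rewrite stein_upperB//; apply: le_norm_Rintegral_itv => //.
- exact: gtail_ge0.
- exact: integrable_sM.
move=> t /andP[/ltW at' _]; rewrite normrM (ger0_norm (gtail_ge0 _)).
by rewrite (le_trans _ (le_gtail at'))// ler_piMl ?gtail_ge0.
Qed.

(** On ]a, b] the two integrands add up to s, because gcdf + gtail = 1. *)
Lemma stein_rhs_lipschitz_le a b : a <= b -> `|stein_rhs b - stein_rhs a| <= b - a.
Proof.
move=> ab; rewrite /stein_rhs.
rewrite [X in `|X|](_ : _ = (stein_lower b - stein_lower a)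
                   + (stein_upper a - stein_upper b)); last by ring.
rewrite stein_lowerB// stein_upperB// -RintegralD//; try exact: integrable_sM.
rewrite -[leRHS]mulr1; apply: le_norm_Rintegral_itv => //.
  have -> : (EFin \o (fun t => s t * gcdf t + s t * gtail t)) =
    ((EFin \o (fun t => s t * gcdf t)%R) \+ (EFin \o (fun t => s t * gtail t)%R))%E.
    by apply/funext => t /=; rewrite EFinD.
  by apply: integrableD => //; exact: integrable_sM.
by move=> t _; rewrite -mulrDr /gtail addrC subrK mulr1.
Qed.

Lemma stein_rhs_lipschitz a b : `|stein_rhs b - stein_rhs a| <= `|b - a|.
Proof.
have [ab|/ltW ba] := leP a b.
  by rewrite [leRHS]ger0_norm ?subr_ge0// stein_rhs_lipschitz_le.
by rewrite distrC [leRHS]distrC [leRHS]ger0_norm ?subr_ge0// stein_rhs_lipschitz_le.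
Qed.

Lemma norm_stein_sol w : `|stein_sol w| <= 1.
Proof.
rewrite /stein_sol normrM normrN normfV ler_pdivrMr ?normr_gt0 ?gt_eqF ?gpdf_gt0//.
rewrite mul1r (ger0_norm (gpdf_ge0 _)) (le_trans (ler_normD _ _))//.
rewrite !normrM (ger0_norm (gcdf_ge0 _)) (ger0_norm (gtail_ge0 _)).
have h1 := ler_wpM2l (gtail_ge0 w) (norm_stein_lower w).
have h2 := ler_wpM2l (gcdf_ge0 w) (norm_stein_upper w).
apply: (le_trans (lerD h1 h2)).
rewrite gprimN /gprim /gtail le_eqVlt; apply/orP; left; apply/eqP; ring.
Qed.

Lemma stein_dsolE w : stein_dsol w =
  stein_lower w * gratio w - stein_upper w * gratio (- w).
Proof.
rewrite /stein_dsol /stein_rhs /stein_sol !gratioE gpdfN gtailN.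
have : gpdf w != 0 by rewrite gt_eqF ?gpdf_gt0.
by move=> ?; field.
Qed.

Lemma norm_stein_dsol w : `|stein_dsol w| <= 4.
Proof.
rewrite stein_dsolE (le_trans (ler_normB _ _))//.
rewrite (_ : 4 = 2 + 2); last by ring.
rewrite (normrM (stein_lower w)) (normrM (stein_upper w)) (ger0_norm (gratio_ge0 w)) (ger0_norm (gratio_ge0 (- w))) lerD//.
  by apply: le_trans (gprim_gratio_le2 w); rewrite ler_wpM2r ?gratio_ge0 ?norm_stein_lower.
by apply: le_trans (gprim_gratio_le2 (- w)); rewrite ler_wpM2r ?gratio_ge0 ?norm_stein_upper.
Qed.

Definition stein_lip : R := 2 * (stein_cst + 2).

Lemma stein_cst_ge4 : 4 <= stein_cst :> R.
Proof. by rewrite lerDl divr_ge0 ?gpdf_ge0. Qed.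

Lemma stein_dsol_lipschitz a b : `|stein_dsol b - stein_dsol a| <= stein_lip * `|b - a|.
Proof.
wlog ab : a b / a <= b.
  move=> h; have [/h//|/ltW /h] := leP a b.
  by rewrite distrC [X in _ -> _ <= _ * X]distrC.
rewrite (ger0_norm (_ : 0 <= b - a)) ?subr_ge0// !stein_dsolE.
have h1 := lipschitz_mul_gratio norm_stein_lower norm_stein_lowerB ab.
have h2 := @lipschitz_mul_gratio R (fun w => stein_upper (- w)) _ _ (- b) (- a).
rewrite /stein_lip (_ : _ - _ =
  (stein_lower b * gratio b - stein_lower a * gratio a) +
  (stein_upper a * gratio (- a) - stein_upper b * gratio (- b))); last by ring.
rewrite (le_trans (ler_normD _ _))//.
rewrite (_ : 2 * _ * _ = (stein_cst + 2) * (b - a) + (stein_cst + 2) * (b - a)); last by ring.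
rewrite lerD//; move: h2; rewrite !opprK (_ : - a + b = b - a) 1?addrC//.
apply; last by rewrite lerN2.
- by move=> w; rewrite (le_trans (norm_stein_upper _))// opprK.
- move=> x y xy; rewrite (le_trans (norm_stein_upperB _))// ?lerN2//.
  by rewrite opprK addrC gtailN.
Qed.

Let num w := - (gtail w * stein_lower w + gcdf w * stein_upper w).

(** The terms linear in b - a cancel and leave the integral over ]a, b] of
    s t * (gcdf t - gcdf b). *)
Let num_incr a b : a <= b ->
  `|num b - num a - (gcdf b - gcdf a) * stein_rhs a| <= (b - a) ^+ 2.
Proof.
move=> ab.
rewrite [X in `|X|](_ : _ = - (gtail b * (stein_lower b - stein_lower a) -
    gcdf b * (stein_upper a - stein_upper b))); last first.
  by rewrite /num /stein_rhs /gtail; ring.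
rewrite normrN stein_lowerB// stein_upperB// -!RintegralZl//; try exact: integrable_sM.
have iZ (r : R) (h : R -> R) : leb.-integrable `]a, b] (EFin \o h) ->
    leb.-integrable `]a, b] (EFin \o (fun t => r * h t)).
  by move=> ih; have := @integrableZl _ _ R leb `]a, b] _ r _ ih; apply.
rewrite -RintegralB//; try by apply: iZ; exact: integrable_sM.
rewrite expr2; apply: le_norm_Rintegral_itv => //; first by rewrite subr_ge0.
  have -> : (EFin \o (fun t => gtail b * (s t * gcdf t) - gcdf b * (s t * gtail t))) =
    ((EFin \o (fun t => gtail b * (s t * gcdf t))%R) \- (EFin \o (fun t => gcdf b * (s t * gtail t))%R))%E.
    by apply/funext => t /=; rewrite EFinB.
  by apply: integrableB => //; apply: iZ; exact: integrable_sM.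
move=> t /andP[at' tb].
rewrite [X in `|X|](_ : _ = s t * (gcdf t - gcdf b)); last by rewrite /gtail; ring.
rewrite normrM (le_trans (_ : _ <= `|gcdf t - gcdf b|)) ?ler_piMl//.
have /andP[c0 c1] := gcdf_incr tb.
by rewrite distrC ger0_norm// (le_trans c1)// lerB// ltW.
Qed.

Let is_derive_num w : is_derive w 1 num (gpdf w * stein_rhs w).
Proof.
have h : is_derive w 1 (fun b => num b - stein_rhs w * gcdf b) 0.
  apply: (@is_derive0_quadratic _ _ 2) => b.
  rewrite [X in `|X|](_ : _ = num b - num w - (gcdf b - gcdf w) * stein_rhs w); last by ring.
  have [/num_incr wb|/ltW bw] := leP w b.
    by rewrite (le_trans wb)// mulr_natl mulr2n lerDl sqr_ge0.
  rewrite [X in `|X|](_ : _ = - (num w - num b - (gcdf w - gcdf b) * stein_rhs b)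
    - (gcdf w - gcdf b) * (stein_rhs b - stein_rhs w)); last by ring.
  rewrite (le_trans (ler_normB _ _))// normrN mulr_natl mulr2n lerD//.
    by rewrite (le_trans (num_incr bw))// le_eqVlt; apply/orP; left; apply/eqP; ring.
  have /andP[c0 c1] := gcdf_incr bw.
  rewrite normrM (ger0_norm c0) (_ : (b - w) ^+ 2 = (w - b) * (w - b)); last by ring.
  rewrite ler_pM//.
  by rewrite (le_trans (stein_rhs_lipschitz _ _))// distrC ger0_norm// subr_ge0.
have hc := is_derive_gcdf w.
rewrite (_ : num = (fun b => num b - stein_rhs w * gcdf b) + (fun b => stein_rhs w * gcdf b)); last first.
  by apply/funext => b; rewrite fctE subrK.
apply: is_derive_eq.
by rewrite /GRing.scale/=; ring.
Qed.

Lemma is_derive_stein_sol w : is_derive w 1 stein_sol (stein_dsol w).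
Proof.
have ? := is_derive_gpdf w; have ? := is_derive_num w.
have ? : gpdf w != 0 by rewrite gt_eqF ?gpdf_gt0.
have ? := @is_deriveV R gpdf w (- w * gpdf w) 1 ltac:(eassumption) ltac:(eassumption).
rewrite (_ : stein_sol = fun w => num w * (gpdf w)^-1)//.
apply: is_derive_eq.
rewrite /stein_dsol /stein_rhs /stein_sol /num /GRing.scale/=.
by field.
Qed.

Lemma continuous_stein_sol : continuous stein_sol.
Proof.
move=> w; apply: differentiable_continuous.
by apply/derivable1_diffP; have [] := is_derive_stein_sol w.
Qed.

Lemma continuous_stein_rhs : continuous stein_rhs.
Proof.
move=> w; apply/cvgrPdistC_le => e e0; near=> t.
apply: le_trans (stein_rhs_lipschitz _ _) _.
by near: t; apply: (@cvgr_distC_le _ _ _ _ _ id).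
Unshelve. all: by end_near. Qed.

Lemma continuous_stein_dsol : continuous stein_dsol.
Proof.
move=> w; apply: cvgD; first exact: continuous_stein_rhs.
by apply: cvgM; [exact: cvg_id|exact: continuous_stein_sol].
Qed.

(** Short increments are controlled by the Lipschitz constant, long ones by
    the supremum of the derivative. The exponent delta is the one that fits
    moments of order 2 + delta. *)
Lemma stein_dsol_holder (delta a b : R) : 0 < delta <= 1 ->
  `|stein_dsol b - stein_dsol a| <= stein_lip * `|b - a| `^ delta.
Proof.
move=> /andP[d0 d1].
have l0 : 8 <= stein_lip by have := stein_cst_ge4; rewrite /stein_lip; lra.
have [ab1|ab1] := leP `|b - a| 1.
  rewrite (le_trans (stein_dsol_lipschitz _ _))//.
  rewrite ler_wpM2l//; first lra.
  have [->|ab0] := eqVneq `|b - a| 0; first by rewrite powR_ge0.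
  rewrite -[leLHS]powRr1// ger_powR// ab1 andbT.
  by rewrite lt_neqAle eq_sym ab0 normr_ge0.
rewrite (le_trans (ler_normB _ _))//.
have h : 1 <= `|b - a| `^ delta.
  by rewrite -(powRr0 `|b - a|) ler_powR// ltW.
have := norm_stein_dsol a; have := norm_stein_dsol b.
by nra.
Qed.

Lemma stein_sol_taylor (delta a b : R) : 0 < delta <= 1 ->
  `|stein_sol b - stein_sol a - (b - a) * stein_dsol a|
    <= stein_lip * (`|b - a| * `|b - a| `^ delta).
Proof.
move=> dd.
suff [c cab ->] : exists2 c, `|c - a| <= `|b - a| & stein_sol b - stein_sol a = stein_dsol c * (b - a).
  rewrite mulrC -mulrBr normrM mulrCA ler_wpM2l//.
  rewrite (le_trans (stein_dsol_holder _ _ dd))// ler_wpM2l//.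
    by have := stein_cst_ge4; rewrite /stein_lip; lra.
  by move/andP: dd => [d0 _]; rewrite ge0_ler_powR ?nnegrE// ltW.
have [ab|/ltW ba] := leP a b.
  have [||c cab cE] := @MVT_segment R stein_sol stein_dsol a b ab.
  - by move=> x _; exact: is_derive_stein_sol.
  - by apply: continuous_subspaceT; exact: continuous_stein_sol.
  exists c => //; move: cab; rewrite in_itv/= => /andP[ac cb].
  by rewrite !ger0_norm ?subr_ge0// lerB.
have [||c cab cE] := @MVT_segment R stein_sol stein_dsol b a ba.
- by move=> x _; exact: is_derive_stein_sol.
- by apply: continuous_subspaceT; exact: continuous_stein_sol.
exists c; move: cab; rewrite in_itv/= => /andP[bc ca].
  by rewrite !ler0_norm ?subr_le0// !opprB lerB.
by rewrite -[LHS]opprB cE -mulrN opprB.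
Qed.

End stein_solution.

Section stein_kernel.
Context {R : realType}.
Implicit Types w t x a b c : R.
Notation leb := (@lebesgue_measure R).
Variable s : R -> R.
Hypothesis ms : measurable_fun setT s.
Hypothesis s_le1 : forall t, `|s t| <= 1.

Let ker w t : R := s t * (gcdf t - (w <= t)%R%:R).

Let measurable_ker w : measurable_fun setT (ker w).
Proof.
apply: measurable_funM => //; apply: measurable_funB.
  by apply: continuous_measurable_fun; exact: continuous_gcdf.
have -> : (fun t => (w <= t)%R%:R) = \1_(`[w, +oo[%classic) :> (R -> R).
  by apply/funext => t; rewrite indicE mem_setE in_itv/= andbT.
exact: measurable_indic.
Qed.

Let setT_split w : [set: R] = `]-oo, w[%classic `|` `[w, +oo[%classic.
Proof. by rewrite -set_itvNyy; exact: itv_bndbnd_setU. Qed.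

Let disj_split w : [disjoint `]-oo, w[%classic & `[w, +oo[%classic].
Proof.
apply/disj_setPS => y [/=]; rewrite 2!in_itv/= andbT.
by move=> yw wy; move: (le_lt_trans wy yw); rewrite ltxx.
Qed.

Let kerN w t : (`]-oo, w[%classic : set R) t -> ker w t = s t * gcdf t.
Proof. by rewrite /= in_itv/= /ker => tw; rewrite leNgt tw subr0. Qed.

Let kerP w t : (`[w, +oo[%classic : set R) t -> ker w t = - (s t * gtail t).
Proof. by rewrite /= in_itv/= andbT /ker => tw; rewrite tw /gtail mulr1n; ring. Qed.

Lemma integral_norm_stein_kernel w :
  (\int[leb]_t `|(ker w t)%:E| <= (gprim w + gprim (- w))%:E)%E.
Proof.
rewrite (setT_split w) ge0_integral_setU//; last first.
  by apply: measurable_funTS; apply: measurableT_comp => //; apply/measurable_EFinP; exact: measurable_ker.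
rewrite EFinD; apply: leeD.
  rewrite -integral_gcdf -integral_itv_bndo_bndc; last first.
    apply/measurable_EFinP; apply: measurable_funTS.
    by apply: continuous_measurable_fun; exact: continuous_gcdf.
  apply: ge0_le_integral => //.
  - by apply: measurable_funTS; apply: measurableT_comp => //; apply/measurable_EFinP; exact: measurable_ker.
  - apply/measurable_EFinP; apply: measurable_funTS.
    by apply: continuous_measurable_fun; exact: continuous_gcdf.
  - move=> t /kerN ->; rewrite lee_fin normrM (ger0_norm (gcdf_ge0 _)).
    by rewrite ler_piMl ?gcdf_ge0.
rewrite gprimN -integral_gtail; apply: ge0_le_integral => //.
- by apply: measurable_funTS; apply: measurableT_comp => //; apply/measurable_EFinP; exact: measurable_ker.
- apply/measurable_EFinP; apply: measurable_funTS.
  by apply: continuous_measurable_fun; exact: continuous_gtail.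
- move=> t /kerP ->; rewrite lee_fin normrN normrM (ger0_norm (gtail_ge0 _)).
  by rewrite ler_piMl ?gtail_ge0.
Qed.

Lemma integrable_stein_kernel w : leb.-integrable setT (EFin \o ker w).
Proof.
apply/integrableP; split; first by apply/measurable_EFinP; exact: measurable_ker.
exact: le_lt_trans (integral_norm_stein_kernel w) (ltry _).
Qed.

(** The form of the test function that appears when Fubini's theorem is applied
    to the integral of a difference of distribution functions. *)
Lemma stein_rhsE w : \int[leb]_t (ker w t) = stein_rhs s w.
Proof.
have ik := integrable_stein_kernel w.
rewrite (setT_split w) Rintegral_setU//; last first.
  by apply: integrableS ik => //; exact: measurableU.
rewrite /stein_rhs /stein_lower /stein_upper; congr (_ + _).
  rewrite -[RHS]Rintegral_itv_bndo_bndc; last first.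
    apply: integrableS (integrable_sM ms s_le1 _ (integrable_gcdf w)) => //.
    by apply: subset_itvl; rewrite bnd_simp.
  by apply: eq_Rintegral => t; rewrite inE => /kerN.
have isg : leb.-integrable `]w, +oo[ (EFin \o (fun t => s t * gtail t)).
  exact: (integrable_sM ms s_le1 _ (integrable_gtail w)).
rewrite -mulN1r -RintegralZl// -Rintegral_itv_obnd_cbnd; last by apply: integrableS ik.
apply: eq_Rintegral => t; rewrite inE/= in_itv/= andbT => /ltW wt.
by rewrite kerP ?mulN1r//= in_itv/= wt.
Qed.

End stein_kernel.

(** * The Wasserstein distance to the Gaussian law as an expectation *)

Lemma measurable_stein_rhs {R : realType} (s : R -> R)
    (ms : measurable_fun setT s) (s_le1 : forall t, `|s t| <= 1) :
  measurable_fun setT (stein_rhs s).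
Proof. by apply: continuous_measurable_fun; exact: continuous_stein_rhs. Qed.

Lemma integrable_stein_rhs_comp {R : realType} d (T : measurableType d)
    (P : probability T R) (M : T -> R) (s : R -> R) :
  measurable_fun setT s -> (forall t, `|s t| <= 1) ->
  measurable_fun setT M -> P.-integrable setT (EFin \o M) ->
  P.-integrable setT (EFin \o (fun w => stein_rhs s (M w))).
Proof.
move=> ms s1 mM iM.
have ic : P.-integrable setT (EFin \o cst `|stein_rhs s 0|).
  exact: finite_measure_integrable_cst.
apply: le_integrable (integrableD _ ic (integrable_abse iM)) => //=.
  apply/measurable_EFinP; apply: measurableT_comp mM.
  exact: measurable_stein_rhs.
move=> w _; rewrite lee_fin [leRHS]ger0_norm ?addr_ge0//.
rewrite -lerBlDl (le_trans (lerB_dist _ _))//.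
by rewrite (le_trans (stein_rhs_lipschitz ms s1 _ _))// subr0.
Qed.

Section wasserstein_stein.
Context {R : realType} d (T : measurableType d) (P : probability T R).
Notation leb := (@lebesgue_measure R).
Variable M : T -> R.
Hypothesis mM : measurable_fun setT M.
Hypothesis iM : P.-integrable setT (EFin \o M).

Let F t : R := fine (P [set w | M w <= t]).

Let measurable_le t : measurable [set w | M w <= t].
Proof.
rewrite -[X in measurable X]setTI.
by apply: measurable_fun_le => //; exact: measurable_cst.
Qed.

Let PF t : P [set w | M w <= t] = (F t)%:E.
Proof. by rewrite /F fineK// fin_num_measure. Qed.

Let FE t : F t = \int[P]_w (M w <= t)%R%:R.
Proof.
rewrite /F /Rintegral; congr fine.
rewrite -[in LHS](setIT [set w | M w <= t]) -integral_indic//.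
apply: eq_integral => w _; rewrite indicE.
suff -> : (w \in [set w | M w <= t]) = (M w <= t) by [].
by apply/idP/idP; rewrite in_setE.
Qed.

Let measurable_F : measurable_fun setT F.
Proof.
apply: nondecreasing_measurable => // a b ab.
rewrite fine_le ?fin_num_measure// le_measure ?inE// => w /= /le_trans; exact.
Qed.

Let s t : R := if gcdf t <= F t then 1 else -1.

Let measurable_gcdf : measurable_fun setT (@gcdf R).
Proof. by apply: continuous_measurable_fun; exact: continuous_gcdf. Qed.

Let ms : measurable_fun setT s.
Proof.
apply: measurable_fun_ifT => //.
exact: measurable_fun_ler.
Qed.

Let s_le1 t : `|s t| <= 1.
Proof. by rewrite /s; case: ifP; rewrite ?normrN normr1. Qed.

Let ker (z : T * R) : R := - (s z.2 * (gcdf z.2 - (M z.1 <= z.2)%R%:R)).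

Let measurable_ker : measurable_fun setT ker.
Proof.
apply: measurableT_comp => //.
apply: measurable_funM; first exact: measurableT_comp ms _.
apply: measurable_funB; first exact: measurableT_comp measurable_gcdf _.
have -> : (fun z : T * R => (M z.1 <= z.2)%R%:R) =
    \1_[set z | M z.1 <= z.2] :> (T * R -> R).
  apply/funext => t; rewrite indicE.
  suff -> : (t \in [set z | M z.1 <= z.2]) = (M t.1 <= t.2) by [].
  by apply/idP/idP; rewrite in_setE.
apply: measurable_indic; rewrite -[X in measurable X]setTI.
by apply: measurable_fun_le => //; exact: measurableT_comp mM _.
Qed.

Let gprim_le_norm (x : R) : gprim x + gprim (- x) <= 2 + 2 * `|x|.
Proof.
rewrite gprimN /gprim.
have := gpdf_le1 x; have := gcdf_ge0 x; have := gcdf_le1 x.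
have := gtail_ge0 x; have := gtail_le1 x.
have := ler_norm x; have := ler_norm (- x); rewrite normrN.
by have := normr_ge0 x; nra.
Qed.

Let integrable_ker : (P \x leb)%E.-integrable setT (EFin \o ker).
Proof.
apply/(@integrable12ltyP _ _ T _ R P leb) => //=; first exact/measurable_EFinP.
apply: (@le_lt_trans _ _ (\int[P]_w (2%:E + 2%:E * `|(M w)%:E|)%E)%E).
  apply: ge0_le_integral => //=.
  - by move=> w _; apply: integral_ge0 => t _; rewrite lee_fin.
  - have /= := @measurable_fun_fubini_tonelli_F _ _ T _ R leb (abse \o (EFin \o ker)).
    by apply => //; apply: measurableT_comp => //; exact/measurable_EFinP.
  - apply/measurable_EFinP => /=; apply: measurable_funD => //; apply: measurable_funM => //.
    exact: measurableT_comp.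
  - move=> w _; under eq_integral do rewrite normrN.
    apply: (le_trans (integral_norm_stein_kernel ms s_le1 (M w))).
    by rewrite -EFinM -EFinD lee_fin gprim_le_norm.
have /integrableP[_] : P.-integrable setT (fun w => 2%:E + 2%:E * `|(M w)%:E|)%E.
  apply: integrableD => //; first by apply: finite_measure_integrable_cst.
  by apply: integrableZl => //; exact: integrable_abse iM.
apply: le_lt_trans; rewrite le_eqVlt; apply/orP; left; apply/eqP.
by apply: eq_integral => w _; rewrite [RHS]gee0_abs// adde_ge0// mule_ge0.
Qed.

(** Let F be the distribution function of M, and s the sign of F - gcdf. Then
    the integrand of the distance is s t * (F t - gcdf t), and F t is the
    expectation of 1_(M <= t): exchanging the two integrals makes stein_rhs s
    appear. *)
Lemma d_w_stein : exists s : R -> R, [/\ measurable_fun setT s,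
  forall t, `|s t| <= 1 & d_w P M = (- \int[P]_w stein_rhs s (M w))%:E].
Proof.
exists s; split => //.
have fubini := @Fubini _ _ T _ R P leb (EFin \o ker) integrable_ker.
transitivity (\int[leb]_t \int[P]_w (ker (w, t))%:E)%E.
  apply: eq_integral => t _.
  have ->: (\int[P]_w (ker (w, t))%:E = (- (s t * (gcdf t - F t)))%:E)%E.
    have mb : measurable_fun setT (fun w => (M w <= t)%R%:R : R).
      have -> : (fun w => (M w <= t)%R%:R) = \1_[set w | M w <= t] :> (T -> R).
        apply/funext => w; rewrite indicE.
        suff -> : (w \in [set w | M w <= t]) = (M w <= t) by [].
        by apply/idP/idP; rewrite in_setE.
      exact: measurable_indic.
    have ic : P.-integrable setT (EFin \o cst (gcdf t)).
      exact: finite_measure_integrable_cst.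
    have ib : P.-integrable setT (EFin \o (fun w => (M w <= t)%R%:R)).
      have i1 : P.-integrable setT (EFin \o cst 1) by exact: finite_measure_integrable_cst.
      apply: le_integrable i1 => //=.
        exact/measurable_EFinP.
      by move=> w _; rewrite lee_fin; case: (M w <= t); rewrite ?normr1 ?normr0.
    have icb : P.-integrable setT (EFin \o (fun w => gcdf t - (M w <= t)%R%:R)).
      have := integrableB measurableT ic ib.
      by apply: eq_integrable => // w _ /=; rewrite EFinB.
    transitivity (\int[P]_w (- s t * (gcdf t - (M w <= t)%R%:R)))%:E.
      rewrite /Rintegral fineK; last first.
        apply: integrable_fin_num => //.
        have := integrableZl measurableT (- s t) icb.
        by apply: eq_integrable => // w _ /=; rewrite EFinM.
      by apply: eq_integral => w _; rewrite mulNr.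
    rewrite RintegralZl// RintegralB// Rintegral_cst// [X in fine X]probability_setT mulr1.
    by rewrite FE mulNr.
  rewrite PF normal_cdfE -EFinB; congr EFin.
  rewrite /s; case: ifPn => [|]; rewrite -?ltNge => h.
    by rewrite ger0_norm ?subr_ge0// mul1r opprB.
  by rewrite ltr0_norm ?subr_lt0// mulN1r opprK opprB.
rewrite -fubini -mulN1r -RintegralZl//; last exact: integrable_stein_rhs_comp.
rewrite /Rintegral fineK//; last first.
  apply: integrable_fin_num => //.
  have := integrableZl measurableT (-1) (integrable_stein_rhs_comp ms s_le1 mM iM).
  by apply.
apply: eq_integral => w _.
rewrite mulN1r -(stein_rhsE ms s_le1) -mulN1r -RintegralZl//; last exact: integrable_stein_kernel.
rewrite /Rintegral fineK//.
  by apply: eq_integral => t _; rewrite mulN1r.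
apply: integrable_fin_num => //.
by have := integrableZl measurableT (-1) (integrable_stein_kernel ms s_le1 (M w)); apply.
Qed.
End wasserstein_stein.

(** * Independence *)

Section independence_tools.
Context {R : realType} d (T : measurableType d) (P : probability T R).

Definition indep_sets (G H : set (set T)) :=
  forall A B, G A -> H B -> P (A `&` B) = (P A * P B)%E.

(** For fixed B, the events A satisfying the product formula form a
    lambda-system. *)
Lemma indep_sets_sigma (G H : set (set T)) :
  setI_closed G -> G `<=` measurable -> H `<=` measurable ->
  indep_sets G H -> indep_sets <<s G >> H.
Proof.
move=> GI Gm Hm GH A B sA HB.
have sGm : <<s G >> `<=` measurable.
  by apply: smallest_sub => //; exact: sigma_algebra_measurable.
have mB := Hm _ HB.
have fB : P B \is a fin_num by rewrite fin_num_measure.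
pose Q A := P (A `&` B) = (P A * P B)%E.
apply: (@dynkin_induction _ (g_sigma_algebraType G) G Q) => //.
- by rewrite /Q setTI probability_setT mul1e.
- by move=> X GX; exact: GH.
- move=> X /sGm mX QX; rewrite /Q setIC -setDE measureD// ?ltey_eq ?fB//.
  transitivity (P B - P X * P B)%E; first by rewrite -QX setIC.
  rewrite probability_setC// muleBl ?fin_num_adde_defr ?fin_num_measure//.
  by rewrite mul1e.
- move=> F mF tF QF; rewrite /Q setI_bigcupl measure_bigcup//; last 2 first.
  + by move=> n _; apply: measurableI => //; exact: sGm (mF n).
  + exact: trivIset_setIr.
  rewrite measure_bigcup//; last by move=> n _; exact: sGm (mF n).
  rewrite -(fineK fB) muleC -nneseriesZl//.
  by apply: eq_eseriesr => n _; rewrite fineK// muleC; exact: QF.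
Qed.

End independence_tools.

Section independent_variables.
Context {R : realType} d (T : measurableType d) (P : probability T R).
Context d1 d2 (T1 : measurableType d1) (T2 : measurableType d2).

Definition indep_rv (U : T -> T1) (V : T -> T2) :=
  forall A B, measurable A -> measurable B ->
    P (U @^-1` A `&` V @^-1` B) = (P (U @^-1` A) * P (V @^-1` B))%E.

Variables (U0 : T -> T1) (V0 : T -> T2).
Hypotheses (mU0 : measurable_fun setT U0) (mV0 : measurable_fun setT V0).
Hypothesis UV : indep_rv U0 V0.

Let U := U0.
Let V := V0.
Let pairUV w := (U w, V w).

HB.instance Definition _ := @isMeasurableFun.Build _ _ _ _ U mU0.
HB.instance Definition _ := @isMeasurableFun.Build _ _ _ _ V mV0.

Let measurable_pairUV : measurable_fun setT pairUV.
Proof. exact: measurable_fun_pair. Qed.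

HB.instance Definition _ := @isMeasurableFun.Build _ _ _ _ pairUV measurable_pairUV.

Let distUV (X : set (T1 * T2)) : measurable X ->
  (distribution P U \x distribution P V)%E X = distribution P pairUV X.
Proof.
apply: product_measure_unique => A B mA mB.
by rewrite /distribution /pushforward/= -/U -/V -UV.
Qed.

(** The joint law of U0 and V0 is the product of their laws, and Tonelli's
    theorem applies. The spaces T1 and T2 are arbitrary: below, V0 is the
    identity of T with the sigma-algebra of a whole generation. *)
Lemma ge0_integral_indep (f : T1 * T2 -> \bar R) :
  measurable_fun setT f -> (forall z, 0 <= f z)%E ->
  (\int[P]_w f (U0 w, V0 w) = \int[P]_w \int[P]_w' f (U0 w, V0 w'))%E.
Proof.
move=> mf f0.
have <- := @ge0_integral_distribution _ _ _ _ _ P pairUV f mf f0.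
rewrite (eq_measure_integral (distribution P U \x distribution P V)%E); last first.
  by move=> A mA _; exact/esym/distUV.
rewrite fubini_tonelli1// ge0_integral_distribution//=.
- apply: eq_integral => w _; rewrite /fubini_F ge0_integral_distribution//.
  exact: measurableT_comp.
- exact: measurable_fun_fubini_tonelli_F.
- by move=> x; apply: integral_ge0.
Qed.

End independent_variables.

Section expectation_of_product.
Context {R : realType} d (T : measurableType d) (P : probability T R).
Implicit Types u v : T -> R.

Lemma indep_rv_comp d1 d2 (T1 : measurableType d1) (T2 : measurableType d2)
    d3 d4 (T3 : measurableType d3) (T4 : measurableType d4)
    (U : T -> T1) (V : T -> T2) (f : T1 -> T3) (g : T2 -> T4) :
  indep_rv P U V -> measurable_fun setT f -> measurable_fun setT g ->
  indep_rv P (f \o U) (g \o V).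
Proof.
move=> UV mf mg A B mA mB.
apply: (UV (f @^-1` A) (g @^-1` B)).
  by rewrite -[X in measurable X]setTI; exact: mf.
by rewrite -[X in measurable X]setTI; exact: mg.
Qed.

Lemma ge0_integral_prod_indep u v :
  measurable_fun setT u -> measurable_fun setT v -> indep_rv P u v ->
  (forall w, 0 <= u w) -> (forall w, 0 <= v w) ->
  (\int[P]_w (u w * v w)%:E = (\int[P]_w (u w)%:E) * (\int[P]_w (v w)%:E))%E.
Proof.
move=> mu mv uv u0 v0.
have h := @ge0_integral_indep _ _ _ P _ _ _ _ u v mu mv uv (fun z => (`|z.1| * `|z.2|)%:E).
transitivity (\int[P]_w (`|u w| * `|v w|)%:E)%E.
  by apply: eq_integral => w _; rewrite !ger0_norm.
rewrite [LHS]h; last 2 first.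
- apply/measurable_EFinP; apply: measurable_funM.
    exact: measurableT_comp measurable_fst.
  exact: measurableT_comp measurable_snd.
- by move=> z; rewrite lee_fin mulr_ge0.
under eq_integral => w _.
  under eq_integral do rewrite /= !ger0_norm// EFinM.
  rewrite ge0_integralZl//=; last 3 first.
  - exact/measurable_EFinP.
  - by move=> ? _; rewrite lee_fin.
  - by rewrite lee_fin.
  over.
rewrite /= ge0_integralZr//.
- exact/measurable_EFinP.
- by move=> ? _; rewrite lee_fin.
- by apply: integral_ge0 => ? _; rewrite lee_fin.
Qed.

Lemma integrable_prod_indep u v : indep_rv P u v ->
  P.-integrable setT (EFin \o u) -> P.-integrable setT (EFin \o v) ->
  P.-integrable setT (EFin \o (fun w => u w * v w)).
Proof.
move=> uv iu iv.
have mu : measurable_fun setT u by apply/measurable_EFinP; case/integrableP : iu.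
have mv : measurable_fun setT v by apply/measurable_EFinP; case/integrableP : iv.
apply/integrableP; split; first by apply/measurable_EFinP; exact: measurable_funM.
under eq_integral do rewrite /= normrM.
have mn : measurable_fun setT (@Num.norm R R) by [].
rewrite (ge0_integral_prod_indep (u := fun w => `|u w|) (v := fun w => `|v w|))//.
- case/integrableP : iu => _ /= iu; case/integrableP : iv => _ /= iv.
  apply: lte_mul_pinfty => //; first exact: integral_ge0.
  by rewrite ge0_fin_numE//; exact: integral_ge0.
- exact: measurableT_comp.
- exact: measurableT_comp.
- exact: (indep_rv_comp uv mn mn).
Qed.

Lemma Rintegral_prod_indep u v : indep_rv P u v ->
  P.-integrable setT (EFin \o u) -> P.-integrable setT (EFin \o v) ->
  \int[P]_w (u w * v w) = (\int[P]_w u w) * (\int[P]_w v w).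
Proof.
move=> uv iu iv.
have mu : measurable_fun setT u by apply/measurable_EFinP; case/integrableP : iu.
have mv : measurable_fun setT v by apply/measurable_EFinP; case/integrableP : iv.
(* The positive part for b = false, the negative part for b = true. *)
pose h (b : bool) (x : R) : R := Num.max ((-1) ^+ b * x) 0.
have mh b : measurable_fun setT (h b).
  by apply: measurable_maxr => //; exact: measurable_funM.
have h0 b x : 0 <= h b x by rewrite le_max lexx orbT.
have hle b x : h b x <= `|x|.
  by rewrite ge_max normr_ge0 andbT (le_trans (ler_norm _))// normrM normrX normrN1 expr1n mul1r.
have hE x : x = h false x - h true x.
  by rewrite /h expr0 expr1 mul1r mulN1r /Num.max; do 2 case: ifP; lra.
have ih (f : T -> R) b : P.-integrable setT (EFin \o f) ->
    P.-integrable setT (EFin \o (h b \o f)).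
  move=> iF; have mf : measurable_fun setT f by apply/measurable_EFinP; case/integrableP : iF.
  apply: le_integrable iF => //=.
    by apply/measurable_EFinP; exact: measurableT_comp.
  by move=> w _; rewrite lee_fin ger0_norm.
have ihh b c : P.-integrable setT (EFin \o (fun w => h b (u w) * h c (v w))).
  by apply: integrable_prod_indep; [exact: indep_rv_comp|exact: ih|exact: ih].
have Eh b c : \int[P]_w (h b (u w) * h c (v w)) =
    (\int[P]_w h b (u w)) * (\int[P]_w h c (v w)).
  rewrite /Rintegral -fineM; last 2 first.
  - exact: (integrable_fin_num measurableT (ih _ _ iu)).
  - exact: (integrable_fin_num measurableT (ih _ _ iv)).
  congr fine; apply: (ge0_integral_prod_indep (u := h b \o u) (v := h c \o v)) => //.
  - exact: measurableT_comp.
  - exact: measurableT_comp.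
  - exact: indep_rv_comp.
  - by move=> w; exact: h0.
  - by move=> w; exact: h0.
have EB (f g : T -> R) : P.-integrable setT (EFin \o f) -> P.-integrable setT (EFin \o g) ->
    \int[P]_w (f w - g w) = \int[P]_w f w - \int[P]_w g w.
  by move=> iF ig; rewrite RintegralB.
have Ew (f : T -> R) : P.-integrable setT (EFin \o f) ->
    \int[P]_w f w = \int[P]_w h false (f w) - \int[P]_w h true (f w).
  move=> iF; rewrite -EB; [|exact: ih|exact: ih].
  by apply: eq_Rintegral => w _; exact: hE.
rewrite (Ew _ iu) (Ew _ iv).
have iB (f g : T -> R) : P.-integrable setT (EFin \o f) -> P.-integrable setT (EFin \o g) ->
    P.-integrable setT (EFin \o (fun w => f w - g w)).
  move=> iF ig; have := integrableB measurableT iF ig.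
  by apply: eq_integrable => // w _ /=; rewrite EFinB.
transitivity (\int[P]_w ((h false (u w) * h false (v w) - h false (u w) * h true (v w))
   - (h true (u w) * h false (v w) - h true (u w) * h true (v w)))).
  by apply: eq_Rintegral => w _; rewrite {1}(hE (u w)) {1}(hE (v w)); ring.
rewrite (EB _ _ (iB _ _ (ihh false false) (ihh false true))
  (iB _ _ (ihh true false) (ihh true true))).
rewrite !EB// !Eh.
by ring.
Qed.

End expectation_of_product.

(** * Expectations and moments of real functions *)

Section real_expectation.
Context {R : realType} d (T : measurableType d) (P : probability T R).
Implicit Types f g : T -> R.

Definition intg f := P.-integrable setT (EFin \o f).
Definition mean f : R := \int[P]_w f w.

Lemma measurable_powR_norm (a : R) f : measurable_fun setT f ->
  measurable_fun setT (fun w => `|f w| `^ a).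
Proof.
move=> mf; apply: (@measurableT_comp _ _ _ _ _ _ (@powR R ^~ a)) => //.
exact: measurableT_comp.
Qed.

Lemma intg_measurable f : intg f -> measurable_fun setT f.
Proof. by case/integrableP => /measurable_EFinP. Qed.

Lemma intg_dom f g : measurable_fun setT f -> (forall w, `|f w| <= g w) ->
  intg g -> intg f.
Proof.
move=> mf fg ig; apply: le_integrable ig => //=; first exact/measurable_EFinP.
by move=> w _; rewrite lee_fin (le_trans (fg w))// ler_norm.
Qed.

Lemma intg_cst (c : R) : intg (fun=> c).
Proof. exact: finite_measure_integrable_cst. Qed.

Lemma intg_bounded f c : measurable_fun setT f -> (forall w, `|f w| <= c) -> intg f.
Proof. by move=> mf fc; apply: intg_dom (intg_cst c). Qed.

Lemma intgD f g : intg f -> intg g -> intg (fun w => f w + g w).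
Proof.
move=> iF ig; have := integrableD measurableT iF ig.
by apply: eq_integrable => // w _ /=; rewrite EFinD.
Qed.

Lemma intgB f g : intg f -> intg g -> intg (fun w => f w - g w).
Proof.
move=> iF ig; have := integrableB measurableT iF ig.
by apply: eq_integrable => // w _ /=; rewrite EFinB.
Qed.

Lemma intgZ c f : intg f -> intg (fun w => c * f w).
Proof.
move=> iF; have := integrableZl measurableT c iF.
by apply: eq_integrable => // w _ /=; rewrite EFinM.
Qed.

Lemma intg_abs f : intg f -> intg (fun w => `|f w|).
Proof. by move=> iF; have := integrable_abse iF. Qed.

Lemma intg_sum (I : Type) (r : seq I) (f : I -> T -> R) :
  (forall i, intg (f i)) -> intg (fun w => \sum_(i <- r) f i w).
Proof.
move=> iF; elim: r => [|i r ih].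
  by under eq_fun do rewrite big_nil; exact: intg_cst.
by under eq_fun do rewrite big_cons; exact: intgD.
Qed.

Lemma meanD f g : intg f -> intg g -> mean (fun w => f w + g w) = mean f + mean g.
Proof. by move=> iF ig; rewrite /mean RintegralD. Qed.

Lemma meanB f g : intg f -> intg g -> mean (fun w => f w - g w) = mean f - mean g.
Proof. by move=> iF ig; rewrite /mean RintegralB. Qed.

Lemma meanZ c f : intg f -> mean (fun w => c * f w) = c * mean f.
Proof. by move=> iF; rewrite /mean RintegralZl. Qed.

Lemma mean_cst c : mean (fun=> c) = c.
Proof. by rewrite /mean Rintegral_cst// [X in fine X]probability_setT mulr1. Qed.

Lemma mean_sum (I : Type) (r : seq I) (f : I -> T -> R) :
  (forall i, intg (f i)) ->
  mean (fun w => \sum_(i <- r) f i w) = \sum_(i <- r) mean (f i).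
Proof.
move=> iF; elim: r => [|i r ih].
  by under [X in mean X]eq_fun do rewrite big_nil; rewrite big_nil mean_cst.
under [X in mean X]eq_fun do rewrite big_cons.
by rewrite big_cons meanD ?ih//; exact: intg_sum.
Qed.

Lemma mean_le f g : intg f -> intg g -> (forall w, f w <= g w) -> mean f <= mean g.
Proof. by move=> iF ig fg; apply: le_Rintegral. Qed.

Lemma mean_ge0 f : (forall w, 0 <= f w) -> 0 <= mean f.
Proof. by move=> f0; apply: Rintegral_ge0. Qed.

Lemma mean_abs f : intg f -> `|mean f| <= mean (fun w => `|f w|).
Proof. by move=> iF; apply: le_normr_Rintegral. Qed.

Lemma mean_indep f g : indep_rv P f g -> intg f -> intg g ->
  mean (fun w => f w * g w) = mean f * mean g.
Proof. exact: Rintegral_prod_indep. Qed.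

Lemma intg_indep f g : indep_rv P f g -> intg f -> intg g ->
  intg (fun w => f w * g w).
Proof. exact: integrable_prod_indep. Qed.

End real_expectation.

Lemma powR_le_add {R : realType} (x a b : R) : 0 <= x -> 0 < a <= b ->
  x `^ a <= 1 + x `^ b.
Proof.
move=> x0 /andP[a0 ab]; have [x1|x1] := leP x 1.
  rewrite (le_trans (_ : _ <= 1))// ?lerDl ?powR_ge0//.
  by have := @ge0_ler_powR R a (ltW a0) x 1; rewrite !nnegrE powR1; apply.
by rewrite (le_trans (_ : _ <= x `^ b)) ?lerDr// ler_powR// ltW.
Qed.

(** The constant is 2 ^ 3, as 2 + delta <= 3. *)
Lemma powR_normB_le {R : realType} (delta x y : R) : 0 < delta <= 1 ->
  `|x - y| `^ (2 + delta) <= 8 * (`|x| `^ (2 + delta) + `|y| `^ (2 + delta)).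
Proof.
move=> /andP[d0 d1].
have p0 : 0 < 2 + delta by lra.
have two : 2 `^ (2 + delta) <= 8 :> R.
  have -> : 8 = 2 `^ 3 :> R by rewrite powR_mulrn//; ring.
  by rewrite ler_powR ?ler1n//; lra.
wlog xy : x y / `|x| <= `|y|.
  move=> hw; have [/hw//|/ltW/hw] := leP `|x| `|y|.
  by rewrite distrC (addrC (`|y| `^ _)).
rewrite (@le_trans _ _ ((2 * `|y|) `^ (2 + delta)))//.
  rewrite ge0_ler_powR ?nnegrE ?mulr_ge0// ?(ltW p0)//.
  by rewrite (le_trans (ler_normB _ _))// mulr_natl mulr2n lerD.
by rewrite powRM// ler_pM ?powR_ge0// lerDr powR_ge0.
Qed.

Section moments.
Context {R : realType} d (T : measurableType d) (P : probability T R).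
Implicit Types f g : T -> R.

Lemma intg_ae_le f g : measurable_fun setT f -> measurable_fun setT g ->
  (forall w, 0 <= g w) -> {ae P, forall w, `|f w| <= g w} ->
  (\int[P]_w (g w)%:E < +oo)%E -> intg P f.
Proof.
move=> mf mg g0 fg gfin; apply/integrableP; split; first exact/measurable_EFinP.
apply: le_lt_trans gfin.
have mF : measurable_fun setT (fun w => (`|(EFin \o f) w|)%E).
  by apply: measurableT_comp => //; exact/measurable_EFinP.
have mG : measurable_fun setT (fun w => (g w)%:E) by exact/measurable_EFinP.
apply: (ae_ge0_le_integral measurableT _ mF _ mG).
- by move=> w _; exact: abse_ge0.
- by move=> w _; rewrite lee_fin.
by apply: filterS fg => w h _; rewrite /= lee_fin.
Qed.

Lemma mean_ae f g : measurable_fun setT f -> measurable_fun setT g ->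
  {ae P, forall w, f w = g w} -> mean P f = mean P g.
Proof.
move=> mf mg fg; rewrite /mean /Rintegral; congr fine; apply: ae_eq_integral => //.
- exact/measurable_EFinP.
- exact/measurable_EFinP.
- by apply: filterS fg => w h _; rewrite h.
Qed.

Lemma intg_sqr_of_moment f (r : R) : 2 <= r -> measurable_fun setT f ->
  intg P (fun w => `|f w| `^ r) -> intg P (fun w => f w ^+ 2).
Proof.
move=> r2 mf iF.
apply: (@intg_dom _ _ _ P _ (fun w => 1 + `|f w| `^ r)).
- exact: measurable_funX.
- by move=> w; rewrite normrX -powR_mulrn// powR_le_add// r2 andbT.
exact: (intgD (intg_cst P 1) iF).
Qed.

Lemma intg_of_sqr f : measurable_fun setT f ->
  intg P (fun w => f w ^+ 2) -> intg P f.
Proof.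
move=> mf iF; apply: (@intg_dom _ _ _ P _ (fun w => 1 + f w ^+ 2)) => //.
  by move=> w; rewrite -real_normK ?num_real//; have := sqr_ge0 (`|f w| - 1); nra.
exact: (intgD (intg_cst P 1) iF).
Qed.

Lemma intg_moment_shift f (c delta : R) : 0 < delta <= 1 ->
  measurable_fun setT f -> intg P (fun w => `|f w| `^ (2 + delta)) ->
  intg P (fun w => `|f w - c| `^ (2 + delta)).
Proof.
move=> d01 mf iF.
apply: (@intg_dom _ _ _ P _ (fun w => 8 * (`|f w| `^ (2 + delta) + `|c| `^ (2 + delta)))).
- by apply: measurable_powR_norm; exact: measurable_funB.
- by move=> w; rewrite ger0_norm ?powR_ge0//; exact: powR_normB_le.
exact: (intgZ 8 (intgD iF (intg_cst P _))).
Qed.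

Lemma integral_le_intg f (C : R) : measurable_fun setT f ->
  (\int[P]_w `|f w|%:E <= C%:E)%E -> intg P f /\ mean P (fun w => `|f w|) <= C.
Proof.
move=> mf fC.
have iF : intg P f.
  apply/integrableP; split; first exact/measurable_EFinP.
  exact: le_lt_trans fC (ltry _).
split => //; rewrite -lee_fin.
by rewrite /mean /Rintegral fineK//; exact: (integrable_fin_num measurableT (intg_abs iF)).
Qed.

End moments.

(** * A central limit estimate by Stein's method *)

Section stein_clt.
Context {R : realType} d (T : measurableType d) (P : probability T R).
Variables (s : R -> R) (ms : measurable_fun setT s) (s_le1 : forall t, `|s t| <= 1).
Variables (delta : R) (delta01 : 0 < delta <= 1).
Variables (N : nat) (eta : 'I_N -> T -> R).
Hypothesis meta : forall k, measurable_fun setT (eta k).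
Hypothesis eta_moment : forall k, intg P (fun w => `|eta k w| `^ (2 + delta)).
Hypothesis eta_mean : forall k, mean P (eta k) = 0.
Hypothesis eta_var : \sum_k mean P (fun w => eta k w ^+ 2) = 1.

Let S w := \sum_k eta k w.
Let S' k w := \sum_(j | j != k) eta j w.

Hypothesis eta_indep : forall k, indep_rv P (eta k) (S' k).

Local Notation E := (mean P).
Local Notation f := (stein_sol s).
Local Notation g := (stein_dsol s).
Local Notation beta k := (mean P (fun w => `|eta k w| `^ (2 + delta))).

Let d0 : 0 < delta. Proof. by case/andP: delta01. Qed.

Let intg_pow k (a : R) : 0 < a <= 2 + delta -> intg P (fun w => `|eta k w| `^ a).
Proof.
move=> ha; apply: intg_dom (intgD (intg_cst P 1) (eta_moment k)).
  by apply: measurable_powR_norm.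
by move=> w; rewrite ger0_norm ?powR_ge0// powR_le_add.
Qed.

Let mS : measurable_fun setT S.
Proof. exact: measurable_sum. Qed.

Let mS' k : measurable_fun setT (S' k).
Proof.
rewrite (_ : S' k = fun w => \sum_j (if j != k then eta j w else 0)); last first.
  by apply/funext => w; rewrite /S' big_mkcond.
by apply: measurable_sum => j; case: (j != k).
Qed.

Let SE k w : S w = S' k w + eta k w.
Proof. by rewrite /S (bigD1 k)//= addrC. Qed.

Let intg_eta k : intg P (eta k).
Proof.
apply: intg_dom (intg_pow k (a := 1) _) => //; last by have := d0; rewrite ltr01/=; lra.
by move=> w; rewrite powRr1.
Qed.

Let intg_eta2 k : intg P (fun w => eta k w ^+ 2).
Proof.
apply: intg_dom (intg_pow k (a := 2) _).
- exact: measurable_funX.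
- by move=> w; rewrite normrX powR_mulrn.
- by have := d0; move=> ?; apply/andP; split; lra.
Qed.

Let mf : measurable_fun setT f.
Proof. by apply: continuous_measurable_fun; exact: continuous_stein_sol. Qed.

Let mg : measurable_fun setT g.
Proof. by apply: continuous_measurable_fun; exact: continuous_stein_dsol. Qed.

Let intg_g (U : T -> R) : measurable_fun setT U -> intg P (fun w => g (U w)).
Proof.
move=> mU; apply: (@intg_bounded _ _ _ P _ 4); first exact: measurableT_comp.
by move=> w; exact: norm_stein_dsol.
Qed.

Let intg_f (U : T -> R) : measurable_fun setT U -> intg P (fun w => f (U w)).
Proof.
move=> mU; apply: (@intg_bounded _ _ _ P _ 1); first exact: measurableT_comp.
by move=> w; exact: norm_stein_sol.
Qed.

Let intg_eta_f k (U : T -> R) : measurable_fun setT U -> intg P (fun w => eta k w * f (U w)).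
Proof.
move=> mU; apply: intg_dom (intg_abs (intg_eta k)).
  by apply: measurable_funM => //; exact: measurableT_comp.
by move=> w; rewrite normrM ler_piMr// norm_stein_sol.
Qed.

Let L := stein_lip : R.
Let L0 : 0 <= L.
Proof. by have := @stein_cst_ge4 R; rewrite /L /stein_lip; lra. Qed.

Let n0 : (2 + delta == 0) = false.
Proof. by apply/gt_eqF; have := d0; lra. Qed.

Let beta_ge0 k : 0 <= beta k.
Proof. by apply: mean_ge0 => w; exact: powR_ge0. Qed.

(** A product of expectations: the inequality
    a ^ 2 * b ^ delta <= a ^ (2 + delta) + b ^ (2 + delta) is integrated
    separately in a and in b. *)
Let mixed_moment k :
  E (fun w => eta k w ^+ 2) * E (fun w => `|eta k w| `^ delta) <= 2 * beta k.
Proof.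
have dd : 0 < delta <= 2 + delta by have := d0; move=> ?; apply/andP; split; lra.
have pt (a b : R) : a ^+ 2 * `|b| `^ delta <= `|a| `^ (2 + delta) + `|b| `^ (2 + delta).
  have -> : a ^+ 2 = `|a| `^ 2 by rewrite powR_mulrn// real_normK ?num_real.
  have [ab|ab] := leP `|a| `|b|.
    rewrite (le_trans (_ : _ <= `|b| `^ 2 * `|b| `^ delta))//.
      by rewrite ler_wpM2r ?powR_ge0// ge0_ler_powR ?nnegrE.
    by rewrite -powRD ?n0// lerDr powR_ge0.
  rewrite (le_trans (_ : _ <= `|a| `^ 2 * `|a| `^ delta))//.
    by rewrite ler_wpM2l ?powR_ge0// ge0_ler_powR ?nnegrE// ltW.
  by rewrite -powRD ?n0// lerDl powR_ge0.
rewrite -meanZ; last exact: intg_pow.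
rewrite (@le_trans _ _ (E (fun w => beta k + `|eta k w| `^ (2 + delta))))//.
  apply: mean_le; [by apply: intgZ; exact: intg_pow|by apply: intgD => //; exact: intg_cst|].
  move=> w; rewrite mulrC -meanZ// -[X in _ <= _ + X](@mean_cst _ _ _ P) -meanD//; last exact: intg_cst.
  apply: mean_le; [exact: intgZ|apply: intgD => //; exact: intg_cst|].
  by move=> w'; rewrite mulrC pt.
by rewrite meanD// ?mean_cst; [rewrite mulr_natl mulr2n|exact: intg_cst].
Qed.

(** Let f be the Stein solution, so that stein_rhs s (S) = f' (S) - S * f (S).
    As eta k is centred and independent of S' k = S - eta k, a Taylor expansion
    at S' k gives E (eta k * f (S)) = E (eta k ^ 2) * E (f' (S' k)) + r k. The
    variances add up to 1, so summing over k compares E (f' (S)) with averages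
    of the E (f' (S' k)). The Hoelder continuity of f' bounds both r k and the
    differences E (f' (S)) - E (f' (S' k)) by moments of order 2 + delta. *)
Lemma stein_clt : `|E (fun w => stein_rhs s (S w))| <= 3 * stein_lip * \sum_k beta k.
Proof.
have dd : 0 < delta <= 2 + delta by have := d0; move=> ?; apply/andP; split; lra.
have msq : measurable_fun setT (fun x : R => x ^+ 2) by exact: measurable_funX.
pose r k := E (fun w => eta k w * (f (S w) - f (S' k w) - eta k w * g (S' k w))).
have ig2 k : intg P (fun w => eta k w ^+ 2 * g (S' k w)).
  apply: (@intg_indep _ _ _ P (fun w => eta k w ^+ 2) (fun w => g (S' k w))) => //.
  - exact: (@indep_rv_comp _ _ _ P _ _ _ _ _ _ _ _ (eta k) (S' k) (fun x => x ^+ 2) g (eta_indep k) msq mg).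
  - exact: intg_g.
have ir k : intg P (fun w => eta k w * (f (S w) - f (S' k w) - eta k w * g (S' k w))).
  have -> : (fun w => eta k w * (f (S w) - f (S' k w) - eta k w * g (S' k w))) =
     (fun w => (eta k w * f (S w) - eta k w * f (S' k w)) - eta k w ^+ 2 * g (S' k w)).
    by apply/funext => w; ring.
  by apply: intgB => //; apply: intgB => //; exact: intg_eta_f.
have rE k : E (fun w => eta k w * f (S w)) = r k + E (fun w => eta k w ^+ 2) * E (fun w => g (S' k w)).
  have if' : intg P (fun w => eta k w * f (S' k w)) by exact: intg_eta_f.
  rewrite -mean_indep//; last 2 first.
  - exact: (@indep_rv_comp _ _ _ P _ _ _ _ _ _ _ _ (eta k) (S' k) (fun x => x ^+ 2) g (eta_indep k) msq mg).
  - exact: intg_g.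
  have z : E (fun w => eta k w * f (S' k w)) = 0.
    rewrite (@mean_indep _ _ _ P (eta k) (fun w => f (S' k w)))//.
    - by rewrite eta_mean mul0r.
    - exact: (@indep_rv_comp _ _ _ P _ _ _ _ _ _ _ _ (eta k) (S' k) idfun f (eta_indep k) (@measurable_id _ _ _) mf).
    - exact: intg_f.
  rewrite -[LHS]subr0 -z -meanB//; last exact: intg_eta_f.
  rewrite /r -meanD//.
  by congr (E _); apply/funext => w; ring.
have rL k : `|r k| <= L * beta k.
  rewrite -meanZ// (le_trans (mean_abs _))//.
  apply: mean_le; [exact: intg_abs|exact: intgZ|].
  move=> w; rewrite normrM (SE k).
  have := @stein_sol_taylor R s ms s_le1 delta (S' k w) (S' k w + eta k w) delta01.
  rewrite (addrC (S' k w)) addrK -/L => h.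
  apply: (le_trans (ler_wpM2l (normr_ge0 (eta k w)) h)).
  rewrite mulrCA ler_wpM2l// mulrA -expr2 -powR_mulrn// -powRD ?n0//.
have gL k : `|E (fun w => g (S w)) - E (fun w => g (S' k w))| <= L * E (fun w => `|eta k w| `^ delta).
  rewrite -meanB; try exact: intg_g.
  have ipd : intg P (fun w => `|eta k w| `^ delta) by exact: intg_pow.
  rewrite -meanZ// (le_trans (mean_abs _))//; first by apply: intgB; exact: intg_g.
  apply: mean_le; [by apply: intg_abs; apply: intgB; exact: intg_g|exact: intgZ|].
  move=> w; have := @stein_dsol_holder R s ms s_le1 delta (S' k w) (S w) delta01.
  have -> // : S w - S' k w = eta k w by rewrite (SE k) addrC addKr.
have -> : E (fun w => stein_rhs s (S w)) =
  \sum_k (E (fun w => eta k w ^+ 2) * (E (fun w => g (S w)) - E (fun w => g (S' k w))) - r k).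
  have -> : (fun w => stein_rhs s (S w)) = (fun w => g (S w) - \sum_k eta k w * f (S w)).
    by apply/funext => w; rewrite -mulr_suml /stein_dsol /S; ring.
  rewrite meanB; [|exact: intg_g|by apply: intg_sum => k; exact: intg_eta_f].
  rewrite mean_sum; last by move=> k; exact: intg_eta_f.
  rewrite -[in LHS](mul1r (E (fun w => g (S w)))) -eta_var mulr_suml -sumrB.
  by apply: eq_bigr => k _; rewrite rE mulrBr opprD addrA addrAC.
rewrite (le_trans (ler_norm_sum _ _ _))// mulr_sumr; apply: ler_sum => k _.
rewrite (le_trans (ler_normB _ _))//.
rewrite (_ : 3 * stein_lip * beta k = L * (2 * beta k) + L * beta k); last by rewrite /L; ring.
rewrite lerD// normrM ger0_norm; last by apply: mean_ge0 => w; exact: sqr_ge0.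
apply: (@le_trans _ _ (E (fun w => eta k w ^+ 2) * (L * E (fun w => `|eta k w| `^ delta)))).
  by rewrite ler_wpM2l//; apply: mean_ge0 => w; exact: sqr_ge0.
by rewrite mulrCA ler_wpM2l// mixed_moment.
Qed.

End stein_clt.

(** * The sequence of environments *)

Section environment.
Context {R : realType} d (T : measurableType d) (P : probability T R).
Variable xi : 'I_2 -> nat -> {RV P >-> R}.
Hypothesis xi_iid : iid_pairs xi.

(** The two coordinates of a generation may depend on each other; only the
    pairs are independent. *)
Definition env (n : nat) (w : T) : R * R := (xi 0 n w, xi 1 n w).

Lemma measurable_env n : measurable_fun setT (env n).
Proof. exact: measurable_fun_pair. Qed.

Lemma measurable_env_preimage n (B : set (R * R)) : measurable B ->
  measurable (env n @^-1` B).
Proof. by move=> mB; rewrite -[X in measurable X]setTI; exact: measurable_env. Qed.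

HB.instance Definition _ n :=
  @isMeasurableFun.Build _ _ _ _ (env n) (measurable_env n).

(** A pi-system generating the environments of all generations but [k], to
    which the product formula for the environments applies directly. *)
Definition env_cylinders (k : nat) : set (set T) :=
  [set A | exists (J : {fset nat}) (B : nat -> set (R * R)),
     [/\ k \notin J, forall n, measurable (B n) &
         A = \bigcap_(n in [set` J]) (env n @^-1` B n)]].

Lemma env_cylinders_setI k : setI_closed (env_cylinders k).
Proof.
move=> _ _ [J [B [kJ mB ->]]] [J' [B' [kJ' mB' ->]]].
exists (J `|` J')%fset, (fun n => (if n \in J then B n else setT) `&`
                        (if n \in J' then B' n else setT)); split.
- by rewrite in_fsetU negb_or kJ.
- by move=> n; apply: measurableI; case: ifP.
apply/seteqP; split=> w.
  move=> [h h'] n /=; rewrite in_fsetU => /orP nJ; split.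
    by case: ifPn => // nJ1; exact: h.
  by case: ifPn => // nJ1; exact: h'.
move=> h; split => n /= nJ.
  by have := h n; rewrite /= in_fsetU nJ/= => /(_ isT) [].
by have := h n; rewrite /= in_fsetU nJ/= orbT => /(_ isT) [].
Qed.

Lemma env_cylinders_measurable k : env_cylinders k `<=` measurable.
Proof.
move=> _ [J [B [_ mB ->]]]; apply: fin_bigcap_measurable.
  exact: finite_fset.
by move=> n _; exact: measurable_env_preimage.
Qed.

Definition env_events (k : nat) : set (set T) :=
  [set A | exists2 B : set (R * R), measurable B & A = env k @^-1` B].

Lemma env_events_measurable k : env_events k `<=` measurable.
Proof. by move=> _ [B mB ->]; exact: measurable_env_preimage. Qed.

Lemma indep_env k : indep_sets P (env_cylinders k) (env_events k).
Proof.
move=> _ _ [J [B [kJ mB ->]]] [C mC ->].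
pose D n := if n == k then C else B n.
have mD n : measurable (D n) by rewrite /D; case: ifP.
have DJ n : n \in J -> D n = B n.
  by rewrite /D; case: eqP => // -> kJ'; rewrite kJ' in kJ.
have [ii _] := xi_iid.
have := ii (k |` J)%fset D mD.
have -> : \bigcap_(n in [set` (k |` J)%fset]) (env n @^-1` D n) =
  \bigcap_(n in [set` J]) (env n @^-1` B n) `&` env k @^-1` C.
  apply/seteqP; split => w.
    move=> h; split.
      by move=> n /= nJ; have := h n; rewrite /= in_fsetU nJ orbT DJ//; apply.
    by have := h k; rewrite /= fset1U1 /D eqxx; apply.
  move=> [h1 h2] n /=; rewrite in_fset1U => /orP[/eqP ->|nJ].
    by rewrite /D eqxx.
  by rewrite DJ//; exact: h1.
move=> ->; rewrite big_fsetU1//= /D eqxx EFinM muleC.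
rewrite fineK; last by rewrite fin_num_measure//; exact: measurable_env_preimage.
congr (_ * _)%E; rewrite (ii J B mB); congr EFin.
rewrite big_seq [RHS]big_seq; apply: eq_bigr => n nJ.
by case: eqP => // nk; rewrite -nk nJ in kJ.
Qed.

Lemma indep_env_sigma k : indep_sets P <<s env_cylinders k>> (env_events k).
Proof.
apply: indep_sets_sigma; last exact: indep_env.
- exact: env_cylinders_setI.
- exact: env_cylinders_measurable.
- exact: env_events_measurable.
Qed.

Notation othersT k := (g_sigma_algebraType (env_cylinders k)).

Lemma measurable_env_others k j : j != k ->
  measurable_fun setT (env j : othersT k -> R * R).
Proof.
move=> jk _ Y mY; rewrite setTI; apply: sub_sigma_algebra.
exists [fset j]%fset, (fun=> Y); split => //.
  by rewrite in_fset1 eq_sym.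
apply/seteqP; split => w; first by move=> h n /=; rewrite in_fset1 => /eqP ->.
by move=> /(_ j); rewrite /= in_fset1 eqxx; apply.
Qed.

(** Here U is any function of the environments of the generations other
    than k. *)
Lemma indep_rv_env k d1 d2 (T1 : measurableType d1) (T2 : measurableType d2)
    (U : T -> T1) (h : R * R -> T2) :
  measurable_fun setT (U : othersT k -> T1) -> measurable_fun setT h ->
  indep_rv P (h \o env k) U.
Proof.
move=> mU mh A B mA mB; rewrite setIC muleC; apply: (@indep_env_sigma k).
  by have := mU measurableT _ mB; rewrite setTI.
exists (h @^-1` A) => //.
by rewrite -[X in measurable X]setTI; exact: mh.
Qed.

Lemma ge0_integral_env n (h : R * R -> \bar R) : measurable_fun setT h ->
  (forall z, 0 <= h z)%E ->
  (\int[P]_w h (env n w) = \int[P]_w h (env 0 w))%E.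
Proof.
move=> mh h0; have [_ iid] := xi_iid.
have := @ge0_integral_distribution _ _ _ _ _ P (env n) h mh h0.
have := @ge0_integral_distribution _ _ _ _ _ P (env 0) h mh h0.
rewrite /comp => <- <-.
by apply: eq_measure_integral => B mB _; exact: iid.
Qed.

Lemma integral_env n (h : R * R -> \bar R) : measurable_fun setT h ->
  (\int[P]_w h (env n w) = \int[P]_w h (env 0 w))%E.
Proof.
move=> mh; rewrite integralE [RHS]integralE.
have hp n0 : (\int[P]_x (fun x0 => h (env n0 x0))^\+ x = \int[P]_x h^\+ (env n0 x))%E.
  apply: eq_integral => w _. by rewrite !(funeposE,funenegE).
have hn n0 : (\int[P]_x (fun x0 => h (env n0 x0))^\- x = \int[P]_x h^\- (env n0 x))%E.
  apply: eq_integral => w _. by rewrite !(funeposE,funenegE).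
rewrite !hp !hn (@ge0_integral_env n h^\+%E) ?(@ge0_integral_env n h^\-%E)//.
- exact: measurable_funeneg.
- exact: measurable_funepos.
Qed.

Lemma intg_env n (h : R * R -> R) : measurable_fun setT h ->
  intg P (fun w => h (env 0 w)) -> intg P (fun w => h (env n w)).
Proof.
move=> mh /integrableP[m0 i0]; apply/integrableP; split.
  by apply/measurable_EFinP; exact: measurableT_comp (measurable_env n).
rewrite (@ge0_integral_env n (fun z => `|(h z)%:E|%E))//.
by apply: measurableT_comp => //; exact/measurable_EFinP.
Qed.

Lemma mean_env n (h : R * R -> R) : measurable_fun setT h ->
  mean P (fun w => h (env n w)) = mean P (fun w => h (env 0 w)).
Proof.
move=> mh; rewrite /mean /Rintegral (@integral_env n (EFin \o h))//.
exact/measurable_EFinP.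
Qed.

Lemma ae_env n (A : set (R * R)) : measurable A ->
  {ae P, forall w, A (env 0 w)} -> {ae P, forall w, A (env n w)}.
Proof.
move=> mA; have [_ iid] := xi_iid.
have m k : measurable (env k @^-1` (~` A)).
  by apply: measurable_env_preimage; exact: measurableC.
suff : P.-negligible (env 0 @^-1` (~` A)) -> P.-negligible (env n @^-1` (~` A)) by [].
move=> /(negligibleP P (m _)) h0; apply/(negligibleP P (m _)).
by rewrite -h0; apply: iid; exact: measurableC.
Qed.

End environment.

(** * Normal approximation of a difference of two averages *)

Lemma sum_lt_ord {R : pzRingType} (N n : nat) (x : R) : (n <= N)%N ->
  \sum_(k < N) ((k < n)%N%:R * x) = n%:R * x.
Proof.
move=> nN; rewrite -mulr_suml -natr_sum; congr (_%:R * _).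
transitivity (\sum_(k < n) 1)%N; last by rewrite sum1_card card_ord.
rewrite (big_ord_widen N (fun=> 1%N))// [RHS]big_mkcond/=.
by apply: eq_bigr => k _; case: (k < n)%N.
Qed.

Lemma powRV {R : realType} (x r : R) : 0 <= x -> x^-1 `^ r = (x `^ r)^-1.
Proof. by move=> x0; rewrite -powR_inv1// -powRrM mulN1r powRN. Qed.

Section env_clt.
Context {R : realType} d (T : measurableType d) (P : probability T R).
Variable xi : 'I_2 -> nat -> {RV P >-> R}.
Hypothesis xi_iid : iid_pairs xi.
Variables (delta : R) (delta01 : 0 < delta <= 1).
Variable h : 'I_2 -> R -> R.
Hypothesis mh : forall l, measurable_fun setT (h l).
Hypothesis h_moment : forall l, intg P (fun w => `|h l (xi l 0%N w)| `^ (2 + delta)).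
Hypothesis h_mean : forall l, mean P (fun w => h l (xi l 0%N w)) = 0.
Local Notation v l := (mean P (fun w => h l (xi l 0%N w) ^+ 2)).
Local Notation K l := (mean P (fun w => `|h l (xi l 0%N w)| `^ (2 + delta))).
Local Notation cv := (mean P (fun w => h 0 (xi 0 0%N w) * h 1 (xi 1 0%N w))).
Variables (m n : nat) (m0 : (0 < m)%N) (n0 : (0 < n)%N).
Variable V : R.
Hypothesis V0 : 0 < V.
Hypothesis VE : V ^+ 2 = n%:R^-1 * v 0 + m%:R^-1 * v 1
   - 2 * cv * ((minn m n)%:R / (m%:R * n%:R)).

(** Generation k contributes to the first average when k < n and to the second
    one when k < m. Grouping by generation makes the difference of the averages
    a sum of maxn m n independent variables, although the two populations are
    dependent. *)
Let N := maxn m n.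
Let a (k : nat) : R := (k < n)%N%:R / n%:R.
Let b (k : nat) : R := (k < m)%N%:R / m%:R.
Let H (k : nat) (z : R * R) : R := (a k * h 0 z.1 - b k * h 1 z.2) / V.
Let eta (k : 'I_N) (w : T) : R := H k (env xi k w).

Let mH k : measurable_fun setT (H k).
Proof.
apply: measurable_funM => //; apply: measurable_funB; apply: measurable_funM => //.
  exact: measurableT_comp (mh 0) measurable_fst.
exact: measurableT_comp (mh 1) measurable_snd.
Qed.

Let meta k : measurable_fun setT (eta k).
Proof. exact: measurableT_comp (mH k) (measurable_env xi k). Qed.

Let d0 : 0 < delta. Proof. by case/andP: delta01. Qed.
Let d1 : delta <= 1. Proof. by case/andP: delta01. Qed.

Let mxi0 l : measurable_fun setT (fun w => h l (xi l 0%N w)).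
Proof. by apply: measurableT_comp. Qed.

Let intg_h2 l : intg P (fun w => h l (xi l 0%N w) ^+ 2).
Proof. by apply: (intg_sqr_of_moment _ (mxi0 l) (h_moment l)); have := d0; lra. Qed.

Let intg_h l : intg P (fun w => h l (xi l 0%N w)).
Proof. exact: (intg_of_sqr (mxi0 l) (intg_h2 l)). Qed.

Let intg_h01 : intg P (fun w => h 0 (xi 0 0%N w) * h 1 (xi 1 0%N w)).
Proof.
apply: intg_dom (intgD (intg_h2 0) (intg_h2 1)); first exact: measurable_funM.
move=> w; set x := h 0 _; set y := h 1 _.
have := sqr_ge0 (x - y); have := sqr_ge0 (x + y).
by rewrite ler_norml; move=> ? ?; apply/andP; split; nra.
Qed.

Let env_moment (k : nat) (z : R * R) : `|H k z| `^ (2 + delta) <=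
  8 * (V `^ (2 + delta))^-1 * ((k < n)%N%:R * (n%:R `^ (2 + delta))^-1 * `|h 0 z.1| `^ (2 + delta)
    + (k < m)%N%:R * (m%:R `^ (2 + delta))^-1 * `|h 1 z.2| `^ (2 + delta)).
Proof.
have p0 : 0 < 2 + delta by have := d0; lra.
have pn0 : (2 + delta == 0) = false by exact: gt_eqF.
have abE (q k' : nat) (x : R) : (0 < q)%N -> `|(k' < q)%N%:R / q%:R * x| `^ (2 + delta) =
   (k' < q)%N%:R * (q%:R `^ (2 + delta))^-1 * `|x| `^ (2 + delta).
  move=> q0; rewrite normrM powRM//; congr (_ * _).
  rewrite normrM powRM// normfV (ger0_norm (ler0n R q)).
  rewrite powRV//; congr (_ * _).
  by case: (k' < q)%N; rewrite ?normr1 ?normr0 ?powR1// powR0// pn0.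
rewrite /H normrM powRM// normfV (gtr0_norm V0).
rewrite powRV ?(ltW V0)// [leLHS]mulrC -[leRHS]mulrA [leRHS]mulrCA.
rewrite ler_wpM2l ?invr_ge0 ?powR_ge0//.
by rewrite -!abE//; exact: powR_normB_le.
Qed.

Let nN : (n <= N)%N. Proof. exact: leq_maxr. Qed.
Let mN : (m <= N)%N. Proof. exact: leq_maxl. Qed.

Let eta_moment (k : 'I_N) : intg P (fun w => `|eta k w| `^ (2 + delta)).
Proof.
have mHp : measurable_fun setT (fun z => `|H k z| `^ (2 + delta)).
  exact: measurable_powR_norm (mH k).
apply: (@intg_env _ _ _ P xi xi_iid k (fun z => `|H k z| `^ (2 + delta))) => //.
have i0 := intgZ (8 * (V `^ (2 + delta))^-1)
  (intgD (intgZ ((k < n)%N%:R * (n%:R `^ (2 + delta))^-1) (h_moment 0))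
         (intgZ ((k < m)%N%:R * (m%:R `^ (2 + delta))^-1) (h_moment 1))).
apply: intg_dom i0; first exact: measurableT_comp mHp (measurable_env xi 0).
by move=> w; rewrite ger0_norm ?powR_ge0//; exact: env_moment.
Qed.

Let eta_mean (k : 'I_N) : mean P (eta k) = 0.
Proof.
rewrite (@mean_env _ _ _ P xi xi_iid k _ (mH k)).
transitivity (mean P (fun w => (a k / V) * h 0 (xi 0 0%N w) - (b k / V) * h 1 (xi 1 0%N w))).
  by congr (mean P _); apply/funext => w; rewrite /H/=; ring.
rewrite meanB; [|exact: intgZ|exact: intgZ].
by rewrite !meanZ// !h_mean !mulr0 subrr.
Qed.

Let eta_sqr (k : 'I_N) : mean P (fun w => eta k w ^+ 2) =
  (a k ^+ 2 * v 0 + b k ^+ 2 * v 1 - 2 * (a k * b k) * cv) / V ^+ 2.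
Proof.
have mH2 : measurable_fun setT (fun z => H k z ^+ 2) by exact: measurable_funX.
rewrite (@mean_env _ _ _ P xi xi_iid k _ mH2).
transitivity (mean P (fun w => (V ^- 2) * ((a k ^+ 2 * h 0 (xi 0 0%N w) ^+ 2 + b k ^+ 2 * h 1 (xi 1 0%N w) ^+ 2)
   - 2 * (a k * b k) * (h 0 (xi 0 0%N w) * h 1 (xi 1 0%N w))))).
  congr (mean P _); apply/funext => w; rewrite /H/=.
  by field; rewrite gt_eqF.
have i1 : intg P (fun w => a k ^+ 2 * h 0 (xi 0 0%N w) ^+ 2 + b k ^+ 2 * h 1 (xi 1 0%N w) ^+ 2).
  by apply: intgD; exact: intgZ.
rewrite meanZ; last by apply: intgB => //; exact: intgZ.
rewrite meanB//; last exact: intgZ.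
rewrite meanD; [|exact: intgZ|exact: intgZ].
by rewrite !meanZ// mulrC.
Qed.

Let eta_var : \sum_k mean P (fun w => eta k w ^+ 2) = 1.
Proof.
rewrite (eq_bigr _ (fun k _ => eta_sqr k)) -mulr_suml.
apply: (@mulIf _ (V ^+ 2)); first by rewrite gt_eqF// exprn_gt0.
rewrite mul1r divfK; last by rewrite gt_eqF// exprn_gt0.
have nz : n%:R != 0 :> R by rewrite pnatr_eq0 -lt0n.
have mz : m%:R != 0 :> R by rewrite pnatr_eq0 -lt0n.
rewrite VE sumrB big_split/=; congr (_ + _ - _).
- rewrite -mulr_suml; congr (_ * _).
  rewrite (eq_bigr (fun k : 'I_N => (k < n)%N%:R * (n%:R ^- 2))); last first.
    by move=> k _; rewrite /a; case: (k < n)%N; rewrite /= ?mul0r ?expr0n// !mul1r exprVn.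
  by rewrite sum_lt_ord//; field.
- rewrite -mulr_suml; congr (_ * _).
  rewrite (eq_bigr (fun k : 'I_N => (k < m)%N%:R * (m%:R ^- 2))); last first.
    by move=> k _; rewrite /b; case: (k < m)%N; rewrite /= ?mul0r ?expr0n// !mul1r exprVn.
  by rewrite sum_lt_ord//; field.
rewrite (eq_bigr (fun k : 'I_N => (k < minn m n)%N%:R * (2 * cv / (m%:R * n%:R)))); last first.
  move=> k _; rewrite /a /b leq_min; case: (k < m)%N; case: (k < n)%N; rewrite /= ?mul0r ?mulr0 ?mul0r// !mul1r.
  by field; rewrite nz.
rewrite sum_lt_ord; last by rewrite geq_min mN.
by field; rewrite nz.
Qed.

Let eta_indep (k : 'I_N) : indep_rv P (eta k) (fun w => \sum_(j | j != k) eta j w).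
Proof.
apply: (@indep_rv_env _ _ _ P xi xi_iid k _ _ R R (fun w => \sum_(j | j != k) eta j w) (H k)) => //.
rewrite (_ : (fun w => \sum_(j | j != k) eta j w) =
  (fun w => \sum_j (if j != k then eta j w else 0))); last first.
  by apply/funext => w; rewrite big_mkcond.
apply: measurable_sum => j; case: (boolP (j != k)) => jk; last exact: measurable_cst.
apply: measurableT_comp (mH j) _.
by apply: measurable_env_others; apply: contra jk => /eqP/val_inj ->.
Qed.

Let sum_eta w : \sum_k eta k w = (n%:R^-1 * (\sum_(k < n) h 0 (xi 0 k w))
      - m%:R^-1 * (\sum_(k < m) h 1 (xi 1 k w))) / V.
Proof.
rewrite /eta /H -mulr_suml sumrB; congr ((_ - _) / V); rewrite mulr_sumr.
  rewrite (big_ord_widen N (fun k => n%:R^-1 * h 0 (xi 0 k w)))// [RHS]big_mkcond/=.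
  by apply: eq_bigr => k _; rewrite /a; case: (k < n)%N; rewrite ?mul1r ?mul0r.
rewrite (big_ord_widen N (fun k => m%:R^-1 * h 1 (xi 1 k w)))// [RHS]big_mkcond/=.
by apply: eq_bigr => k _; rewrite /b; case: (k < m)%N; rewrite ?mul1r ?mul0r.
Qed.

(** By the form of V, the contributions of the generations have total variance
    1, so stein_clt applies. The moments of order 2 + delta of the first average
    add up to n `^ - (1 + delta) times a constant, and those of the second one to
    m `^ - (1 + delta) times a constant; the smaller index dominates. *)
Lemma env_clt (s : R -> R) : measurable_fun setT s -> (forall t, `|s t| <= 1) ->
  `|mean P (fun w => stein_rhs s ((n%:R^-1 * (\sum_(k < n) h 0 (xi 0 k w))
      - m%:R^-1 * (\sum_(k < m) h 1 (xi 1 k w))) / V))|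
  <= 3 * stein_lip * (8 * (V `^ (2 + delta))^-1 *
      ((K 0 + K 1) * ((minn m n)%:R `^ (1 + delta))^-1)).
Proof.
move=> ms s1.
have := @stein_clt R d T P s ms s1 delta delta01 N eta meta eta_moment eta_mean eta_var eta_indep.
under [X in mean P X]eq_fun do rewrite sum_eta.
move=> /le_trans; apply; rewrite ler_wpM2l//.
  by have := @stein_cst_ge4 R; rewrite /stein_lip; lra.
have K0 l : 0 <= K l by apply: mean_ge0 => w; exact: powR_ge0.
have rpow (q : nat) : (0 < q)%N -> (minn m n <= q)%N ->
    q%:R * (q%:R `^ (2 + delta))^-1 <= ((minn m n)%:R `^ (1 + delta))^-1 :> R.
  move=> q0 rq; have q0' : 0 < q%:R :> R by rewrite ltr0n.
  have -> : q%:R `^ (2 + delta) = q%:R * q%:R `^ (1 + delta).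
    rewrite -[X in _ = X * _]powRr1 ?ler0n// -powRD; first by congr (_ `^ _); ring.
    by rewrite gt_eqF//; have := d0; lra.
  rewrite invfM mulrA divff ?gt_eqF// mul1r lef_pV2 ?posrE ?powR_gt0//; last first.
    by rewrite ltr0n leq_min m0.
  by rewrite ge0_ler_powR ?nnegrE ?ler0n// ?ler_nat//; have := d0; lra.
apply: (@le_trans _ _ (\sum_(k < N) (8 * (V `^ (2 + delta))^-1 *
   ((k < n)%N%:R * ((n%:R `^ (2 + delta))^-1 * K 0) + (k < m)%N%:R * ((m%:R `^ (2 + delta))^-1 * K 1))))).
  apply: ler_sum => k _.
  have mHp : measurable_fun setT (fun z => `|H k z| `^ (2 + delta)).
    exact: measurable_powR_norm (mH k).
  rewrite (@mean_env _ _ _ P xi xi_iid k _ mHp).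
  have i1 := intgD (intgZ ((k < n)%N%:R * (n%:R `^ (2 + delta))^-1) (h_moment 0))
         (intgZ ((k < m)%N%:R * (m%:R `^ (2 + delta))^-1) (h_moment 1)).
  have i2 := intgZ (8 * (V `^ (2 + delta))^-1) i1.
  apply: (le_trans (mean_le _ i2 (fun w => env_moment k (env xi 0 w)))).
    apply: intg_dom i2; first exact: measurableT_comp mHp (measurable_env xi 0).
    by move=> w; rewrite ger0_norm ?powR_ge0//; exact: env_moment.
  rewrite meanZ// meanD; [|exact: intgZ|exact: intgZ].
  by rewrite !meanZ// !mulrA.
rewrite -mulr_sumr ler_wpM2l ?mulr_ge0 ?invr_ge0 ?powR_ge0//.
rewrite big_split/= (sum_lt_ord _ nN) (sum_lt_ord _ mN) mulrDl; apply: lerD.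
  by rewrite mulrA mulrC ler_wpM2l// rpow// geq_minr.
by rewrite mulrA mulrC ler_wpM2l// rpow// geq_minl.
Qed.
End env_clt.

(** * Integration over an event of known conditional probability *)

Section conditional_density.
Context {R : realType} d (T : measurableType d) (P : probability T R).
Context d' (S : measurableType d') (Z : T -> S) (mZ : measurable_fun setT Z).
Variables (C : set T) (mC : measurable C) (f : S -> R) (mf : measurable_fun setT f).
Hypothesis f0 : forall z, 0 <= f z.
Hypothesis Cf : forall B, measurable B ->
  P (Z @^-1` B `&` C) = (\int[P]_(w in Z @^-1` B) (f (Z w))%:E)%E.

Import HBNNSimple.

Let mpre B : measurable B -> measurable (Z @^-1` B).
Proof. by move=> mB; rewrite -[X in measurable X]setTI; exact: mZ. Qed.

Let integral_indic_cond (B : set S) : measurable B ->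
  (\int[P]_(w in C) (\1_B (Z w))%:E = \int[P]_w ((\1_B (Z w))%:E * (f (Z w))%:E))%E.
Proof.
move=> mB; transitivity (P (Z @^-1` B `&` C)).
  by rewrite -integral_indic//; exact: mpre.
rewrite Cf// integral_mkcond; apply: eq_integral => w _.
rewrite patchE indicE.
have -> : (Z w \in B) = (w \in Z @^-1` B) by apply/idP/idP; rewrite !in_setE.
by case: (w \in _); rewrite ?mul1e ?mul0e.
Qed.

Let integral_nnsfun_cond (g : {nnsfun S >-> R}) :
  (\int[P]_(w in C) (g (Z w))%:E = \int[P]_w ((g (Z w))%:E * (f (Z w))%:E))%E.
Proof.
have mgr r : measurable (g @^-1` [set r]).
  by rewrite -[X in measurable X]setTI; exact: measurable_funP.
have mi r D : measurable_fun D (fun w => (r * \1_(g @^-1` [set r]) (Z w))%:E).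
  apply/measurable_EFinP; apply: measurable_funTS; apply: measurable_funM => //.
  by apply: measurableT_comp mZ; exact: measurable_indic.
have i0 r w : (0 <= (r * \1_(g @^-1` [set r]) (Z w))%:E)%E.
  by rewrite EFinM nnfun_muleindic_ge0.
have mfZ : measurable_fun setT (fun w => (f (Z w))%:E).
  by apply/measurable_EFinP; exact: measurableT_comp.
under eq_integral do rewrite fimfunE -fsumEFin//.
rewrite ge0_integral_fsum//.
transitivity (\int[P]_w \sum_(r \in range g)
    ((r * \1_(g @^-1` [set r]) (Z w))%:E * (f (Z w))%:E))%E; last first.
  apply: eq_integral => w _; rewrite fimfunE -fsumEFin// ge0_mule_fsuml//.
rewrite ge0_integral_fsum//; last 2 first.
- by move=> r; apply: emeasurable_funM.
- by move=> r w _; rewrite mule_ge0// lee_fin.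
apply: eq_fsbigr => r; rewrite inE => -[z _ <-].
under eq_integral do rewrite EFinM.
have mI D : measurable_fun D (fun w => (\1_(g @^-1` [set g z]) (Z w))%:E : \bar R).
  apply/measurable_EFinP; apply: measurable_funTS.
  by apply: measurableT_comp mZ; exact: measurable_indic.
have gz0 : (0 <= (g z)%:E)%E by rewrite lee_fin.
rewrite ge0_integralZl//= integral_indic_cond// -ge0_integralZl//=.
- by apply: eq_integral => w _; rewrite EFinM muleA.
- exact: emeasurable_funM.
- by move=> w _; rewrite mule_ge0// lee_fin.
Qed.

(** The hypothesis on C and f says that f (Z) is the conditional probability of
    C given Z. The identity holds for indicators, hence for simple functions,
    hence in general by monotone convergence. *)
Lemma ge0_integral_cond (g : S -> \bar R) : measurable_fun setT g ->
  (forall z, 0 <= g z)%E ->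
  (\int[P]_(w in C) g (Z w) = \int[P]_w (g (Z w) * (f (Z w))%:E))%E.
Proof.
move=> mg g0.
pose g_ := nnsfun_approx measurableT mg.
have gE z : g z = limn (fun n => (g_ n z)%:E).
  by apply/esym/cvg_lim => //; exact: cvg_nnsfun_approx.
have mg_ n : measurable_fun setT (fun w => (g_ n (Z w))%:E).
  by apply/measurable_EFinP; exact: measurableT_comp.
have mfZ : measurable_fun setT (fun w => (f (Z w))%:E).
  by apply/measurable_EFinP; exact: measurableT_comp.
transitivity (limn (fun n => \int[P]_(w in C) (g_ n (Z w))%:E)%E).
  rewrite -monotone_convergence//.
  - by apply: eq_integral => w _; exact: gE.
  - by move=> n; exact: measurable_funTS.
  - by move=> n w _; rewrite lee_fin.
  - by move=> w _ a b ab; rewrite lee_fin; exact/lefP/nd_nnsfun_approx.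
under eq_fun do rewrite integral_nnsfun_cond.
rewrite -monotone_convergence//.
- apply: eq_integral => w _; rewrite gE; apply/cvg_lim => //.
  apply: cvgeZr => //; rewrite -gE; exact: cvg_nnsfun_approx.
- by move=> n; exact: emeasurable_funM.
- by move=> n w _; rewrite mule_ge0// lee_fin.
- move=> w _ a b ab; rewrite lee_wpmul2r ?lee_fin//; exact/lefP/nd_nnsfun_approx.
Qed.

End conditional_density.

(** * Past and present of a generation *)

Lemma ord2_eq01 (l : 'I_2) : l = 0 \/ l = 1.
Proof. by case: l => -[|[|//]] i; [left|right]; exact: val_inj. Qed.

Section offspring.
Context {R : realType} d (T : measurableType d) (P : probability T R).
Variables (p : R.-pker R ~> nat) (xi : 'I_2 -> nat -> {RV P >-> R}).
Variable X : 'I_2 -> nat -> nat -> {RV P >-> nat}.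
Hypothesis xi_iid : iid_pairs xi.
Hypothesis X_cond : cond_indep_offspring p xi X.

Notation individual := ('I_2 * nat * nat)%type.
Implicit Types (J : {fset individual}) (c : individual -> nat) (B : set (R * R)).

Definition offspring_cyl J c : set T :=
  \bigcap_(j in [set` J]) (X j.1.1 j.1.2 j.2 @^-1` [set c j]).

(** The boolean makes the class closed under intersection: two cylinders that
    prescribe different values for an individual have an empty intersection. *)
Definition past (k : nat) : set (set T) :=
  [set A | exists (b : bool) J c, (forall j, j \in J -> (j.1.2 < k)%N) /\
     A = (if b then setT else set0) `&` offspring_cyl J c].

Definition present (k : nat) : set (set T) :=
  [set A | exists B J c, [/\ measurable B, (forall j, j \in J -> j.1.2 = k) &
     A = env xi k @^-1` B `&` offspring_cyl J c]].

Lemma measurable_child_preimage l k i (A : set nat) : measurable (X l k i @^-1` A).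
Proof. by rewrite -[X in measurable X]setTI; exact: measurable_funP. Qed.

Lemma measurable_offspring_cyl J c : measurable (offspring_cyl J c).
Proof.
apply: fin_bigcap_measurable; first exact: finite_fset.
by move=> j _; exact: measurable_child_preimage.
Qed.

Lemma past_measurable k : past k `<=` measurable.
Proof.
move=> _ [b [J [c [_ ->]]]]; apply: measurableI; first by case: b.
exact: measurable_offspring_cyl.
Qed.

Lemma present_measurable k : present k `<=` measurable.
Proof.
move=> _ [B [J [c [mB _ ->]]]]; apply: measurableI; last exact: measurable_offspring_cyl.
exact: measurable_env_preimage.
Qed.

Lemma offspring_cyl_merge J J' c c' :
  (forall j, j \in J -> j \in J' -> c j = c' j) ->
  offspring_cyl J c `&` offspring_cyl J' c' =
  offspring_cyl (J `|` J')%fset (fun j => if j \in J then c j else c' j).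
Proof.
move=> h; apply/seteqP; split => w.
  move=> [h1 h2] j /=; rewrite in_fsetU.
  by case: (boolP (j \in J)) => /= [jJ _|jJ jJ']; [exact: h1|exact: h2].
move=> hw; split => j /= jJ.
  by have := hw j; rewrite /= in_fsetU jJ/= => /(_ isT).
have := hw j; rewrite /= in_fsetU jJ orbT => /(_ isT).
by case: ifP => // jJ' ->; exact: h.
Qed.

Lemma offspring_cylI J J' c c' : exists (b : bool) c'',
  offspring_cyl J c `&` offspring_cyl J' c' =
  (if b then setT else set0) `&` offspring_cyl (J `|` J')%fset c''.
Proof.
pose ok := forall j, j \in J -> j \in J' -> c j = c' j.
exists `[< ok >], (fun j => if j \in J then c j else c' j).
case: asboolP => [h|h]; first by rewrite setTI offspring_cyl_merge.
rewrite set0I; apply/seteqP; split => w //= -[h1 h2]; apply: h => j jJ jJ'.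
by rewrite -(h1 j jJ) -(h2 j jJ').
Qed.

Lemma past_setI k : setI_closed (past k).
Proof.
move=> _ _ [b [J [c [Jk ->]]]] [b' [J' [c' [Jk' ->]]]].
have [b'' [c'' E]] := offspring_cylI J J' c c'.
exists [&& b, b' & b''], (J `|` J')%fset, c''; split.
  by move=> j; rewrite in_fsetU => /orP[/Jk|/Jk'].
by rewrite setIACA E; case: b; case: b'; case: b'' {E}; rewrite /= ?setTI ?set0I ?setI0 ?set0I.
Qed.

Lemma present_setI k : setI_closed (present k).
Proof.
move=> _ _ [B [J [c [mB Jk ->]]]] [B' [J' [c' [mB' Jk' ->]]]].
have [b [c'' E]] := offspring_cylI J J' c c'.
exists (B `&` B' `&` (if b then setT else set0)), (J `|` J')%fset, c''; split.
- by apply: measurableI; [exact: measurableI|case: b {E}].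
- by move=> j; rewrite in_fsetU => /orP[/Jk|/Jk'].
rewrite setIACA E !preimage_setI !setIA; congr (_ `&` _).
by case: b {E}; rewrite ?preimage_setT ?preimage_set0.
Qed.

Definition offspring_pmf (x : R) (y : nat) : R := fine (p x [set y]).

Lemma offspring_law_le1 x (A : set nat) : (p x A <= 1)%E.
Proof. by rewrite -(@prob_kernel _ _ _ _ _ p x) le_measure ?inE. Qed.

Lemma offspring_pmf_fin x y : p x [set y] \is a fin_num.
Proof. by rewrite ge0_fin_numE// (le_lt_trans (offspring_law_le1 _ _))// ltry. Qed.

Lemma offspring_pmf_ge0 x y : 0 <= offspring_pmf x y.
Proof. exact: fine_ge0. Qed.

Lemma measurable_offspring_pmf y : measurable_fun setT (offspring_pmf ^~ y).
Proof.
apply: measurableT_comp => //.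
exact: (measurable_kernel p [set y]).
Qed.

Definition cyl_pmf J c (w : T) : R :=
  \prod_(j <- J) offspring_pmf (xi j.1.1 j.1.2 w) (c j).

Lemma cyl_pmf_ge0 J c w : 0 <= cyl_pmf J c w.
Proof. by apply: prodr_ge0 => j _; exact: offspring_pmf_ge0. Qed.

Lemma sigma_env_env k B : measurable B -> sigma_env xi (env xi k @^-1` B).
Proof.
move=> mB; pose G := [set A | exists l n (B : set R), measurable B /\ A = xi l n @^-1` B].
have mxi l : measurable_fun setT (xi l k : g_sigma_algebraType G -> R).
  move=> _ Y mY; rewrite setTI; apply: sub_sigma_algebra.
  by exists l, k, Y.
have mm : measurable_fun setT (env xi k : g_sigma_algebraType G -> R * R).
  by apply: measurable_fun_pair; exact: mxi.
by have := mm measurableT _ mB; rewrite setTI.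
Qed.

Lemma P_env_cyl k B J c : measurable B ->
  P (env xi k @^-1` B `&` offspring_cyl J c) =
  (\int[P]_(w in env xi k @^-1` B) (cyl_pmf J c w)%:E)%E.
Proof. by move=> mB; have [_] := X_cond J c; apply; exact: sigma_env_env. Qed.

Lemma P_cyl J c : P (offspring_cyl J c) = (\int[P]_w (cyl_pmf J c w)%:E)%E.
Proof. by have := P_env_cyl 0 J c measurableT; rewrite preimage_setT setTI. Qed.

Lemma measurable_cyl_pmf J c : measurable_fun setT (cyl_pmf J c).
Proof.
rewrite /cyl_pmf; apply: measurable_prod => j _.
by apply: (measurableT_comp (measurable_offspring_pmf _)).
Qed.

(** Given all environments, the numbers of children are independent, and the
    law of each depends on the environment of its own generation only.
    Integrating, an event of the past contributes a function of environments
    before k and an event of the present a function of the environment of k;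
    these are independent. *)
Lemma indep_past_present k : indep_sets P (past k) (present k).
Proof.
move=> _ _ [b [J [c [Jk ->]]]] [B [J' [c' [mB Jk' ->]]]].
case: b; last by rewrite !set0I measure0 mul0e.
rewrite setTI setICA.
have JJ' : [disjoint J & J']%fset.
  apply/fdisjointP => j /Jk jk; apply/negP => /Jk' e.
  by rewrite e ltnn in jk.
pose c'' j := if j \in J then c j else c' j.
have -> : offspring_cyl J c `&` offspring_cyl J' c' = offspring_cyl (J `|` J')%fset c''.
  by apply: offspring_cyl_merge => j jJ; move/fdisjointP: JJ' => /(_ _ jJ) /negP.
rewrite P_env_cyl// P_cyl P_env_cyl//.
have splitE w : cyl_pmf (J `|` J')%fset c'' w = cyl_pmf J c w * cyl_pmf J' c' w.
  rewrite /cyl_pmf (perm_big (enum_fset J ++ enum_fset J')); last first.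
    apply: uniq_perm; first exact: fset_uniq.
      rewrite cat_uniq !fset_uniq andbT/=; apply/hasPn => j jJ'.
      by move/fdisjointP: JJ' => JJ'; apply/negP => /JJ'; rewrite jJ'.
    by move=> j; rewrite mem_cat in_fsetU.
  rewrite big_cat/=; congr (_ * _); apply: eq_big_seq => j jJ; rewrite /c''.
    by rewrite (jJ : j \in J).
  case: ifP => // jJ1; move/fdisjointP: JJ' => /(_ _ jJ1).
  by rewrite (jJ : j \in J').
pose h (z : R * R) : R :=
  \1_B z * \prod_(j <- J') offspring_pmf (if j.1.1 == 0 then z.1 else z.2) (c' j).
have hE w : h (env xi k w) = \1_(env xi k @^-1` B) w * cyl_pmf J' c' w.
  rewrite /h /cyl_pmf; congr (_ * _).
  apply: eq_big_seq => j jJ; rewrite (Jk' j jJ) /env/=.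
  by have [->|->] := ord2_eq01 j.1.1.
have mh : measurable_fun setT h.
  apply: measurable_funM; first exact: measurable_indic.
  apply: measurable_prod => j _; apply: (measurableT_comp (measurable_offspring_pmf _)).
  rewrite (_ : (fun z : R * R => _) = if j.1.1 == 0 then fst else snd); last first.
    by apply/funext => z; case: ifP.
  by case: ifP => _; [exact: measurable_fst|exact: measurable_snd].
have ind : indep_rv P (h \o env xi k) (cyl_pmf J c).
  apply: (@indep_rv_env _ _ _ P xi xi_iid k _ _ _ _ (cyl_pmf J c) h) => //.
  apply: measurable_prod => j jJ; apply: (measurableT_comp (measurable_offspring_pmf _)).
  have jk : j.1.2 != k by rewrite ltn_eqF// Jk.
  have me := @measurable_env_others _ _ _ P xi k _ jk.
  have [->|->] := ord2_eq01 j.1.1; first exact: (measurableT_comp measurable_fst me).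
  exact: (measurableT_comp measurable_snd me).
have h0 w : 0 <= (h \o env xi k) w.
  by rewrite /= hE mulr_ge0// cyl_pmf_ge0.
have mhe : measurable_fun setT (h \o env xi k).
  exact: measurableT_comp mh (measurable_env xi k).
have E1 : (\int[P]_(w in env xi k @^-1` B) (cyl_pmf J' c' w)%:E =
    \int[P]_w ((h \o env xi k) w)%:E)%E.
  rewrite integral_mkcond; apply: eq_integral => w _.
  by rewrite /= hE patchE indicE; case: (w \in _); rewrite ?mul1r ?mul0r.
rewrite E1 muleC -(ge0_integral_prod_indep mhe (measurable_cyl_pmf J c) ind h0 (cyl_pmf_ge0 J c)).
rewrite integral_mkcond; apply: eq_integral => w _.
rewrite /= hE patchE indicE; case: (w \in _); rewrite ?mul1r ?mul0r//.
by rewrite splitE mulrC.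
Qed.
End offspring.

Lemma measurable_sum_nat d (S : measurableType d) (Y : nat -> S -> nat) (n : nat) :
  (forall i, measurable_fun setT (Y i)) ->
  measurable_fun setT (fun w => \sum_(i < n) Y i w)%N.
Proof.
move=> mY; elim: n => [|n ih].
  by under eq_fun do rewrite big_ord0; exact: measurable_cst.
by under eq_fun do rewrite big_ord_recr/=; exact: measurable_fun_addn.
Qed.

Lemma measurable_nat_index d1 d2 (S : measurableType d1) (S' : measurableType d2)
    (N : S -> nat) (Y : nat -> S -> S') :
  measurable_fun setT N -> (forall n, measurable_fun setT (Y n)) ->
  measurable_fun setT (fun w => Y (N w) w).
Proof.
move=> mN mY _ A mA; rewrite setTI.
have -> : (fun w => Y (N w) w) @^-1` A =
    \bigcup_n (N @^-1` [set n] `&` Y n @^-1` A).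
  apply/seteqP; split => w /=; first by move=> ?; exists (N w).
  by move=> [n _ [/= <-]].
apply: bigcup_measurable => n _; apply: measurableI.
  by rewrite -[X in measurable X]setTI; exact: mN.
by rewrite -[X in measurable X]setTI; exact: mY.
Qed.

Lemma measurable_random_sum d (S : measurableType d) (N : S -> nat) (Y : nat -> S -> nat) :
  measurable_fun setT N -> (forall i, measurable_fun setT (Y i)) ->
  measurable_fun setT (fun w => \sum_(i < N w) Y i w)%N.
Proof.
move=> mN mY.
apply: (@measurable_nat_index _ _ _ _ N (fun n w => \sum_(i < n) Y i w)%N) => // n.
exact: measurable_sum_nat.
Qed.

Lemma measurable_nat_valued d (S : measurableType d) (Y : S -> nat) :
  (forall n, measurable (Y @^-1` [set n])) -> measurable_fun setT Y.
Proof.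
move=> mY _ A _; rewrite setTI.
have -> : Y @^-1` A = \bigcup_(n in A) Y @^-1` [set n].
  by apply/seteqP; split => w /=; [move=> ?; exists (Y w)|move=> [n An ->]].
by apply: bigcup_measurable.
Qed.

Lemma indep_sets_sym {R : realType} d (T : measurableType d) (P : probability T R)
  (G H : set (set T)) : indep_sets P G H -> indep_sets P H G.
Proof. by move=> GH A B HA GB; rewrite setIC muleC; exact: GH. Qed.

Section generations.
Context {R : realType} d (T : measurableType d) (P : probability T R).
Variables (p : R.-pker R ~> nat) (xi : 'I_2 -> nat -> {RV P >-> R}).
Variable X : 'I_2 -> nat -> nat -> {RV P >-> nat}.
Hypothesis xi_iid : iid_pairs xi.
Hypothesis X_cond : cond_indep_offspring p xi X.

Notation pastT k := (g_sigma_algebraType (past X k)).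
Notation presT k := (g_sigma_algebraType (present xi X k)).

Lemma measurable_child_past k l j i : (j < k)%N ->
  measurable_fun setT (X l j i : pastT k -> nat).
Proof.
move=> jk; apply: measurable_nat_valued => n; apply: sub_sigma_algebra.
exists true, [fset (l, j, i)]%fset, (fun=> n); split.
  by move=> j'; rewrite in_fset1 => /eqP ->.
rewrite setTI; apply/seteqP; split => w.
  by move=> h j'; rewrite /= in_fset1 => /eqP ->.
by move=> /(_ (l, j, i)); apply; rewrite /= in_fset1.
Qed.

Lemma measurable_branching_past k l j : (j <= k)%N ->
  measurable_fun setT (branching (X l) j : pastT k -> nat).
Proof.
elim: j => [|j ih] jk; first exact: measurable_cst.
apply: measurable_random_sum; first by apply: ih; exact: ltnW.
by move=> i; exact: measurable_child_past.
Qed.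

Lemma measurable_branching l j : measurable_fun setT (branching (X l) j : T -> nat).
Proof.
elim: j => [|j ih]; first exact: measurable_cst.
exact: measurable_random_sum.
Qed.

Lemma measurable_child_present k l i :
  measurable_fun setT (X l k i : presT k -> nat).
Proof.
apply: measurable_nat_valued => n; apply: sub_sigma_algebra.
exists setT, [fset (l, k, i)]%fset, (fun=> n); split => //.
  by move=> j'; rewrite in_fset1 => /eqP ->.
rewrite preimage_setT setTI; apply/seteqP; split => w.
  by move=> h j'; rewrite /= in_fset1 => /eqP ->.
by move=> /(_ (l, k, i)); apply; rewrite /= in_fset1.
Qed.

Lemma measurable_env_present k : measurable_fun setT (env xi k : presT k -> R * R).
Proof.
move=> _ B mB; rewrite setTI; apply: sub_sigma_algebra.
exists B, fset0, (fun=> 0%N); split => //.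
by apply/seteqP; split => w //= [].
Qed.

Lemma measurable_xi_present k l : measurable_fun setT (xi l k : presT k -> R).
Proof.
by have [->|->] := ord2_eq01 l;
  [have := measurableT_comp measurable_fst (@measurable_env_present k)
  |have := measurableT_comp measurable_snd (@measurable_env_present k)].
Qed.

(** A population size N of generation k depends on the past, the children and
    the environment of generation k on the present; independence allows N to be
    frozen while the present is integrated. All the conditional estimates on the
    process go through this identity. *)
Lemma integral_past_present k (N : T -> nat) (Y : nat -> T -> \bar R) :
  measurable_fun setT (N : pastT k -> nat) ->
  (forall z, measurable_fun setT (Y z : presT k -> \bar R)) ->
  (forall z w, 0 <= Y z w)%E ->
  (\int[P]_w Y (N w) w = \int[P]_w \int[P]_w' Y (N w) w')%E.
Proof.
move=> mN mY Y0.
have pastM : <<s past X k>> `<=` measurable.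
  by apply: smallest_sub; [exact: sigma_algebra_measurable|exact: past_measurable].
have presM : <<s present xi X k>> `<=` measurable.
  by apply: smallest_sub; [exact: sigma_algebra_measurable|exact: present_measurable].
have mNT : measurable_fun setT N.
  by move=> _ A mA; rewrite setTI; apply: pastM; have := mN measurableT _ mA; rewrite setTI.
have mid : measurable_fun setT (idfun : T -> presT k).
  by move=> _ A mA; rewrite setTI; exact: presM.
apply: (@ge0_integral_indep _ _ _ P _ _ _ (presT k) N idfun mNT mid _ (fun z => Y z.1 z.2)).
- move=> A B mA mB; rewrite preimage_id.
  have ind1 : indep_sets P <<s past X k>> (present xi X k).
    apply: indep_sets_sigma.
    + exact: past_setI.
    + exact: past_measurable.
    + exact: present_measurable.
    + exact: (indep_past_present xi_iid X_cond).
  have ind2 : indep_sets P <<s present xi X k>> <<s past X k>>.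
    apply: indep_sets_sigma.
    + exact: present_setI.
    + exact: present_measurable.
    + exact: pastM.
    + exact: indep_sets_sym.
  apply: (indep_sets_sym ind2) => //.
  by have := mN measurableT _ mA; rewrite setTI.
- apply: (@measurable_nat_index _ _ _ _ (fun z : nat * presT k => z.1) (fun n z => Y n z.2)).
    exact: measurable_fst.
  by move=> n; exact: (measurableT_comp (mY n) measurable_snd).
- by move=> z.
Qed.

End generations.

(** * Laws of the numbers of children *)

Section child_moments.
Context {R : realType} d (T : measurableType d) (P : probability T R).
Variables (p : R.-pker R ~> nat) (xi : 'I_2 -> nat -> {RV P >-> R}).
Variable X : 'I_2 -> nat -> nat -> {RV P >-> nat}.
Hypothesis xi_iid : iid_pairs xi.
Hypothesis X_cond : cond_indep_offspring p xi X.
Variable l : 'I_2.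
Implicit Types (g : R -> nat -> \bar R).

Let sel (z : R * R) : R := if l == 0 then z.1 else z.2.

Let sel_env k w : sel (env xi k w) = xi l k w.
Proof. by rewrite /sel; have [->|->] := ord2_eq01 l. Qed.

Let measurable_sel : measurable_fun setT sel.
Proof.
rewrite (_ : sel = if l == 0 then fst else snd); last first.
  by apply/funext => z; rewrite /sel; case: ifP.
by case: ifP => _; [exact: measurable_fst|exact: measurable_snd].
Qed.

Let pm := offspring_pmf p.

Let mchild k i (c : nat) : measurable (X l k i @^-1` [set c]).
Proof. exact: measurable_child_preimage. Qed.

Let mpm c : measurable_fun setT (pm ^~ c).
Proof. exact: measurable_offspring_pmf. Qed.

Let mpm_sel c : measurable_fun setT (fun z => pm (sel z) c).
Proof. exact: (measurableT_comp (mpm c)). Qed.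

Let cond1 k i c (B : set (R * R)) : measurable B ->
  P (env xi k @^-1` B `&` X l k i @^-1` [set c]) =
  (\int[P]_(w in env xi k @^-1` B) (pm (sel (env xi k w)) c)%:E)%E.
Proof.
move=> mB; have := P_env_cyl X_cond k [fset (l, k, i)]%fset (fun=> c) mB.
have -> : offspring_cyl X [fset (l, k, i)]%fset (fun=> c) = X l k i @^-1` [set c].
  apply/seteqP; split => w; last by move=> h j'; rewrite /= in_fset1 => /eqP ->.
  by move=> /(_ (l, k, i)); apply; rewrite /= in_fset1.
move=> ->; apply: eq_integral => w _.
by rewrite /cyl_pmf big_seq_fset1 sel_env.
Qed.

Let cond2 k i j c c' (B : set (R * R)) : i != j -> measurable B ->
  P (env xi k @^-1` B `&` (X l k j @^-1` [set c] `&` X l k i @^-1` [set c'])) =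
  (\int[P]_(w in env xi k @^-1` B) (pm (sel (env xi k w)) c' * pm (sel (env xi k w)) c)%:E)%E.
Proof.
move=> ij mB.
pose cc (a : 'I_2 * nat * nat) := if a.2 == i then c' else c.
have := P_env_cyl X_cond k ((l, k, i) |` [fset (l, k, j)])%fset cc mB.
have -> : offspring_cyl X ((l, k, i) |` [fset (l, k, j)])%fset cc =
    X l k j @^-1` [set c] `&` X l k i @^-1` [set c'].
  apply/seteqP; split => w.
    move=> h; split.
      have := h (l, k, j); rewrite /= in_fset1U in_fset1 eqxx orbT => /(_ isT).
      by rewrite /cc/= eq_sym (negbTE ij).
    have := h (l, k, i); rewrite /= in_fset1U eqxx => /(_ isT).
    by rewrite /cc/= eqxx.
  move=> [h1 h2] a; rewrite /= in_fset1U in_fset1 => /orP[/eqP ->|/eqP ->].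
    by rewrite /cc/= eqxx.
  by rewrite /cc/= eq_sym (negbTE ij).
move=> ->; apply: eq_integral => w _.
rewrite /cyl_pmf big_fsetU1/=; last first.
  by rewrite in_fset1; apply: contra ij => /eqP[->].
by rewrite big_seq_fset1 /cc/= eqxx eq_sym (negbTE ij) sel_env.
Qed.

Let measurable_g_child g k i : (forall c, measurable_fun setT (g ^~ c)) ->
  measurable_fun setT (fun w => g (xi l k w) (X l k i w)).
Proof.
move=> mg; apply: (@measurable_nat_index _ _ _ _ (X l k i) (fun c w => g (xi l k w) c)) => // c.
exact: (measurableT_comp (mg c)).
Qed.

Lemma integral_split_child (C : set T) g k i : measurable C ->
  (forall c, measurable_fun setT (g ^~ c)) -> (forall r c, 0 <= g r c)%E ->
  (\int[P]_(w in C) g (xi l k w) (X l k i w) =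
   \sum_(0 <= c <oo) \int[P]_(w in C `&` X l k i @^-1` [set c]) g (xi l k w) c)%E.
Proof.
move=> mC mg g0.
have CE : C = \bigcup_c (C `&` X l k i @^-1` [set c]).
  rewrite -setI_bigcupr; apply/seteqP; split => w; last by case.
  by move=> Cw; split => //; exists (X l k i w).
rewrite [in LHS]CE ge0_integral_bigcup//.
- apply: eq_eseriesr => c _; apply: eq_integral => w; rewrite inE => -[_ /= <-//].
- by move=> c; exact: measurableI.
- by apply: measurable_funTS; exact: measurable_g_child.
- apply/trivIsetP => a b _ _ ab; apply/seteqP; split => // w /= [[_ ea] [_ eb]].
  by rewrite -ea -eb eqxx in ab.
Qed.

(** On the event X l k i = c the integrand depends on the environment only, and
    the conditional probability of this event is known. *)
Lemma integral_child g k i :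
  (forall c, measurable_fun setT (g ^~ c)) -> (forall r c, 0 <= g r c)%E ->
  (\int[P]_w g (xi l k w) (X l k i w) =
   \sum_(0 <= c <oo) \int[P]_w (g (xi l k w) c * (pm (xi l k w) c)%:E))%E.
Proof.
move=> mg g0; rewrite integral_split_child//; apply: eq_eseriesr => c _.
rewrite setTI; have mgs : measurable_fun setT (fun z => g (sel z) c).
  exact: (measurableT_comp (mg c)).
have := @ge0_integral_cond _ _ _ P _ _ (env xi k) (measurable_env xi k) _ (mchild k i c)
  (fun z => pm (sel z) c) (mpm_sel c) (fun z => offspring_pmf_ge0 p (sel z) c) (cond1 k i c)
  (fun z => g (sel z) c) mgs (fun z => g0 (sel z) c).
under eq_integral do rewrite sel_env.
by move=> ->; apply: eq_integral => w _; rewrite sel_env.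
Qed.

(** The same for two siblings, whose numbers of children are conditionally
    independent. *)
Lemma integral_child_given g k i j c : i != j ->
  (forall c, measurable_fun setT (g ^~ c)) -> (forall r c, 0 <= g r c)%E ->
  (\int[P]_(w in X l k j @^-1` [set c]) g (xi l k w) (X l k i w) =
   \sum_(0 <= c' <oo) \int[P]_w (g (xi l k w) c' * (pm (xi l k w) c' * pm (xi l k w) c)%:E))%E.
Proof.
move=> ij mg g0; rewrite integral_split_child//; apply: eq_eseriesr => c' _.
have mgs : measurable_fun setT (fun z => g (sel z) c').
  exact: (measurableT_comp (mg c')).
have mpp : measurable_fun setT (fun z => pm (sel z) c' * pm (sel z) c).
  by apply: measurable_funM.
have := @ge0_integral_cond _ _ _ P _ _ (env xi k) (measurable_env xi k) _
  (measurableI _ _ (mchild k j c) (mchild k i c'))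
  (fun z => pm (sel z) c' * pm (sel z) c) mpp
  (fun z => mulr_ge0 (offspring_pmf_ge0 p (sel z) c') (offspring_pmf_ge0 p (sel z) c))
  (fun B => @cond2 k i j c c' B ij) (fun z => g (sel z) c') mgs (fun z => g0 (sel z) c').
under eq_integral do rewrite sel_env.
by move=> ->; apply: eq_integral => w _; rewrite sel_env.
Qed.

(** By integral_child, only the law of the environment matters, and it is the
    same in all generations. *)
Lemma integral_child_stationary g k i :
  (forall c, measurable_fun setT (g ^~ c)) -> (forall r c, 0 <= g r c)%E ->
  (\int[P]_w g (xi l k w) (X l k i w) = \int[P]_w g (xi l 0 w) (X l 0 0 w))%E.
Proof.
move=> mg g0; rewrite (@integral_child g k i mg g0) (@integral_child g 0%N 0%N mg g0).
apply: eq_eseriesr => c _.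
have mh : measurable_fun setT (fun z => g (sel z) c * (pm (sel z) c)%:E)%E.
  apply: emeasurable_funM; first exact: (measurableT_comp (mg c)).
  by apply/measurable_EFinP.
have h0 z : (0 <= g (sel z) c * (pm (sel z) c)%:E)%E.
  by rewrite mule_ge0// lee_fin offspring_pmf_ge0.
have := @ge0_integral_env _ _ _ P xi xi_iid k _ mh h0.
under eq_integral do rewrite sel_env.
by move=> ->; apply: eq_integral => w _; rewrite sel_env.
Qed.

End child_moments.

(** * Numbers of children divided by their conditional mean *)

Section normalized_children.
Context {R : realType}.
Variable p : R.-pker R ~> nat.
Implicit Types x : R.
Notation pm := (offspring_pmf p).

Lemma offspring_pmfE x c : (pm x c)%:E = p x [set c].
Proof. by rewrite /offspring_pmf fineK// offspring_pmf_fin. Qed.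

Lemma measurable_offspring_mean : measurable_fun setT (offspring_mean p).
Proof.
apply: ge0_emeasurable_sum => // c _; apply: emeasurable_funM => //.
exact: (measurable_kernel p [set c]).
Qed.

Lemma offspring_mean_ge0 x : (0 <= offspring_mean p x)%E.
Proof. by apply: nneseries_ge0 => c _ _; rewrite mule_ge0. Qed.

Lemma sum_offspring_pmf x : (\sum_(0 <= c <oo) (pm x c)%:E = 1)%E.
Proof.
rewrite -(@prob_kernel _ _ _ _ _ p x).
have -> : [set: nat] = \bigcup_c [set c] by apply/seteqP; split => // c _; exists c.
rewrite measure_semi_bigcup//; last first.
  by apply/trivIsetP => a b _ _ ab; apply/seteqP; split => // c /= [-> e]; rewrite e eqxx in ab.
by apply: eq_eseriesr => c _; rewrite offspring_pmfE.
Qed.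

(** Almost every environment is such: a law without atom at 0 has mean at
    least 1. *)
Definition good x : bool :=
  (offspring_mean p x < +oo)%E && (1 <= offspring_mean p x)%E.

Lemma measurable_good : measurable_fun setT good.
Proof.
apply: measurable_and.
  by apply: measurable_fun_lte => //; exact: measurable_offspring_mean.
by apply: measurable_fun_lee => //; exact: measurable_offspring_mean.
Qed.

Lemma offspring_mean_ge1 x : p x [set 0%N] = 0%E -> (1 <= offspring_mean p x)%E.
Proof.
move=> p0; rewrite -(sum_offspring_pmf x); apply: lee_nneseries => c _.
  by move=> _; rewrite lee_fin offspring_pmf_ge0.
rewrite offspring_pmfE; case: c => [|c]; first by rewrite p0 mule0.
by rewrite -[leLHS]mul1e lee_wpmul2r// lee_fin ler1n.
Qed.

(** The value 1 in bad environments makes the conditional mean equal to 1 in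
    every environment, which spares almost-everywhere arguments in moment
    computations. *)
Definition ratio x (c : nat) : R :=
  if good x then c%:R / fine (offspring_mean p x) else 1.

Lemma good_mean x : good x ->
  1 <= fine (offspring_mean p x) /\ offspring_mean p x = (fine (offspring_mean p x))%:E.
Proof.
move=> /andP[lty ge1]; have f : offspring_mean p x \is a fin_num.
  by rewrite ge0_fin_numE// offspring_mean_ge0.
by rewrite -lee_fin fineK.
Qed.

Lemma ratio_ge0 x c : 0 <= ratio x c.
Proof.
rewrite /ratio; case: ifP => // /good_mean[m1 _].
by rewrite divr_ge0// (le_trans _ m1).
Qed.

Lemma measurable_ratio c : measurable_fun setT (ratio ^~ c).
Proof.
apply: measurable_fun_ifT => //; first exact: measurable_good.
rewrite (_ : (fun x => _) = fun x => c%:R * (fine (offspring_mean p x)) `^ (-1)); last first.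
  by apply/funext => x; rewrite powR_inv1// fine_ge0// offspring_mean_ge0.
apply: measurable_funM => //; apply: (@measurableT_comp _ _ _ _ _ _ (@powR R ^~ (-1))) => //.
by apply: measurableT_comp => //; exact: measurable_offspring_mean.
Qed.

Lemma sum_ratio x : (\sum_(0 <= c <oo) ((ratio x c)%:E * (pm x c)%:E) = 1)%E.
Proof.
have [gx|/negbTE gx] := boolP (good x); last first.
  rewrite -[RHS](sum_offspring_pmf x); apply: eq_eseriesr => c _.
  by rewrite /ratio gx mul1e.
have [m1 mE] := good_mean gx.
set m := fine _ in m1 mE *.
transitivity ((m^-1)%:E * offspring_mean p x)%E; last first.
  by rewrite mE -EFinM mulVf// gt_eqF// (lt_le_trans _ m1).
rewrite -nneseriesZl//; apply: eq_eseriesr => c _.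
by rewrite /ratio gx offspring_pmfE muleA -EFinM mulrC.
Qed.

End normalized_children.

Section normalized_children_moments.
Context {R : realType} d (T : measurableType d) (P : probability T R).
Variables (p : R.-pker R ~> nat) (xi : 'I_2 -> nat -> {RV P >-> R}).
Variable X : 'I_2 -> nat -> nat -> {RV P >-> nat}.
Hypothesis xi_iid : iid_pairs xi.
Hypothesis X_cond : cond_indep_offspring p xi X.
Variable l : 'I_2.
Notation pm := (offspring_pmf p).
Notation rat k i := (fun w => ratio p (xi l k w) (X l k i w)).

Let mpmxi k c : measurable_fun setT (fun w => (pm (xi l k w) c)%:E).
Proof. by apply/measurable_EFinP; apply: (measurableT_comp (measurable_offspring_pmf p c)). Qed.

Let mratxi k c : measurable_fun setT (fun w => (ratio p (xi l k w) c)%:E).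
Proof. by apply/measurable_EFinP; apply: (measurableT_comp (measurable_ratio p c)). Qed.

Let mrat c : measurable_fun setT (fun x => (ratio p x c)%:E).
Proof. by apply/measurable_EFinP; exact: measurable_ratio. Qed.

Lemma integral_ratio k i : (\int[P]_w (rat k i w)%:E = 1)%E.
Proof.
rewrite (@integral_child _ _ _ P p xi X X_cond l (fun x c => (ratio p x c)%:E))//; last first.
  by move=> r c; rewrite lee_fin ratio_ge0.
rewrite -integral_nneseries//.
- under eq_integral do rewrite sum_ratio.
  by rewrite integral_cst// mul1e; exact: probability_setT.
- by move=> c; exact: emeasurable_funM.
- by move=> c w _; rewrite mule_ge0// lee_fin ?ratio_ge0 ?offspring_pmf_ge0.
Qed.

(** Two siblings are conditionally independent with conditional mean 1; hence
    normalized numbers of children are uncorrelated. *)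
Lemma integral_ratio_prod k i j : i != j ->
  (\int[P]_w (rat k i w * rat k j w)%:E = 1)%E.
Proof.
move=> ij; rewrite -(integral_ratio k j).
rewrite (@integral_child _ _ _ P p xi X X_cond l (fun x c => (ratio p x c)%:E))//; last first.
  by move=> r c; rewrite lee_fin ratio_ge0.
transitivity (\sum_(0 <= c <oo) \int[P]_(w in X l k j @^-1` [set c])
    (ratio p (xi l k w) (X l k i w) * ratio p (xi l k w) c)%:E)%E.
  have mr k' i' : measurable_fun setT (rat k' i').
    apply: (@measurable_nat_index _ _ _ _ (X l k' i') (fun c w => ratio p (xi l k' w) c)) => // c.
    by apply: (measurableT_comp (measurable_ratio p c)).
  have TE : [set: T] = \bigcup_c (X l k j @^-1` [set c]).
    by apply/seteqP; split => w // _; exists (X l k j w).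
  rewrite [in LHS]TE ge0_integral_bigcup//.
  - by apply: eq_eseriesr => c _; apply: eq_integral => w; rewrite inE => /= <-.
  - by move=> c; exact: measurable_child_preimage.
  - by apply: measurable_funTS; apply/measurable_EFinP; exact: measurable_funM.
  - by move=> w _; rewrite lee_fin mulr_ge0// ratio_ge0.
  - apply/trivIsetP => a b _ _ ab; apply/seteqP; split => // w /= [ea eb].
    by rewrite -ea -eb eqxx in ab.
apply: eq_eseriesr => c _.
rewrite (@integral_child_given _ _ _ P p xi X X_cond l
  (fun x c' => (ratio p x c' * ratio p x c)%:E) k i j c)//; last 2 first.
- move=> c'; apply/measurable_EFinP; apply: measurable_funM; exact: measurable_ratio.
- by move=> r c'; rewrite lee_fin mulr_ge0// ratio_ge0.
rewrite -integral_nneseries//.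
- apply: eq_integral => w _.
  rewrite -[RHS]mule1 -(sum_ratio p (xi l k w)) -EFinM -nneseriesZl//.
    by apply: eq_eseriesr => c' _; rewrite -!EFinM; congr EFin; ring.
  by move=> c' _; rewrite mule_ge0// lee_fin ?ratio_ge0 ?offspring_pmf_ge0.
- move=> c'; apply: emeasurable_funM; apply/measurable_EFinP; apply: measurable_funM.
  + by apply: (measurableT_comp (measurable_ratio p c')).
  + by apply: (measurableT_comp (measurable_ratio p c)).
  + by apply: (measurableT_comp (measurable_offspring_pmf p c')).
  + by apply: (measurableT_comp (measurable_offspring_pmf p c)).
- by move=> c' w _; rewrite mule_ge0// lee_fin mulr_ge0 ?ratio_ge0 ?offspring_pmf_ge0.
Qed.

End normalized_children_moments.

(** * The logarithm of an average *)

Lemma le_ln_sub1 {R : realType} (x : R) : 0 < x -> ln x <= x - 1.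
Proof.
move=> x0; have := @expR_ge1Dx R (ln x); rewrite lnK ?posrE//; lra.
Qed.

(** Here A' will be an average of mean 1, and A a truncated one, close to 1. As
    ln A' <= A' - 1, the absolute value of ln A' is at most A' - 1 plus twice the
    negative part of ln A', and the mean of A' - 1 vanishes: hence the 1 on the
    left. The negative part is at most - ln A. For A >= 1 / 2 this is of order
    1 - A <= b * (1 - A) ^ 2 + 1 / b; for A < 1 / 2 it is at most M, hence at
    most 4 * b * (1 - A) ^ 2 or M ^ 2 / b according as M <= b or not. *)
Lemma norm_ln_average {R : realType} (A A' M b : R) :
  0 < b -> 0 <= M -> expR (- M) <= A -> A <= A' ->
  `|ln A'| + 1 <= A' + 2 * ((2 + 5 * b) * (1 - A) ^+ 2 + (1 + M ^+ 2) / b).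
Proof.
move=> b0 M0 AM AA'.
have A0 : 0 < A by exact: lt_le_trans (expR_gt0 _) AM.
have A'0 : 0 < A' by exact: lt_le_trans AA'.
set Q := (2 + 5 * b) * (1 - A) ^+ 2 + (1 + M ^+ 2) / b.
have Q0 : 0 <= Q.
  apply: addr_ge0; first by apply: mulr_ge0; [lra|exact: sqr_ge0].
  by apply: divr_ge0; [have := sqr_ge0 M; lra|exact: ltW].
have h1 := le_ln_sub1 A'0.
have [lnA'0|lnA'0] := leP 0 (ln A'); first by rewrite ger0_norm//; lra.
rewrite ltr0_norm//.
suff : - ln A' <= Q by lra.
have lnAA' : ln A <= ln A' by rewrite ler_ln ?posrE.
have A1 : A < 1 by rewrite -ltr_ln ?posrE// ln1 (le_lt_trans lnAA').
rewrite (@le_trans _ _ (- ln A))//; first by lra.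
have ib0 : 0 < b^-1 by rewrite invr_gt0.
have bb : b * b^-1 = 1 by rewrite divff// gt_eqF.
have e1 : 1 - A <= b * (1 - A) ^+ 2 + b^-1.
  have : 0 <= b^-1 * (b * (1 - A) - 1) ^+ 2 by rewrite mulr_ge0 ?sqr_ge0// ltW.
  have -> : b^-1 * (b * (1 - A) - 1) ^+ 2 =
      (b * b^-1) * (b * (1 - A) ^+ 2) - 2 * (b * b^-1) * (1 - A) + b^-1 by ring.
  rewrite bb; nra.
have e2 : 0 <= M ^+ 2 / b by rewrite divr_ge0 ?sqr_ge0// ltW.
have e3 : 0 <= b * (1 - A) ^+ 2 by rewrite mulr_ge0 ?sqr_ge0// ltW.
have -> : Q = 2 * (1 - A) ^+ 2 + 5 * (b * (1 - A) ^+ 2) + b^-1 + M ^+ 2 / b by rewrite /Q; ring.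
have [Ah|Ah] := leP (2^-1) A.
  have iA0 : 0 < A^-1 by rewrite invr_gt0.
  have e4 : - ln A <= A^-1 - 1 by rewrite -lnV ?posrE// le_ln_sub1.
  have e5 : A^-1 - 1 <= (1 - A) + 2 * (1 - A) ^+ 2.
    have AA : A * A^-1 = 1 by rewrite divff// gt_eqF.
    have iA2 : A^-1 <= 2 by nra.
    have -> : A^-1 - 1 = (1 - A) + A^-1 * (1 - A) ^+ 2 by field; rewrite gt_eqF.
    by rewrite lerD2l ler_wpM2r ?sqr_ge0.
  lra.
have e6 : - ln A <= M by rewrite lerNl -ler_expR lnK ?posrE.
have e7 : 1 <= 4 * (1 - A) ^+ 2 by nra.
have s0 : 0 <= (1 - A) ^+ 2 by exact: sqr_ge0.
have [Mb|Mb] := leP M b.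
  have : b <= 4 * (b * (1 - A) ^+ 2) by nra.
  lra.
have : M <= M ^+ 2 / b by rewrite ler_pdivlMr// expr2 ler_wpM2l// ltW.
lra.
Qed.

(** Where the truncation acts, y > K, the left-hand side is negative because
    y `^ q * K `^ (1 - q) >= y. *)
Lemma truncation_lower {R : realType} (y K q : R) : 0 <= y -> 0 < K -> 1 < q ->
  y - y `^ q * K `^ (1 - q) <= Num.min y K.
Proof.
move=> y0 K0 q1.
have [yK|Ky] := leP y K.
  by rewrite gerBl mulr_ge0 ?powR_ge0.
rewrite (@le_trans _ _ 0) ?(ltW K0)// subr_le0.
have -> : K `^ (1 - q) = (K `^ (q - 1))^-1 by rewrite -powRN opprB.
rewrite ler_pdivlMr ?powR_gt0//.
have -> : y `^ q = y * y `^ (q - 1).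
  rewrite -[X in X * _]powRr1// -powRD; first by congr (_ `^ _); ring.
  by apply/implyP => _; rewrite gt_eqF// (lt_trans K0).
by rewrite ler_wpM2l// ge0_ler_powR ?nnegrE ?(ltW K0)// ?(ltW Ky)//; lra.
Qed.

Section good_event.
Context {R : realType} d (T : measurableType d) (P : probability T R).
Variables (p : R.-pker R ~> nat) (xi : 'I_2 -> nat -> {RV P >-> R}).
Variable X : 'I_2 -> nat -> nat -> {RV P >-> nat}.
Hypothesis xi_iid : iid_pairs xi.
Hypothesis X_cond : cond_indep_offspring p xi X.
Variable l : 'I_2.
Hypothesis mean_fin : {ae P, forall w, (offspring_mean p (xi l 0%N w) < +oo)%E}.
Hypothesis p0 : {ae P, forall w, p (xi l 0%N w) [set 0%N] = 0%E}.

Definition good_event (w : T) :=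
  (forall k, good p (xi l k w)) /\ (forall k i, (0 < X l k i w)%N).

Let ae_xi k (A : set R) : measurable A ->
  {ae P, forall w, A (xi l 0%N w)} -> {ae P, forall w, A (xi l k w)}.
Proof.
move=> mA h; have [l0|l1] := ord2_eq01 l.
  have := @ae_env _ _ _ P xi xi_iid k (fst @^-1` A); rewrite l0 in h *; apply => //.
  by rewrite -[X in measurable X]setTI; exact: measurable_fst.
have := @ae_env _ _ _ P xi xi_iid k (snd @^-1` A); rewrite l1 in h *; apply => //.
by rewrite -[X in measurable X]setTI; exact: measurable_snd.
Qed.

(** There are countably many individuals, and each of them is childless with
    probability the mean of the masses at 0, which is zero. *)
Lemma ae_good_event : {ae P, forall w, good_event w}.
Proof.
have aeg : {ae P, forall w, forall k, good p (xi l k w)}.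
  apply: ae_foralln => k; apply: (ae_xi k (A := [set x | good p x])).
    have mt : measurable [set true] by [].
    by have := @measurable_good R p measurableT _ mt; rewrite setTI.
  apply: filterS2 mean_fin p0 => w h1 h2 /=.
  by rewrite /good h1 offspring_mean_ge1.
have aeX : {ae P, forall w, forall k i, (0 < X l k i w)%N}.
  apply: ae_foralln => k; apply: ae_foralln => i.
  have a0 : {ae P, forall w, p (xi l k w) [set 0%N] = 0%E}.
    apply: (ae_xi k (A := [set x | p x [set 0%N] = 0%E])) => //.
    have m0 : measurable [set (0 : \bar R)%E] by [].
    have mk : measurable_fun setT (fun x => p x [set 0%N]) by exact: measurable_kernel.
    by have := mk measurableT _ m0; rewrite setTI.
  have E : offspring_cyl X [fset (l, k, i)]%fset (fun=> 0%N) = ~` [set w | (0 < X l k i w)%N].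
    apply/seteqP; split => w.
      by move=> /(_ (l, k, i)); rewrite /= in_fset1 eqxx => /(_ isT) ->.
    move=> /= /negP; rewrite -leqNgt leqn0 => /eqP h j'.
    by rewrite /= in_fset1 => /eqP ->.
  suff : P.-negligible (offspring_cyl X [fset (l, k, i)]%fset (fun=> 0%N)) by rewrite E.
  apply/(negligibleP P (measurable_offspring_cyl _ _ _)).
  apply: (etrans (P_cyl X_cond _ _)); rewrite -[RHS](integral0 P setT).
  apply: ae_eq_integral => //.
    by apply/measurable_EFinP; exact: measurable_cyl_pmf.
  apply: filterS a0 => w w0 _.
  by rewrite /cyl_pmf big_seq_fset1 /offspring_pmf/= w0.
by apply: filterS2 aeg aeX => w h1 h2.
Qed.

End good_event.

(** * Mean logarithm of an average of normalized numbers of children *)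

Section increments.
Context {R : realType} d (T : measurableType d) (P : probability T R).
Variables (p : R.-pker R ~> nat) (xi : 'I_2 -> nat -> {RV P >-> R}).
Variable X : 'I_2 -> nat -> nat -> {RV P >-> nat}.
Hypothesis xi_iid : iid_pairs xi.
Hypothesis X_cond : cond_indep_offspring p xi X.
Variable l : 'I_2.

Lemma intg_xi k (h : R -> R) : measurable_fun setT h ->
  intg P (fun w => h (xi l 0%N w)) -> intg P (fun w => h (xi l k w)).
Proof.
move=> mh; have [->|->] := ord2_eq01 l.
  exact: (@intg_env _ _ _ P xi xi_iid k (h \o fst) (measurableT_comp mh measurable_fst)).
exact: (@intg_env _ _ _ P xi xi_iid k (h \o snd) (measurableT_comp mh measurable_snd)).
Qed.

Lemma mean_xi k (h : R -> R) : measurable_fun setT h ->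
  mean P (fun w => h (xi l k w)) = mean P (fun w => h (xi l 0%N w)).
Proof.
move=> mh; have [->|->] := ord2_eq01 l.
  exact: (@mean_env _ _ _ P xi xi_iid k (h \o fst) (measurableT_comp mh measurable_fst)).
exact: (@mean_env _ _ _ P xi xi_iid k (h \o snd) (measurableT_comp mh measurable_snd)).
Qed.

Hypothesis mean_fin : {ae P, forall w, (offspring_mean p (xi l 0%N w) < +oo)%E}.
Hypothesis p0 : {ae P, forall w, p (xi l 0%N w) [set 0%N] = 0%E}.

Definition lmean (x : R) : R := ln (fine (offspring_mean p x)).

Lemma measurable_lmean : measurable_fun setT lmean.
Proof.
apply: measurableT_comp => //; apply: measurableT_comp => //.
exact: measurable_offspring_mean.
Qed.

Hypothesis M2 : intg P (fun w => lmean (xi l 0%N w) ^+ 2).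
Variables (q : R) (q1 : 1 < q).

Definition rat k i w : R := ratio p (xi l k w) (X l k i w).

Hypothesis ratq : intg P (fun w => rat 0 0 w `^ q).

Lemma rat_ge0 k i w : 0 <= rat k i w.
Proof. exact: ratio_ge0. Qed.

Lemma measurable_rat k i : measurable_fun setT (rat k i).
Proof.
apply: (@measurable_nat_index _ _ _ _ (X l k i) (fun c w => ratio p (xi l k w) c)) => // c.
by apply: (measurableT_comp (measurable_ratio p c)).
Qed.

Lemma intg_ge0 (f : T -> R) (r : R) : measurable_fun setT f -> (forall w, 0 <= f w) ->
  (\int[P]_w (f w)%:E = r%:E)%E -> intg P f /\ mean P f = r.
Proof.
move=> mf f0 fr; split; last by rewrite /mean /Rintegral fr.
apply/integrableP; split; first exact/measurable_EFinP.
by under eq_integral do rewrite /= ger0_norm//; rewrite fr ltry.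
Qed.

Lemma intg_rat k i : intg P (rat k i).
Proof.
have [] // := @intg_ge0 (rat k i) 1 (measurable_rat k i) (rat_ge0 k i).
exact: (integral_ratio X_cond).
Qed.

Lemma mean_rat k i : mean P (rat k i) = 1.
Proof.
have [] // := @intg_ge0 (rat k i) 1 (measurable_rat k i) (rat_ge0 k i).
exact: (integral_ratio X_cond).
Qed.

Lemma rat_prod k i j : i != j ->
  intg P (fun w => rat k i w * rat k j w) /\ mean P (fun w => rat k i w * rat k j w) = 1.
Proof.
move=> ij; apply: intg_ge0.
- by apply: measurable_funM; exact: measurable_rat.
- by move=> w; rewrite mulr_ge0// rat_ge0.
- exact: (integral_ratio_prod X_cond).
Qed.

Let v := mean P (fun w => rat 0 0 w `^ q).

Let v0 : 0 <= v. Proof. by apply: mean_ge0 => w; exact: powR_ge0. Qed.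

Lemma rat_powR k i : intg P (fun w => rat k i w `^ q) /\ mean P (fun w => rat k i w `^ q) = v.
Proof.
apply: intg_ge0.
- apply: (@measurableT_comp _ _ _ _ _ _ (@powR R ^~ q)) => //.
  exact: measurable_rat.
- by move=> w; exact: powR_ge0.
rewrite (@integral_child_stationary _ _ _ P p xi X xi_iid X_cond l
  (fun r c => (ratio p r c `^ q)%:E) k i).
- by rewrite /v /mean /Rintegral fineK//; exact: (integrable_fin_num measurableT ratq).
- move=> c; apply/measurable_EFinP.
  by apply: (@measurableT_comp _ _ _ _ _ _ (@powR R ^~ q)) => //; exact: measurable_ratio.
- by move=> r c; rewrite lee_fin powR_ge0.
Qed.

Section truncation.
Variables (k z : nat) (K b : R).
Hypotheses (z0 : (0 < z)%N) (K1 : 1 <= K) (b0 : 0 < b).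

Let K0 : 0 < K. Proof. exact: lt_le_trans K1. Qed.
Let t i w : R := Num.min (rat k i w) K.
Let A' w : R := z%:R^-1 * \sum_(i < z) rat k i w.
Let A w : R := z%:R^-1 * \sum_(i < z) t i w.
Let beta := v * K `^ (1 - q).

Let t_ge0 i w : 0 <= t i w.
Proof. by rewrite le_min rat_ge0 ltW. Qed.

Let t_leK i w : t i w <= K.
Proof. by rewrite ge_min lexx orbT. Qed.

Let t_le i w : t i w <= rat k i w.
Proof. by rewrite ge_min lexx. Qed.

Let mt i : measurable_fun setT (t i).
Proof. by apply: measurable_minr => //; exact: measurable_rat. Qed.

Let intg_t i : intg P (t i).
Proof.
apply: intg_dom (intg_rat k i) => // w.
by rewrite ger0_norm.
Qed.

Let intg_tt i j : intg P (fun w => t i w * t j w).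
Proof.
apply: (@intg_bounded _ _ _ P _ (K * K)); first exact: measurable_funM.
by move=> w; rewrite ger0_norm ?mulr_ge0// ler_pM.
Qed.

Let zn0 : z%:R != 0 :> R. Proof. by rewrite pnatr_eq0 -lt0n. Qed.
Let zn1 : 0 < z%:R :> R. Proof. by rewrite ltr0n. Qed.

Let mean_t i : 1 - beta <= mean P (t i).
Proof.
have [iq eq] := rat_powR k i.
have ir := intg_rat k i.
have iz := intgZ (K `^ (1 - q)) iq.
have e : mean P (fun w => rat k i w - K `^ (1 - q) * rat k i w `^ q) = 1 - beta.
  by rewrite (meanB ir iz) (meanZ _ iq) mean_rat eq [X in _ - X]mulrC.
rewrite -[leLHS]e; apply: mean_le; [exact: intgB|exact: intg_t|].
by move=> w; rewrite [X in _ - X]mulrC truncation_lower ?rat_ge0.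
Qed.

Let mean_tt (i j : 'I_z) : mean P (fun w => t i w * t j w) <= 1 + (i == j)%:R * K.
Proof.
have [<-|ij] := eqVneq i j.
  rewrite mul1r; apply: (@le_trans _ _ (K * 1)); last by rewrite mulr1 lerDr.
  have e : mean P (fun w => K * rat k i w) = K * 1.
    by rewrite meanZ ?mean_rat//; exact: intg_rat.
  rewrite -[leRHS]e; apply: mean_le => //; first by apply: intgZ; exact: intg_rat.
  by move=> w; rewrite ler_pM.
have ij' : (i : nat) != j by [].
rewrite mul0r addr0; have [ip <-] := rat_prod k ij'.
by apply: mean_le => // w; rewrite ler_pM.
Qed.

Let intg_A : intg P A.
Proof. by apply: intgZ; apply: intg_sum => i; exact: intg_t. Qed.

Let A2E w : A w ^+ 2 = z%:R ^- 2 * \sum_(i < z) \sum_(j < z) t i w * t j w.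
Proof. by rewrite /A exprMn exprVn; congr (_ * _); rewrite expr2 big_distrlr. Qed.

Let intg_A2 : intg P (fun w => A w ^+ 2).
Proof.
rewrite (_ : (fun w => A w ^+ 2) =
  (fun w => z%:R ^- 2 * \sum_(i < z) \sum_(j < z) t i w * t j w)); last first.
  by apply/funext => w; rewrite A2E.
by apply: intgZ; apply: intg_sum => i; apply: intg_sum => j; exact: intg_tt.
Qed.

Let mean_A : 1 - beta <= mean P A.
Proof.
rewrite meanZ; last by apply: intg_sum => i; exact: intg_t.
rewrite mean_sum; last by move=> i; exact: intg_t.
rewrite ler_pdivlMl// (le_trans _ (ler_sum _ (fun (i : 'I_z) _ => mean_t i)))//.
by rewrite sumr_const card_ord mulr_natl.
Qed.

Let mean_A2 : mean P (fun w => A w ^+ 2) <= 1 + K / z%:R.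
Proof.
rewrite (_ : (fun w => A w ^+ 2) =
  (fun w => z%:R ^- 2 * \sum_(i < z) \sum_(j < z) t i w * t j w)); last first.
  by apply/funext => w; rewrite A2E.
have is_ (i : 'I_z) : intg P (fun w => \sum_(j < z) t i w * t j w).
  by apply: intg_sum => j; exact: intg_tt.
rewrite meanZ; last exact: intg_sum.
rewrite mean_sum// ler_pdivrMl ?exprn_gt0//.
apply: (@le_trans _ _ (\sum_(i < z) (z%:R + K))).
  apply: ler_sum => i _; rewrite mean_sum; last by move=> j; exact: intg_tt.
  apply: (le_trans (ler_sum _ (fun (j : 'I_z) _ => mean_tt i j))).
  rewrite big_split/= sumr_const card_ord lerD2l.
  rewrite (bigD1 i)//= eqxx mul1r big1 ?addr0// => j.
  by rewrite eq_sym => /negbTE ->; rewrite mul0r.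
rewrite sumr_const card_ord -mulr_natl le_eqVlt; apply/orP; left; apply/eqP.
by field.
Qed.

Let M w := lmean (xi l k w).
Let EM2 := mean P (fun w => lmean (xi l 0%N w) ^+ 2).

Let mM2 : measurable_fun setT (fun x => lmean x ^+ 2).
Proof. by apply: measurable_funX; exact: measurable_lmean. Qed.

Let intg_M2 : intg P (fun w => M w ^+ 2).
Proof. exact: (intg_xi k mM2). Qed.

Let mean_M2 : mean P (fun w => M w ^+ 2) = EM2.
Proof. exact: (mean_xi k mM2). Qed.

Let Q w : R := (2 + 5 * b) * (1 - A w) ^+ 2 + (1 + M w ^+ 2) / b.

Let sqE : (fun w => (1 - A w) ^+ 2) = (fun w => (1 - 2 * A w) + A w ^+ 2).
Proof. by apply/funext => w; ring. Qed.

Let intg_1B : intg P (fun w => 1 - 2 * A w).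
Proof. exact: (intgB (intg_cst P 1) (intgZ 2 intg_A)). Qed.

Let intg_1A2 : intg P (fun w => (1 - A w) ^+ 2).
Proof. rewrite sqE; exact: (intgD intg_1B intg_A2). Qed.

Let mean_1A2 : mean P (fun w => (1 - A w) ^+ 2) <= 2 * beta + K / z%:R.
Proof.
rewrite sqE (meanD intg_1B intg_A2) (meanB (intg_cst P 1) (intgZ 2 intg_A)) mean_cst (meanZ 2 intg_A).
have := mean_A; have := mean_A2; lra.
Qed.

Let intg_1M : intg P (fun w => 1 + M w ^+ 2).
Proof. exact: (intgD (intg_cst P 1) intg_M2). Qed.

Let divME : (fun w => (1 + M w ^+ 2) / b) = (fun w => b^-1 * (1 + M w ^+ 2)).
Proof. by apply/funext => w; rewrite mulrC. Qed.

Let intg_Mb : intg P (fun w => (1 + M w ^+ 2) / b).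
Proof. rewrite divME; exact: (intgZ b^-1 intg_1M). Qed.

Let intg_Q : intg P Q.
Proof. exact: (intgD (intgZ (2 + 5 * b) intg_1A2) intg_Mb). Qed.

Let mean_Q : mean P Q <= (2 + 5 * b) * (2 * beta + K / z%:R) + (1 + EM2) / b.
Proof.
rewrite (meanD (intgZ (2 + 5 * b) intg_1A2) intg_Mb) (meanZ _ intg_1A2).
rewrite divME (meanZ _ intg_1M) (meanD (intg_cst P 1) intg_M2).
rewrite mean_cst mean_M2 [b^-1 * _]mulrC lerD2r; apply: ler_wpM2l mean_1A2.
by have := b0; lra.
Qed.

(** The truncated average A has mean at least 1 - v * K `^ (1 - q) and second
    moment at most 1 + K / z, the normalized numbers of children being
    uncorrelated; so A is close to 1 in mean square. Everybody having at least
    one child, A >= expR (- M), which keeps the logarithm under control where A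
    is small. This is combined with the pointwise bound norm_ln_average; the
    parameters K and b are left free, see increment_decay. *)
Lemma integral_ln_average :
  (\int[P]_w `|ln (z%:R^-1 * \sum_(i < z) rat k i w)|%:E <=
   (2 * ((2 + 5 * b) * (2 * (v * K `^ (1 - q)) + K / z%:R) + (1 + EM2) / b))%:E)%E.
Proof.
have mA' : measurable_fun setT A'.
  have msr : measurable_fun setT (fun w => \sum_(i < z) rat k i w).
    by apply: measurable_sum => i; exact: measurable_rat.
  have mc : measurable_fun setT (fun _ : T => z%:R^-1 : R) by exact: measurable_cst.
  exact: (measurable_funM mc msr).
have isr : intg P (fun w => \sum_(i < z) rat k i w).
  by apply: intg_sum => i; exact: intg_rat.
have iA' : intg P A' by exact: (intgZ z%:R^-1 isr).
have eA' : mean P A' = 1.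
  rewrite (meanZ _ isr) mean_sum; last by move=> i; exact: intg_rat.
  rewrite (eq_bigr (fun=> 1)); last by move=> i _; exact: mean_rat.
  by rewrite sumr_const card_ord -[1 *+ z]/(z%:R) mulVf.
have mL : measurable_fun setT (fun w => `|ln (A' w)|).
  have mn : measurable_fun setT (@Num.norm R R) by [].
  exact: (measurableT_comp mn (measurableT_comp (@measurable_ln R) mA')).
have i2Q := intgZ 2 intg_Q.
have iR : intg P (fun w => A' w + 2 * Q w) by exact: (intgD iA' i2Q).
have aeL : {ae P, forall w, setT w -> ((`|ln (A' w)| + 1)%:E <= (A' w + 2 * Q w)%:E)%E}.
  apply: filterS (ae_good_event xi_iid X_cond mean_fin p0) => w [gw Xw] _.
  have [m1 mE] := good_mean (gw k); set m := fine _ in m1 mE.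
  have m0 : 0 < m by exact: lt_le_trans m1.
  have M0 : 0 <= M w by rewrite /M /lmean ln_ge0.
  have AA' : A w <= A' w.
    rewrite /A /A'; apply: ler_wpM2l; first by rewrite invr_ge0 ler0n.
    by apply: ler_sum => i _; exact: t_le.
  have MA : expR (- M w) <= A w.
    have -> : expR (- M w) = m^-1 by rewrite expRN /M /lmean lnK ?posrE.
    rewrite /A ler_pdivlMl; last exact: zn1.
    apply: (@le_trans _ _ (\sum_(i < z) m^-1)).
      by rewrite sumr_const card_ord mulr_natl.
    apply: ler_sum => i _; rewrite /t le_min; apply/andP; split.
      rewrite /rat /ratio gw -/m -[leLHS]mul1r; apply: ler_wpM2r.
        by rewrite invr_ge0; exact: ltW.
      by rewrite ler1n; exact: Xw.
    by apply: le_trans K1; rewrite (invf_le1 m0); exact: m1.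
  by rewrite lee_fin; exact: (norm_ln_average b0 M0 MA AA').
have mLE : measurable_fun setT (fun w => (`|ln (A' w)|)%:E).
  by apply/measurable_EFinP; exact: mL.
have mc1 : measurable_fun setT (fun _ : T => 1 : R) by exact: measurable_cst.
have mL1 : measurable_fun setT (fun w => (`|ln (A' w)| + 1)%:E).
  by apply/measurable_EFinP; exact: (measurable_funD mL mc1).
have mR : measurable_fun setT (fun w => (A' w + 2 * Q w)%:E).
  by apply/measurable_EFinP; exact: (intg_measurable iR).
have h : (\int[P]_w (`|ln (A' w)|)%:E + 1 <= 1 + (2 * mean P Q)%:E)%E.
  have -> : (\int[P]_w (`|ln (A' w)|)%:E + 1 = \int[P]_w (`|ln (A' w)| + 1)%:E)%E.
    under [RHS]eq_integral do rewrite EFinD.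
    rewrite (ge0_integralD P measurableT _ mLE _ (measurable_cst _)); last 2 first.
    - by move=> w _; rewrite lee_fin normr_ge0.
    - by move=> w _; rewrite lee_fin ler01.
    by congr (_ + _)%E; rewrite (integral_cst P measurableT) mul1e; apply/esym; exact: probability_setT.
  have -> : (1 + (2 * mean P Q)%:E = \int[P]_w (A' w + 2 * Q w)%:E)%E.
    rewrite -[X in (X + _)%E](congr1 EFin eA') -(meanZ 2 intg_Q) -EFinD -(meanD iA' i2Q).
    exact: (fineK (integrable_fin_num measurableT iR)).
  have L0 w : setT w -> (0 <= (`|ln (A' w)| + 1)%:E)%E.
    by move=> _; rewrite lee_fin; apply: addr_ge0; [exact: normr_ge0|exact: ler01].
  have R0 w : setT w -> (0 <= (A' w + 2 * Q w)%:E)%E.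
    move=> _; rewrite lee_fin; apply: addr_ge0.
      apply: mulr_ge0; first by rewrite invr_ge0 ler0n.
      by apply: sumr_ge0 => i _; exact: rat_ge0.
    apply: mulr_ge0; first exact: ler0n.
    rewrite /Q; apply: addr_ge0; first by apply: mulr_ge0; [have := b0; lra|exact: sqr_ge0].
    by apply: divr_ge0; [have := sqr_ge0 (M w); lra|exact: ltW].
  exact: (ae_ge0_le_integral measurableT L0 mL1 R0 mR aeL).
apply: (@le_trans _ _ (2 * mean P Q)%:E); last first.
  by rewrite lee_fin; apply: ler_wpM2l; [exact: ler0n|exact: mean_Q].
by move: h; rewrite addeC leeD2lE.
Qed.

End truncation.
End increments.

(** * The logarithm of the population size *)

(** Jensen's inequality for the convex function x `^ (- e), by way of the
    tangent at the average. *)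
Lemma powR_neg_average {R : realType} (z : nat) (x : 'I_z -> R) (e : R) :
  (0 < z)%N -> 0 <= e -> (forall i, 0 < x i) ->
  (\sum_i x i) `^ (- e) <= z%:R `^ (- e) * (z%:R^-1 * \sum_i x i `^ (- e)).
Proof.
move=> z0 e0 x0.
have zn0 : 0 < z%:R :> R by rewrite ltr0n.
pose a := z%:R^-1 * \sum_i x i.
have s0 : 0 < \sum_i x i.
  case: z z0 x x0 {zn0} @a => // z _ x x0 _.
  rewrite (bigD1 ord0)//=; apply: ltr_pwDl; first exact: x0.
  by apply: sumr_ge0 => i _; exact: ltW.
have a0 : 0 < a by rewrite mulr_gt0// invr_gt0.
have -> : \sum_i x i = z%:R * a by rewrite /a mulVKf// gt_eqF.
rewrite powRM ?(ltW zn0) ?(ltW a0)// ler_wpM2l ?powR_ge0//.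
rewrite ler_pdivlMl// mulrC.
have h i : a `^ (- e) * (1 - e * (x i / a - 1)) <= x i `^ (- e).
  have -> : x i `^ (- e) = a `^ (- e) * expR (- e * ln (x i / a)).
    rewrite {1}(_ : x i = a * (x i / a)); last by rewrite mulrC divfK// gt_eqF.
    rewrite powRM ?(ltW a0) ?divr_ge0 ?(ltW a0) ?(ltW (x0 i))//; congr (_ * _).
    by rewrite /powR gt_eqF// divr_gt0.
  rewrite ler_wpM2l ?powR_ge0// (le_trans _ (expR_ge1Dx _))//.
  have := @le_ln_sub1 R (x i / a); rewrite divr_gt0// => /(_ isT) h.
  by rewrite lerD2l mulNr lerN2 ler_wpM2l.
apply: (@le_trans _ _ (\sum_i a `^ (- e) * (1 - e * (x i / a - 1)))); last first.
  by apply: ler_sum => i _; exact: h.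
rewrite -mulr_sumr sumrB sumr_const card_ord -mulr_sumr sumrB sumr_const card_ord.
rewrite -mulr_suml -[1 *+ z]/(z%:R).
have -> : (\sum_i x i) / a = z%:R.
  by rewrite /a invfM invrK mulrCA divff ?mulr1// gt_eqF.
by rewrite subrr mulr0 subr0.
Qed.

Section branching_log.
Context {R : realType} d (T : measurableType d) (P : probability T R).
Variables (p : R.-pker R ~> nat) (xi : 'I_2 -> nat -> {RV P >-> R}).
Variable X : 'I_2 -> nat -> nat -> {RV P >-> nat}.
Hypothesis xi_iid : iid_pairs xi.
Hypothesis X_cond : cond_indep_offspring p xi X.
Variable l : 'I_2.
Hypothesis mean_fin : {ae P, forall w, (offspring_mean p (xi l 0%N w) < +oo)%E}.
Hypothesis p0 : {ae P, forall w, p (xi l 0%N w) [set 0%N] = 0%E}.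
Hypothesis M2 : intg P (fun w => lmean p (xi l 0%N w) ^+ 2).
Hypothesis nontriv : ~ {ae P, forall w, lmean p (xi l 0%N w) = 0}.
Variables (q : R) (q1 : 1 < q).
Hypothesis ratq : intg P (fun w => rat p xi X l 0 0 w `^ q).

Notation pastT k := (g_sigma_algebraType (past X k)).
Notation presT k := (g_sigma_algebraType (present xi X k)).
Notation Z k := (branching (X l) k).

(** With K a power of z, the mean square error in integral_ln_average is a
    negative power of z, and b is a small enough positive power. *)
Lemma increment_decay : exists eps C1 : R, [/\ 0 < eps, 0 <= C1 &
  forall k z, (0 < z)%N ->
  (\int[P]_w `|ln (z%:R^-1 * \sum_(i < z) rat p xi X l k i w)|%:E <=
   (C1 * z%:R `^ (- eps))%:E)%E].
Proof.
(* With K = z `^ (1 / 2), both K `^ (1 - q) and K / z are at most z `^ (- s);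
   b = z `^ (s / 2) balances b * z `^ (- s) and 1 / b. *)
pose s := Num.min (2^-1) ((q - 1) / 2).
have s0 : 0 < s by rewrite lt_min invr_gt0 ltr0n/=; have := q1; lra.
have sq : s <= (q - 1) / 2 by rewrite ge_min lexx orbT.
have sh : s <= 2^-1 by rewrite ge_min lexx.
pose v := mean P (fun w => rat p xi X l 0 0 w `^ q).
pose m2 := mean P (fun w => lmean p (xi l 0%N w) ^+ 2).
have v0 : 0 <= v by apply: mean_ge0 => w; exact: powR_ge0.
have m20 : 0 <= m2 by apply: mean_ge0 => w; exact: sqr_ge0.
exists (s / 2), (2 * (7 * (2 * v + 1) + (1 + m2))); split.
- by rewrite divr_gt0.
- by apply: mulr_ge0 => //; lra.
move=> k z z0.
have z1 : 1 <= z%:R :> R by rewrite ler1n.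
have zp : 0 < z%:R :> R by rewrite ltr0n.
pose K : R := z%:R `^ (2^-1); pose b : R := z%:R `^ (s / 2).
have K1 : 1 <= K by rewrite -(powRr0 z%:R) ler_powR.
have b1 : 1 <= b by rewrite -(powRr0 z%:R) ler_powR//; lra.
have b0 : 0 < b by lra.
apply: (le_trans (integral_ln_average xi_iid X_cond mean_fin p0 M2 q1 ratq k z0 K1 b0)).
rewrite -/v -/m2 lee_fin.
have be : b^-1 = z%:R `^ (- (s / 2)) by rewrite powRN.
have bb : b^-1 * b^-1 = z%:R `^ (- s).
  rewrite be -powRD; first by congr (_ `^ _); lra.
  by apply/implyP => _; rewrite gt_eqF.
have h1 : K `^ (1 - q) <= b^-1 * b^-1.
  by rewrite bb /K -powRrM ler_powR//; lra.
have h2 : K / z%:R <= b^-1 * b^-1.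
  rewrite bb -[X in _ / X]powRr1 ?(ltW zp)// -powRN -powRD.
    by rewrite ler_powR//; lra.
  by apply/implyP => _; rewrite gt_eqF.
rewrite -be -mulrA ler_wpM2l// [leRHS]mulrDl.
apply: lerD => //.
have ib0 : 0 < b^-1 by rewrite invr_gt0.
have bV : b * b^-1 = 1 by rewrite divff// gt_eqF.
have h3 : 2 * (v * K `^ (1 - q)) + K / z%:R <= (2 * v + 1) * (b^-1 * b^-1).
  have := ler_wpM2l v0 h1; lra.
have h4 : 0 <= (2 * v + 1) * (b^-1 * b^-1).
  by apply: mulr_ge0; [lra|exact: mulr_ge0 (ltW ib0) (ltW ib0)].
apply: (@le_trans _ _ (7 * b * ((2 * v + 1) * (b^-1 * b^-1)))).
  apply: (@le_trans _ _ ((2 + 5 * b) * ((2 * v + 1) * (b^-1 * b^-1)))).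
    by apply: ler_wpM2l h3; lra.
  by apply: (ler_wpM2r h4); lra.
rewrite (_ : 7 * b * _ = 7 * (2 * v + 1) * b^-1 * (b * b^-1)); last by ring.
by rewrite bV mulr1.
Qed.

Section extinction_free_growth.
Variables (eps : R) (eps0 : 0 < eps).

Let neps0 : (- eps == 0) = false. Proof. by rewrite oppr_eq0; exact: gt_eqF. Qed.

Definition inv_moment : R := mean P (fun w => (X l 0 0 w)%:R `^ (- eps)).

Let powR_nat_le1 (c : nat) : c%:R `^ (- eps) <= 1 :> R.
Proof.
case: c => [|c]; first by rewrite powR0 ?neps0// ler01.
rewrite -[leRHS](powRr0 (c.+1%:R : R)) ler_powR ?ler1n//; have := eps0; lra.
Qed.

Let mpow (Y : T -> nat) : measurable_fun setT Y ->
  measurable_fun setT (fun w => (Y w)%:R `^ (- eps) : R).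
Proof.
move=> mY; apply: (@measurableT_comp _ _ _ _ _ _ (fun c : nat => c%:R `^ (- eps))) mY.
by move=> _ A _; rewrite setTI.
Qed.

Lemma intg_inv_moment (Y : T -> nat) : measurable_fun setT Y ->
  intg P (fun w => (Y w)%:R `^ (- eps)).
Proof.
move=> mY; apply: (@intg_bounded _ _ _ P _ 1); first exact: mpow.
by move=> w; rewrite ger0_norm ?powR_ge0.
Qed.

Lemma mean_inv_moment k i : mean P (fun w => (X l k i w)%:R `^ (- eps)) = inv_moment.
Proof.
have := @integral_child_stationary _ _ _ P p xi X xi_iid X_cond l
  (fun _ c => (c%:R `^ (- eps))%:E) k i.
rewrite /inv_moment /mean /Rintegral => -> //.
Qed.

Lemma inv_moment_ge0 : 0 <= inv_moment.
Proof. by apply: mean_ge0 => w; exact: powR_ge0. Qed.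

(** Otherwise everybody would have exactly one child, the conditional mean
    would be 1 and its logarithm 0. *)
Lemma inv_moment_lt1 : inv_moment < 1.
Proof.
have iX := @intg_inv_moment (X l 0 0) (measurable_funP _).
rewrite lt_neqAle; apply/andP; split; last first.
  rewrite -[leRHS](mean_cst P); apply: (mean_le iX (intg_cst P 1)) => w.
  exact: powR_nat_le1.
apply/negP => /eqP g1; apply: nontriv.
have ae0 (f : T -> R) : intg P f -> (forall w, 0 <= f w) -> mean P f = 0 ->
    {ae P, forall w, f w = 0}.
  move=> iF f0 ef; have mf := intg_measurable iF.
  have := ae_eq_integral_abs P measurableT (f := EFin \o f) _.
  case; first exact/measurable_EFinP.
  move=> + _; have -> : (\int[P]_w `|(EFin \o f) w| = 0)%E.
    under eq_integral do rewrite /= ger0_norm//.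
    rewrite -(fineK (integrable_fin_num measurableT iF)).
    by congr EFin; exact: ef.
  move=> /(_ erefl); apply: filterS => w /(_ I) /=.
  by move=> [].
have ae1 : {ae P, forall w, 1 - (X l 0 0 w)%:R `^ (- eps) = 0}.
  apply: (ae0 _ (intgB (intg_cst P 1) iX)).
    by move=> w; rewrite subr_ge0 powR_nat_le1.
  by rewrite (meanB (intg_cst P 1) iX) mean_cst [X in 1 - X]g1 subrr.
have aeX1 : {ae P, forall w, X l 0 0 w = 1%N}.
  apply: filterS2 (ae_good_event xi_iid X_cond mean_fin p0) ae1 => w [_ gX] e.
  have := gX 0%N 0%N; move: e; case: (X l 0 0 w) => [//|[//|c]] e _.
  have : c.+2%:R `^ (- eps) < 1 :> R.
    by rewrite /powR pnatr_eq0/= -[ltRHS]expR0 ltr_expR mulNr oppr_lt0 mulr_gt0// ln_gt0// ltr1n.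
  move=> h; exfalso; move: h e; lra.
have mr c : measurable_fun setT (fun w => ratio p (xi l 0%N w) c).
  by apply: (measurableT_comp (measurable_ratio p c)).
have rat1 : {ae P, forall w, rat p xi X l 0 0 w = ratio p (xi l 0%N w) 1}.
  by apply: filterS aeX1 => w e; rewrite /rat e.
have le1 x : ratio p x 1 <= 1.
  rewrite /ratio; case: ifPn => // gx.
  have [m1 _] := good_mean gx.
  by rewrite mul1r invf_le1 // (lt_le_trans _ m1).
have ir1 : intg P (fun w => ratio p (xi l 0%N w) 1).
  apply: (@intg_bounded _ _ _ P _ 1) => // w.
  by rewrite ger0_norm ?ratio_ge0.
have er1 : mean P (fun w => ratio p (xi l 0%N w) 1) = 1.
  rewrite -[RHS](mean_rat X_cond l 0 0); apply/esym; apply: mean_ae => //.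
  exact: measurable_rat.
have aem := ae0 _ (intgB (intg_cst P 1) ir1).
have {}aem : {ae P, forall w, 1 - ratio p (xi l 0%N w) 1 = 0}.
  apply: aem; first by move=> w; rewrite subr_ge0.
  by rewrite (meanB (intg_cst P 1) ir1) mean_cst er1 subrr.
apply: filterS2 (ae_good_event xi_iid X_cond mean_fin p0) aem => w [gw _].
rewrite /ratio gw mul1r => /eqP; rewrite subr_eq0 => /eqP h.
by rewrite /lmean -[fine _]invrK -h invr1 ln1.
Qed.

Let Y k (z : nat) (w : T) : \bar R :=
  (((\sum_(i < z) X l k i w)%N)%:R `^ (- eps))%:E.

Let mY k z : measurable_fun setT (Y k z : presT k -> \bar R).
Proof.
have mS : measurable_fun setT ((fun w => \sum_(i < z) X l k i w)%N : presT k -> nat).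
  apply: (@measurable_sum_nat _ (presT k) (fun i => X l k i : presT k -> nat)) => i.
  exact: measurable_child_present.
have mf : measurable_fun setT (fun c : nat => (c%:R `^ (- eps))%:E : \bar R).
  by move=> _ A _; rewrite setTI.
exact: (measurableT_comp mf mS).
Qed.

Let inner k z : (\int[P]_w Y k z w <= (inv_moment * z%:R `^ (- eps))%:E)%E.
Proof.
case: z => [|z].
  rewrite [leRHS](_ : _ = 0%E); last by rewrite powR0 ?neps0// mulr0.
  rewrite (eq_integral (fun=> 0%E)); first by rewrite integral0.
  by move=> w _; rewrite /Y big_ord0 powR0// neps0.
have mX i : measurable_fun setT (fun w => (X l k i w)%:R `^ (- eps) : R) by exact: mpow.
have iXi (i : 'I_z.+1) : intg P (fun w => (X l k i w)%:R `^ (- eps)).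
  exact: intg_inv_moment.
have iS : intg P (fun w => \sum_(i < z.+1) (X l k i w)%:R `^ (- eps)).
  exact: intg_sum.
have iF := intgZ (z.+1%:R `^ (- eps)) (intgZ (z.+1%:R^-1) iS).
have eF : (\int[P]_w (z.+1%:R `^ (- eps) * (z.+1%:R^-1 * \sum_(i < z.+1) (X l k i w)%:R `^ (- eps)))%:E
   = (inv_moment * z.+1%:R `^ (- eps))%:E)%E.
  rewrite -[LHS](fineK (integrable_fin_num measurableT iF)); congr EFin.
  have := meanZ (z.+1%:R `^ (- eps)) (intgZ (z.+1%:R^-1) iS).
  rewrite (meanZ _ iS) mean_sum// (eq_bigr (fun=> inv_moment)); last first.
    by move=> i _; exact: mean_inv_moment.
  rewrite sumr_const card_ord -[inv_moment *+ _]mulr_natl mulKf ?pnatr_eq0// mulrC.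
  by move=> <-.
rewrite -eF; apply: ae_ge0_le_integral => //.
- by move=> w _; rewrite lee_fin powR_ge0.
- apply/measurable_EFinP; apply: mpow.
  exact: (@measurable_sum_nat _ T (fun i => X l k i : T -> nat)).
- move=> w _; rewrite lee_fin mulr_ge0 ?powR_ge0// mulr_ge0 ?invr_ge0//.
  by apply: sumr_ge0 => i _; exact: powR_ge0.
- by apply/measurable_EFinP; exact: (intg_measurable iF).
apply: filterS (ae_good_event xi_iid X_cond mean_fin p0) => w [_ gX] _.
rewrite lee_fin natr_sum powR_neg_average//; first exact: ltW.
by move=> i; rewrite ltr0n; exact: gX.
Qed.

(** The population grows geometrically in the sense of its moment of order
    - eps: by powR_neg_average, a generation multiplies this moment by at most
    inv_moment, since everybody has a child. *)
Lemma branching_inv_moment k :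
  (\int[P]_w ((Z k w)%:R `^ (- eps))%:E <= (inv_moment ^+ k)%:E)%E.
Proof.
elim: k => [|k ih].
  rewrite /= (eq_integral (fun=> 1%E)); last by move=> w _; rewrite powR1.
  rewrite (integral_cst P measurableT) mul1e le_eqVlt; apply/orP; left; apply/eqP.
  exact: probability_setT.
have -> : (\int[P]_w ((Z k.+1 w)%:R `^ (- eps))%:E = \int[P]_w Y k (Z k w) w)%E by [].
have mZ := @measurable_branching_past _ _ _ P X k l k (leqnn k).
have Y0 z w : (0 <= Y k z w)%E by rewrite lee_fin powR_ge0.
rewrite (integral_past_present xi_iid X_cond mZ (@mY k) Y0).
apply: (@le_trans _ _ (\int[P]_w (inv_moment%:E * ((Z k w)%:R `^ (- eps))%:E))%E).
  apply: ge0_le_integral => //.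
  - by move=> w _; apply: integral_ge0 => w' _; rewrite lee_fin powR_ge0.
  - have mi : measurable_fun setT (fun z : nat => \int[P]_w' Y k z w')%E.
      by move=> _ A _; rewrite setTI.
    exact: (measurableT_comp mi (@measurable_branching _ _ _ P X l k)).
  - apply/measurable_EFinP; apply: measurable_funM => //; apply: mpow.
    exact: measurable_branching.
  by move=> w _; rewrite -EFinM; exact: inner.
have mE : measurable_fun setT (fun w => ((Z k w)%:R `^ (- eps))%:E : \bar R).
  by apply/measurable_EFinP; exact: (mpow (@measurable_branching _ _ _ P X l k)).
rewrite (ge0_integralZl P measurableT mE)//; last by rewrite lee_fin inv_moment_ge0.
rewrite exprS EFinM; apply: lee_wpmul2l ih.
by rewrite lee_fin inv_moment_ge0.
Qed.

End extinction_free_growth.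

Let D k (z : nat) (w : T) : \bar R :=
  `|ln (z%:R^-1 * \sum_(i < z) rat p xi X l k i w)|%:E.

Let D0 k z w : (0 <= D k z w)%E.
Proof. by rewrite lee_fin normr_ge0. Qed.

Let mD k z : measurable_fun setT (D k z : presT k -> \bar R).
Proof.
have mr i : measurable_fun setT (rat p xi X l k i : presT k -> R).
  apply: (@measurable_nat_index _ _ (presT k) R (X l k i : presT k -> nat)
    (fun c w => ratio p (xi l k w) c)); first exact: measurable_child_present.
  move=> c; exact: (measurableT_comp (measurable_ratio p c) (@measurable_xi_present _ _ _ P xi X k l)).
have ms : measurable_fun setT ((fun w => \sum_(i < z) rat p xi X l k i w) : presT k -> R).
  by apply: measurable_sum => i; exact: mr.
have mc : measurable_fun setT (fun _ : presT k => z%:R^-1 : R) by exact: measurable_cst.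
have mn : measurable_fun setT (@Num.norm R R) by [].
apply/measurable_EFinP.
exact: (measurableT_comp mn (measurableT_comp (@measurable_ln R) (measurable_funM mc ms))).
Qed.

Let mDT k z : measurable_fun setT (D k z).
Proof.
have ms : measurable_fun setT (fun w => \sum_(i < z) rat p xi X l k i w).
  by apply: measurable_sum => i; exact: measurable_rat.
have mc : measurable_fun setT (fun _ : T => z%:R^-1 : R) by exact: measurable_cst.
have mn : measurable_fun setT (@Num.norm R R) by [].
apply/measurable_EFinP.
exact: (measurableT_comp mn (measurableT_comp (@measurable_ln R) (measurable_funM mc ms))).
Qed.

Let mDZ k : measurable_fun setT (fun w => D k (Z k w) w).
Proof. exact: (@measurable_nat_index _ _ _ _ (Z k) (D k) (@measurable_branching _ _ _ P X l k)). Qed.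

(** The estimate increment_decay at the frozen population size z, averaged over
    the size by means of branching_inv_moment. *)
Lemma integral_increment : exists g C1 : R, [/\ 0 <= g < 1, 0 <= C1 &
  forall k, (\int[P]_w D k (Z k w) w <= (C1 * g ^+ k)%:E)%E].
Proof.
have [eps [C1 [eps0 C10 dec]]] := increment_decay.
exists (inv_moment eps), C1; split => //.
  by rewrite inv_moment_ge0 inv_moment_lt1.
move=> k.
have mZ := @measurable_branching_past _ _ _ P X k l k (leqnn k).
rewrite (integral_past_present xi_iid X_cond mZ (@mD k) (@D0 k)).
have mE : measurable_fun setT (fun w => ((Z k w)%:R `^ (- eps))%:E : \bar R).
  have mf : measurable_fun setT (fun c : nat => (c%:R `^ (- eps))%:E : \bar R).
    by move=> _ A _; rewrite setTI.
  exact: (measurableT_comp mf (@measurable_branching _ _ _ P X l k)).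
have mi : measurable_fun setT (fun z : nat => \int[P]_w' D k z w')%E.
  by move=> _ A _; rewrite setTI.
apply: (@le_trans _ _ (\int[P]_w (C1%:E * ((Z k w)%:R `^ (- eps))%:E))%E).
  apply: ge0_le_integral => //.
  - by move=> w _; apply: integral_ge0 => w' _; exact: D0.
  - exact: (measurableT_comp mi (@measurable_branching _ _ _ P X l k)).
  - exact: measurable_funeM.
  move=> w _; case: (Z k w) => [|z]; last exact: dec.
  rewrite (eq_integral (fun=> 0%E)); last first.
    by move=> w' _; rewrite /D big_ord0 mulr0 ln0// normr0.
  by rewrite integral0 -EFinM lee_fin mulr_ge0// powR_ge0.
rewrite (ge0_integralZl P measurableT mE)//.
rewrite EFinM; apply: lee_wpmul2l => //.
exact: branching_inv_moment.
Qed.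

Lemma branching_gt0 w n : good_event p xi X l w -> (0 < Z n w)%N.
Proof.
move=> [_ gX]; elim: n => [//|n ih] /=.
case: (Z n w) ih => // z _; rewrite big_ord_recl.
by rewrite (leq_trans (gX n 0%N))// leq_addr.
Qed.

(** The size of the next generation is the size of the current one, times the
    conditional mean, times the average of the normalized numbers of children. *)
Lemma ln_branchingE w n : good_event p xi X l w ->
  ln (Z n w)%:R - \sum_(k < n) lmean p (xi l k w) =
  \sum_(k < n) ln ((Z k w)%:R^-1 * \sum_(i < Z k w) rat p xi X l k i w).
Proof.
move=> gw; elim: n => [|n ih]; first by rewrite !big_ord0 /= ln1 subr0.
rewrite !big_ord_recr/= -ih.
have Zn := branching_gt0 n gw; have ZSn := branching_gt0 n.+1 gw.
have [gx _] := gw; have [m1 _] := good_mean (gx n).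
have m0 : 0 < fine (offspring_mean p (xi l n w)) by exact: lt_le_trans m1.
have -> : \sum_(i < Z n w) rat p xi X l n i w =
    (Z n.+1 w)%:R / fine (offspring_mean p (xi l n w)).
  rewrite /= natr_sum mulr_suml; apply: eq_bigr => i _.
  by rewrite /rat /ratio gx.
rewrite lnM ?posrE ?invr_gt0 ?divr_gt0 ?ltr0n// lnV ?posrE ?ltr0n//.
rewrite ln_div ?posrE ?ltr0n// /lmean /=; ring.
Qed.

Lemma measurable_branching_log n :
  measurable_fun setT (fun w => ln (Z n w)%:R - \sum_(k < n) lmean p (xi l k w)).
Proof.
have mf : measurable_fun setT (fun c : nat => ln c%:R : R).
  by move=> _ A _; rewrite setTI.
have m1 := measurableT_comp mf (@measurable_branching _ _ _ P X l n).
have m2 : measurable_fun setT (fun w => \sum_(k < n) lmean p (xi l k w)).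
  apply: measurable_sum => k.
  exact: (measurableT_comp (measurable_lmean p) (measurable_funP (xi l k))).
exact: (measurable_funB m1 m2).
Qed.

(** The increments decay geometrically in mean, so the logarithm of the
    population size stays at bounded mean distance from the random walk of the
    logarithms of the conditional means. *)
Lemma branching_log_L1 : exists C : R, 0 <= C /\ forall n,
  (\int[P]_w `|ln (Z n w)%:R - \sum_(k < n) lmean p (xi l k w)|%:E <= C%:E)%E.
Proof.
have [g [C1 [/andP[g0 g1] C10 h]]] := integral_increment.
have g1' : 0 < 1 - g by lra.
exists (C1 / (1 - g)); split; first exact: divr_ge0 C10 (ltW g1').
move=> n.
have mS : measurable_fun setT (fun w => \sum_(k < n) D k (Z k w) w)%E.
  by apply: emeasurable_sum => k; exact: mDZ.
have ml : measurable_fun setT (fun w =>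
    `|ln (Z n w)%:R - \sum_(k < n) lmean p (xi l k w)|%:E : \bar R).
  have mn : measurable_fun setT (@Num.norm R R) by [].
  by apply/measurable_EFinP; exact: (measurableT_comp mn (measurable_branching_log n)).
apply: (@le_trans _ _ (\int[P]_w \sum_(k < n) D k (Z k w) w)%E).
  apply: (ae_ge0_le_integral measurableT _ ml _ mS).
  - by move=> w _; rewrite lee_fin normr_ge0.
  - by move=> w _; apply: sume_ge0 => k _; exact: D0.
  apply: filterS (ae_good_event xi_iid X_cond mean_fin p0) => w gw _.
  by rewrite ln_branchingE// /D sumEFin lee_fin; exact: ler_norm_sum.
rewrite ge0_integral_sum//.
apply: (le_trans (lee_sum _ (fun (k : 'I_n) _ => h k))).
rewrite sumEFin lee_fin -mulr_sumr ler_wpM2l//.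
rewrite -[leRHS]mul1r ler_pdivlMr// mulrC.
have -> : (1 - g) * \sum_(i < n) g ^+ i = 1 - g ^+ n.
  have := subrX1 g n; lra.
by rewrite gerBl exprn_ge0.
Qed.

End branching_log.

(** * Normal approximation for two branching processes *)

Section variance_lower_bound.
Context {R : realType}.

(** For m <= n the right-hand side is (a + b - 2 * k) / n + b * (1 / m - 1 / n),
    a combination of numbers at least c with nonnegative weights of sum 1 / m;
    the other case is symmetric. *)
Lemma variance_comparison (a b k c : R) (m n : nat) : (0 < m)%N -> (0 < n)%N ->
  c <= a -> c <= b -> c <= a + b - 2 * k ->
  c / (minn m n)%:R <=
  n%:R^-1 * a + m%:R^-1 * b - 2 * k * ((minn m n)%:R / (m%:R * n%:R)).
Proof.
move=> m0 n0 ca cb cab.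
have nm : n%:R != 0 :> R by rewrite pnatr_eq0 -lt0n.
have mm : m%:R != 0 :> R by rewrite pnatr_eq0 -lt0n.
have n0' : 0 < n%:R^-1 :> R by rewrite invr_gt0 ltr0n.
have m0' : 0 < m%:R^-1 :> R by rewrite invr_gt0 ltr0n.
have [mn|/ltnW mn] := leqP m n.
  rewrite (_ : _ / (_ * _) = n%:R^-1); last by field; rewrite nm mm.
  have mn' : n%:R^-1 <= m%:R^-1 :> R by rewrite lef_pV2 ?posrE ?ltr0n// ler_nat.
  nra.
rewrite (_ : _ / (_ * _) = m%:R^-1); last by field; rewrite nm mm.
have mn' : m%:R^-1 <= n%:R^-1 :> R by rewrite lef_pV2 ?posrE ?ltr0n// ler_nat.
nra.
Qed.

Lemma variance_difference_gt0 (s0 s1 rho : R) : 0 < s0 -> 0 < s1 ->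
  rho < 1 \/ (rho = 1 /\ s0 <> s1) ->
  0 < s0 ^+ 2 + s1 ^+ 2 - 2 * (rho * s0 * s1).
Proof.
move=> s00 s10 [r1|[-> ne]].
  have := sqr_ge0 (s0 - s1); have : 0 < (1 - rho) * (s0 * s1).
    by rewrite mulr_gt0 ?mulr_gt0// subr_gt0.
  nra.
have : 0 < (s0 - s1) ^+ 2.
  by rewrite lt_neqAle sqr_ge0 andbT eq_sym sqrf_eq0 subr_eq0; apply/eqP.
nra.
Qed.

End variance_lower_bound.

Section pair_of_processes.
Context {R : realType} d (T : measurableType d) (P : probability T R).
Variables (p : R.-pker R ~> nat) (xi : 'I_2 -> nat -> {RV P >-> R}).
Variable X : 'I_2 -> nat -> nat -> {RV P >-> nat}.
Hypothesis xi_iid : iid_pairs xi.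
Hypothesis X_cond : cond_indep_offspring p xi X.
Hypothesis mean_fin : forall l, {ae P, forall w, (offspring_mean p (xi l 0%N w) < +oo)%E}.
Hypothesis sigma_pos_fin : forall l, (0 < 'V_P[log_mean p xi l 0] < +oo)%E.
Hypothesis p0 : forall l, {ae P, forall w, p (xi l 0%N w) [set 0%N] = 0%E}.
Hypothesis rho_cond : (-1 <= rho_ p xi < 1)
  \/ (rho_ p xi = 1 /\ sigma_ p xi 0 <> sigma_ p xi 1).
Variable delta : R.
Hypothesis delta01 : 0 < delta <= 1.
Hypothesis moment_M : ('E_P[(fun w => log_mean p xi 0 0 w `^ (2 + delta)
  + log_mean p xi 1 0 w `^ (2 + delta))%R] < +oo)%E.
Variable q : R.
Hypothesis q1 : 1 < q.
Hypothesis moment_Z : ('E_P[(fun w =>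
    (branching (X 0) 1 w)%:R `^ q / env_mean p xi 0 0 w `^ q
  + (branching (X 1) 1 w)%:R `^ q / env_mean p xi 1 0 w `^ q)%R] < +oo)%E.

Let M l w := lmean p (xi l 0%N w).
Let h l x : R := lmean p x - mu_ p xi l.

Let mM l : measurable_fun setT (M l).
Proof. exact: (measurableT_comp (measurable_lmean p) (measurable_funP (xi l 0%N))). Qed.

Let mh l : measurable_fun setT (h l).
Proof. by apply: measurable_funB; [exact: measurable_lmean|exact: measurable_cst]. Qed.

Let mpow (f : T -> R) (a : R) : measurable_fun setT f ->
  measurable_fun setT (fun w => f w `^ a).
Proof. by move=> mf; apply: (@measurableT_comp _ _ _ _ _ _ (@powR R ^~ a)) => //. Qed.

Let le_sum2 (f : 'I_2 -> R) (l : 'I_2) : (forall l, 0 <= f l) -> f l <= f 0 + f 1.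
Proof. by move=> f0; have [->|->] := ord2_eq01 l; rewrite ?lerDl ?lerDr. Qed.

Let momM l : intg P (fun w => `|M l w| `^ (2 + delta)).
Proof.
have mm : ('E_P[(fun w => M 0 w `^ (2 + delta) + M 1 w `^ (2 + delta))%R] < +oo)%E := moment_M.
move: mm; rewrite unlock => mm.
have mP j : measurable_fun setT (fun w => M j w `^ (2 + delta)) by exact: mpow.
apply: (intg_ae_le _ (measurable_funD (mP 0) (mP 1)) _ _ mm).
- exact: measurable_powR_norm.
- by move=> w; rewrite addr_ge0 ?powR_ge0.
apply: filterS (ae_good_event xi_iid X_cond (mean_fin l) (p0 l)) => w [gw _].
have [m1 _] := good_mean (gw 0%N).
have M0 : 0 <= M l w by rewrite /M /lmean ln_ge0.
rewrite (ger0_norm M0) ger0_norm ?powR_ge0//.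
by apply: (@le_sum2 (fun j => M j w `^ (2 + delta))) => j; exact: powR_ge0.
Qed.

Let M2 l : intg P (fun w => M l w ^+ 2).
Proof. by apply: (intg_sqr_of_moment _ (mM l) (momM l)); have := delta01; lra. Qed.

Let iM l : intg P (M l).
Proof. exact: (intg_of_sqr (mM l) (M2 l)). Qed.

Let fineE (f : T -> R) : fine 'E_P[f] = mean P f.
Proof. by rewrite unlock. Qed.

Let muE l : mu_ p xi l = mean P (M l).
Proof. exact: fineE. Qed.

Let hm l : intg P (fun w => `|h l (xi l 0%N w)| `^ (2 + delta)).
Proof. exact: (intg_moment_shift _ delta01 (mM l) (momM l)). Qed.

Let mhx l : measurable_fun setT (fun w => h l (xi l 0%N w)).
Proof. exact: (measurableT_comp (mh l) (measurable_funP (xi l 0%N))). Qed.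

Let h2 l : intg P (fun w => h l (xi l 0%N w) ^+ 2).
Proof. by apply: (intg_sqr_of_moment _ (mhx l) (hm l)); have := delta01; lra. Qed.

Let ih l : intg P (fun w => h l (xi l 0%N w)).
Proof. exact: (intg_of_sqr (mhx l) (h2 l)). Qed.

Let h_mean l : mean P (fun w => h l (xi l 0%N w)) = 0.
Proof. by rewrite (meanB (iM l) (intg_cst P _)) mean_cst muE subrr. Qed.

Let varE l : fine 'V_P[log_mean p xi l 0] = mean P (fun w => h l (xi l 0%N w) ^+ 2).
Proof. by rewrite /variance unlock fineE. Qed.

Let sigma_gt0 l : 0 < sigma_ p xi l.
Proof. by rewrite sqrtr_gt0 fine_gt0. Qed.

Let sigma2 l : sigma_ p xi l ^+ 2 = mean P (fun w => h l (xi l 0%N w) ^+ 2).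
Proof.
have v0 : 0 <= fine 'V_P[log_mean p xi l 0] by rewrite ltW// fine_gt0.
by rewrite sqr_sqrtr.
Qed.

Let cov : rho_ p xi * sigma_ p xi 0 * sigma_ p xi 1 =
  mean P (fun w => h 0 (xi 0 0%N w) * h 1 (xi 1 0%N w)).
Proof.
rewrite /rho_ -mulrA divfK; last by rewrite mulf_neq0 ?gt_eqF.
by rewrite unlock fineE.
Qed.

Let nontriv l : ~ {ae P, forall w, lmean p (xi l 0%N w) = 0}.
Proof.
move=> z; have : 0 < sigma_ p xi l ^+ 2 by rewrite exprn_gt0.
rewrite sigma2 (@mean_ae _ _ _ P _ (fun=> 0)).
- by rewrite mean_cst ltxx.
- exact: measurable_funX.
- exact: measurable_cst.
have mu0 : mu_ p xi l = 0.
  by rewrite muE (@mean_ae _ _ _ P _ (fun=> 0)) ?mean_cst//; exact: measurable_cst.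
by apply: filterS z => w e; rewrite /h e mu0 subr0 expr0n.
Qed.

Let ratq l : intg P (fun w => rat p xi X l 0 0 w `^ q).
Proof.
move: moment_Z; rewrite unlock => mz.
pose f (j : 'I_2) w := (branching (X j) 1 w)%:R `^ q / env_mean p xi j 0 w `^ q.
have mf j : measurable_fun setT (f j).
  have mX : measurable_fun setT (fun w => (branching (X j) 1 w)%:R : R).
    have mn : measurable_fun setT (fun c : nat => c%:R : R).
      by move=> _ A _; rewrite setTI.
    exact: (measurableT_comp mn (@measurable_branching _ _ _ P X j 1%N)).
  have me : measurable_fun setT (env_mean p xi j 0).
    have mfine : measurable_fun setT (@fine R) by exact: fine_measurable.
    exact: (measurableT_comp mfine (measurableT_comp (measurable_offspring_mean p)
      (measurable_funP (xi j 0%N)))).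
  rewrite (_ : f j = fun w => (branching (X j) 1 w)%:R `^ q * env_mean p xi j 0 w `^ (- q)).
    exact: (measurable_funM (mpow q mX) (mpow (- q) me)).
  by apply/funext => w; rewrite powRN.
have f0 j w : 0 <= f j w by rewrite divr_ge0 ?powR_ge0.
apply: (intg_ae_le _ (measurable_funD (mf 0) (mf 1)) _ _ mz).
- by apply: mpow; exact: measurable_rat.
- by move=> w; rewrite addr_ge0.
apply: filterS (ae_good_event xi_iid X_cond (mean_fin l) (p0 l)) => w [gw _].
rewrite ger0_norm ?powR_ge0//.
have [m1 _] := good_mean (gw 0%N).
have -> : rat p xi X l 0 0 w `^ q = f l w.
  rewrite /rat /ratio gw /f /env_mean /= big_ord1 powRM ?invr_ge0 ?(le_trans _ m1)//.
  by rewrite powRV// (le_trans _ m1).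
exact: (@le_sum2 (fun j => f j w)).
Qed.

Let D l n w : R := ln (branching (X l) n w)%:R - \sum_(k < n) lmean p (xi l k w).

Let mD l n : measurable_fun setT (D l n).
Proof. exact: measurable_branching_log. Qed.

Let D_L1 l : exists C : R, 0 <= C /\ forall n, intg P (D l n) /\ mean P (fun w => `|D l n w|) <= C.
Proof.
have [C [C0 hC]] := branching_log_L1 xi_iid X_cond (mean_fin l) (p0 l) (M2 l)
  (@nontriv l) q1 (ratq l).
by exists C; split => // n; apply: integral_le_intg; [exact: mD|exact: hC].
Qed.

(** The condition on the correlation is exactly what makes the variance of the
    difference of the two log means positive; with variance_comparison this
    gives V the order of (minn m n) `^ - (1 / 2). *)
Lemma V_lower_bound : exists c : R, 0 < c /\ forall m n : nat, (0 < m)%N -> (0 < n)%N ->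
  [/\ 0 < V_ p xi m n, c / (minn m n)%:R <= V_ p xi m n ^+ 2 &
  V_ p xi m n ^+ 2 = n%:R^-1 * mean P (fun w => h 0 (xi 0 0%N w) ^+ 2)
    + m%:R^-1 * mean P (fun w => h 1 (xi 1 0%N w) ^+ 2)
    - 2 * mean P (fun w => h 0 (xi 0 0%N w) * h 1 (xi 1 0%N w))
      * ((minn m n)%:R / (m%:R * n%:R))].
Proof.
pose a := sigma_ p xi 0 ^+ 2; pose b := sigma_ p xi 1 ^+ 2.
pose k := rho_ p xi * sigma_ p xi 0 * sigma_ p xi 1.
have a0 : 0 < a by exact: exprn_gt0.
have b0 : 0 < b by exact: exprn_gt0.
have k0 : 0 < a + b - 2 * k.
  apply: variance_difference_gt0 => //.
  by have [/andP[_ ?]|?] := rho_cond; [left|right].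
pose c := Num.min (a + b - 2 * k) (Num.min a b).
have c0 : 0 < c by rewrite !lt_min k0 a0 b0.
have ca : c <= a by rewrite !ge_min lexx !orbT.
have cb : c <= b by rewrite !ge_min lexx !orbT.
have cab : c <= a + b - 2 * k by rewrite ge_min lexx.
exists c; split => // m n m0 n0.
have lb := variance_comparison m0 n0 ca cb cab.
have min0 : 0 < (minn m n)%:R :> R by rewrite ltr0n leq_min m0 n0.
have V2 : V_ p xi m n ^+ 2 = n%:R^-1 * a + m%:R^-1 * b
    - 2 * k * ((minn m n)%:R / (m%:R * n%:R)).
  rewrite sqr_sqrtr ?/k ?mulrA//; move: lb; rewrite /k !mulrA; apply: le_trans.
  by rewrite divr_ge0 ?ltW.
have pos : 0 < n%:R^-1 * a + m%:R^-1 * b - 2 * k * ((minn m n)%:R / (m%:R * n%:R)).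
  by apply: lt_le_trans lb; rewrite divr_gt0.
split; last by rewrite V2 /a /b /k !sigma2 cov.
  by rewrite lt_neqAle sqrtr_ge0 andbT eq_sym -sqrf_eq0 V2 gt_eqF.
by rewrite V2.
Qed.

Let S m n w : R := (n%:R^-1 * (\sum_(k < n) h 0 (xi 0 k w))
  - m%:R^-1 * (\sum_(k < m) h 1 (xi 1 k w))) / V_ p xi m n.

Let intg_S m n : intg P (S m n).
Proof.
have is_ l (j : nat) : intg P (fun w => \sum_(k < j) h l (xi l k w)).
  by apply: intg_sum => k; exact: (@intg_xi _ _ _ P xi xi_iid l k _ (mh l) (ih l)).
rewrite (_ : S m n = fun w => (V_ p xi m n)^-1 * (n%:R^-1 * (\sum_(k < n) h 0 (xi 0 k w))
  - m%:R^-1 * (\sum_(k < m) h 1 (xi 1 k w)))); last first.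
  by apply/funext => w; rewrite /S mulrC.
exact: (intgZ _ (intgB (intgZ _ (is_ 0 n)) (intgZ _ (is_ 1 m)))).
Qed.

Let R_E m n w : (0 < m)%N -> (0 < n)%N ->
  R_ p xi X m n w = S m n w + (V_ p xi m n)^-1 * (n%:R^-1 * D 0 n w - m%:R^-1 * D 1 m w).
Proof.
move=> m0 n0.
have nm : n%:R != 0 :> R by rewrite pnatr_eq0 -lt0n.
have mm : m%:R != 0 :> R by rewrite pnatr_eq0 -lt0n.
have e l j : \sum_(k < j) h l (xi l k w) =
    \sum_(k < j) lmean p (xi l k w) - j%:R * mu_ p xi l.
  by rewrite sumrB sumr_const card_ord mulr_natl.
rewrite /R_ /S /D !e [RHS](_ : _ = (n%:R^-1 * (ln (branching (X 0) n w)%:R - n%:R * mu_ p xi 0)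
   - m%:R^-1 * (ln (branching (X 1) m w)%:R - m%:R * mu_ p xi 1)) / V_ p xi m n); last by ring.
by congr (_ / _); rewrite !mulrBr !mulKf//; ring.
Qed.

Let intg_R m n : (0 < m)%N -> (0 < n)%N -> intg P (R_ p xi X m n).
Proof.
move=> m0 n0.
have [C0 [_ i0]] := D_L1 0; have [C1 [_ i1]] := D_L1 1.
rewrite (_ : R_ p xi X m n = fun w => S m n w +
  (V_ p xi m n)^-1 * (n%:R^-1 * D 0 n w - m%:R^-1 * D 1 m w)); last first.
  by apply/funext => w; exact: R_E.
exact: (intgD (intg_S m n) (intgZ _ (intgB (intgZ _ (i0 n).1) (intgZ _ (i1 m).1)))).
Qed.

(** By d_w_stein the distance is the expectation of a 1-Lipschitz function of
    the statistic. The statistic differs from the normalized difference S of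
    random walks by a variable of mean of order 1 / ((minn m n) * V), that is
    (minn m n) `^ - (1 / 2), by branching_log_L1, and env_clt applies to S. *)
Lemma d_w_bound : exists C : R, 0 < C /\ forall m n : nat, (0 < m)%N -> (0 < n)%N ->
  (d_w P (R_ p xi X m n) <= (C / (minn m n)%:R `^ (delta / 2))%:E)%E.
Proof.
have [c [c0 hV]] := V_lower_bound.
have [C0 [C00 i0]] := D_L1 0; have [C1 [C10 i1]] := D_L1 1.
pose K := mean P (fun w => `|h 0 (xi 0 0%N w)| `^ (2 + delta))
  + mean P (fun w => `|h 1 (xi 1 0%N w)| `^ (2 + delta)).
have K0 : 0 <= K by apply: addr_ge0; apply: mean_ge0 => w; exact: powR_ge0.
have L0 : 0 <= stein_lip :> R by have := @stein_cst_ge4 R; rewrite /stein_lip; lra.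
have d20 : 0 <= 2 + delta by have := delta01; lra.
have dh : 2^-1 + -1 <= - (delta / 2) by have := delta01; lra.
have lincomb (u v x1 x2 r y : R) : `|u| <= x1 / y -> `|v| <= r -> r <= x2 / y ->
    0 <= 1 / y -> - (u + v) <= (x1 + x2 + 1) / y.
  move=> + + + y1; rewrite !mulrDl.
  by have := ler_norm (- u); have := ler_norm (- v); rewrite !normrN; lra.
(* As V >= (c / N) `^ (1 / 2) with N = minn m n, B1 comes from env_clt and B2
   from the replacement of the statistic by S. *)
pose B1 := 3 * stein_lip * (8 * (c `^ (- (1 + delta / 2)) * K)).
pose B2 := (C0 + C1) * c `^ (- (2^-1)).
have B10 : 0 <= B1 by exact: mulr_ge0 (mulr_ge0 (ler0n _ _) L0) (mulr_ge0 (ler0n _ _) (mulr_ge0 (powR_ge0 _ _) K0)).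
have B20 : 0 <= B2 by exact: mulr_ge0 (addr_ge0 C00 C10) (powR_ge0 _ _).
exists (B1 + B2 + 1); split; first by rewrite ltr_pwDr// addr_ge0.
move=> m n m0 n0.
have [V0 Vc VE] := hV m n m0 n0.
have iR := intg_R m0 n0.
have [s [ms s1 ->]] := d_w_stein (intg_measurable iR) iR.
rewrite lee_fin.
pose N : R := (minn m n)%:R.
have N0 : 0 < N by rewrite ltr0n leq_min m0 n0.
have N1 : 1 <= N by rewrite ler1n leq_min m0 n0.
have irS := integrable_stein_rhs_comp ms s1 (intg_measurable (intg_S m n)) (intg_S m n).
have irR := integrable_stein_rhs_comp ms s1 (intg_measurable iR) iR.
have main := @env_clt _ _ _ P xi xi_iid delta delta01 h mh hm h_mean m n m0 n0 _ V0 VE s ms s1.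
have Vpow a : 0 <= a -> (V_ p xi m n `^ a)^-1 <= c `^ (- (a / 2)) * N `^ (a / 2).
  move=> a0.
  have e : V_ p xi m n `^ a = (V_ p xi m n ^+ 2) `^ (a / 2).
    by rewrite -(powR_mulrn _ (ltW V0)) -powRrM; congr (_ `^ _); field.
  have le : (c / N) `^ (a / 2) <= V_ p xi m n `^ a.
    rewrite e; apply: ge0_ler_powR; rewrite ?nnegrE ?divr_ge0 ?sqr_ge0//; exact: ltW.
  have cN : 0 < (c / N) `^ (a / 2) by apply: powR_gt0; exact: divr_gt0.
  apply: (@le_trans _ _ ((c / N) `^ (a / 2))^-1).
    by rewrite lef_pV2 ?posrE// (lt_le_trans cN).
  have c0' := ltW c0; have N0' := ltW N0.
  have iN0 : 0 <= N^-1 by rewrite invr_ge0.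
  by rewrite powRM// invfM powRN powRV// invrK.
have first : `|mean P (fun w => stein_rhs s (S m n w))| <= B1 / N `^ (delta / 2).
  apply: (le_trans main); rewrite /B1 -[leRHS]mulrA; apply: ler_wpM2l.
    by apply: mulr_ge0.
  rewrite -!mulrA; apply: ler_wpM2l => //; rewrite -/N -/K.
  have := Vpow (2 + delta); rewrite (_ : (2 + delta) / 2 = 1 + delta / 2); last by field.
  move=> /(_ d20) h1.
  have NN : N `^ (1 + delta / 2) * (N `^ (1 + delta))^-1 = (N `^ (delta / 2))^-1.
    rewrite -!powRN -powRD; first by congr (_ `^ _); field.
    by apply/implyP => _; rewrite gt_eqF.
  rewrite -NN mulrCA [leRHS]mulrCA; apply: ler_wpM2l => //.
  rewrite mulrA; apply: ler_wpM2r h1.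
  by rewrite invr_ge0 powR_ge0.
have second : mean P (fun w => `|R_ p xi X m n w - S m n w|) <= B2 / N `^ (delta / 2).
  have iD0 := intgZ n%:R^-1 (intg_abs (i0 n).1).
  have iD1 := intgZ m%:R^-1 (intg_abs (i1 m).1).
  have iDV := intgZ (V_ p xi m n)^-1 (intgD iD0 iD1).
  have V0' : 0 <= (V_ p xi m n)^-1 by rewrite invr_ge0 ltW.
  apply: (@le_trans _ _ ((V_ p xi m n)^-1 * (n%:R^-1 * C0 + m%:R^-1 * C1))).
    apply: (@le_trans _ _ (mean P (fun w => (V_ p xi m n)^-1 *
      (n%:R^-1 * `|D 0 n w| + m%:R^-1 * `|D 1 m w|)))).
      apply: (mean_le (intg_abs (intgB iR (intg_S m n))) iDV) => w.
      rewrite R_E// addrC addKr normrM ger0_norm//; apply: ler_wpM2l => //.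
      apply: (le_trans (ler_normB _ _)).
      by rewrite !normrM !normfV !normr_nat.
    rewrite (meanZ _ (intgD iD0 iD1)) (meanD iD0 iD1) !(meanZ _ (intg_abs (i0 n).1)) (meanZ _ (intg_abs (i1 m).1)).
    apply: ler_wpM2l => //; apply: lerD; apply: ler_wpM2l; rewrite ?invr_ge0 ?ler0n//.
      exact: (i0 n).2.
    exact: (i1 m).2.
  have Nn : n%:R^-1 <= N^-1 by rewrite lef_pV2 ?posrE ?(ltr0n _ n)// ler_nat geq_minr.
  have Nm : m%:R^-1 <= N^-1 by rewrite lef_pV2 ?posrE ?(ltr0n _ m)// ler_nat geq_minl.
  have h2' : n%:R^-1 * C0 + m%:R^-1 * C1 <= (C0 + C1) * N^-1.
    by rewrite mulrDl ![_ * N^-1]mulrC; apply: lerD; apply: ler_wpM2r.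
  have := Vpow 1 ler01; rewrite (powRr1 (ltW V0)) mul1r => hv.
  have NN : N `^ (2^-1) * N^-1 <= (N `^ (delta / 2))^-1.
    rewrite -[X in _ * X^-1 <= _](powRr1 (ltW N0)) -!powRN -powRD; last first.
      by apply/implyP => _; rewrite gt_eqF.
    exact: ler_powR.
  apply: (@le_trans _ _ ((c `^ (- 2^-1) * N `^ (2^-1)) * ((C0 + C1) * N^-1))).
    apply: ler_pM => //; rewrite addr_ge0// mulr_ge0// ?invr_ge0 ?ler0n//.
  rewrite mulrACA [_ * (C0 + C1)]mulrC; apply: ler_wpM2l => //.
have -> : \int[P]_w stein_rhs s (R_ p xi X m n w) = mean P (fun w => stein_rhs s (S m n w))
    + mean P (fun w => stein_rhs s (R_ p xi X m n w) - stein_rhs s (S m n w)).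
  by rewrite (meanB irR irS) /mean addrC subrK.
have lip : `|mean P (fun w => stein_rhs s (R_ p xi X m n w) - stein_rhs s (S m n w))|
    <= mean P (fun w => `|R_ p xi X m n w - S m n w|).
  apply: (le_trans (mean_abs (intgB irR irS))).
  apply: (mean_le (intg_abs (intgB irR irS)) (intg_abs (intgB iR (intg_S m n)))) => w.
  exact: stein_rhs_lipschitz.
have last : 0 <= 1 / N `^ (delta / 2) by rewrite divr_ge0 ?powR_ge0.
exact: lincomb first lip second last.
Qed.

End pair_of_processes.

Theorem corollary2p1 (R : realType) (d : measure_display)
    (T : measurableType d) (P : probability T R)
    (p : R.-pker R ~> nat)
    (xi : 'I_2 -> nat -> {RV P >-> R})
    (X : 'I_2 -> nat -> nat -> {RV P >-> nat})
    (xi_iid : iid_pairs xi)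
    (X_cond : cond_indep_offspring p xi X)
    (mean_fin : forall l, {ae P, forall w, (offspring_mean p (xi l 0%N w) < +oo)%E})
    (sigma_pos_fin : forall l, (0 < 'V_P[log_mean p xi l 0] < +oo)%E)
    (ZlogZ : ('E_P[(fun w =>
        (branching (X 0) 1 w)%:R / env_mean p xi 0 0 w
          * lnp (branching (X 0) 1 w)%:R
      + (branching (X 1) 1 w)%:R / env_mean p xi 1 0 w
          * lnp (branching (X 1) 1 w)%:R)%R] < +oo)%E)
    (p0 : forall l, {ae P, forall w, p (xi l 0%N w) [set 0%N] = 0%E})
    (rho_cond : (-1 <= rho_ p xi < 1)
      \/ (rho_ p xi = 1 /\ sigma_ p xi 0 <> sigma_ p xi 1))
    (delta : R) (delta_01 : 0 < delta <= 1)
    (moment_M : ('E_P[(fun w => log_mean p xi 0 0 w `^ (2 + delta)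
                              + log_mean p xi 1 0 w `^ (2 + delta))%R] < +oo)%E)
    (q : R) (q_gt1 : 1 < q)
    (moment_Z : ('E_P[(fun w =>
        (branching (X 0) 1 w)%:R `^ q / env_mean p xi 0 0 w `^ q
      + (branching (X 1) 1 w)%:R `^ q / env_mean p xi 1 0 w `^ q)%R] < +oo)%E) :
  exists C : R, 0 < C /\
    forall m n : nat, (0 < m)%N -> (0 < n)%N ->
      (d_w P (R_ p xi X m n) <= (C / (minn m n)%:R `^ (delta / 2))%:E)%E.
Proof.
exact: (d_w_bound xi_iid X_cond mean_fin sigma_pos_fin p0 rho_cond delta_01
  moment_M q_gt1 moment_Z).
Qed.
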